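(* For any $\overline{\varepsilon}>0$, any $n\in\{0,1,2,\ldots\}$, any $\vec{s}\in\mathbb{R}^{2n+1}$ ordered as $s_n^{\uparrow}<s_n^{\downarrow}<\cdots<s_1^{\uparrow}<s_1^{\downarrow}<s_0^{\uparrow}$, and any $\vec{\chi}\in\mathbb{R}^n$ (such that the multi-phase solution $v^{\vec{s},\vec{\chi}}(x,t;\overline{\varepsilon})$ is $2\pi$-periodic in $x$), the dispersive action profile of the reflected multi-phase solution $-v^{\vec{s},\vec{\chi}}(x,t;\overline{\varepsilon})$ is not finite gap: $$n_\star(-v^{\vec{s},\vec{\chi}}(x,t;\overline{\varepsilon}))=\infty .$$
   Context: **Multi-phase solutions.** For $n=0,1,2,\ldots$ and $\vec{s},\vec{\chi}=(\chi_n,\ldots,\chi_1)$ as in the claim, the multi-phase ($n$-phase) solution of the Benjamin–Ono equation $\partial_t v+v\,\partial_x v=\frac{\overline{\varepsilon}}{2}J[\partial_x^2v]$ ($J$ the spatial Hilbert transform) is $$v^{\vec{s},\vec{\chi}}(x,t;\overline{\varepsilon})=s_n^{\uparrow}-\sum_{i=1}^n(s_{i-1}^{\uparrow}-s_i^{\downarrow})+2\overline{\varepsilon}\,\mathrm{Im}\,\partial_x\log\det M(x,t),$$ where $M(x,t)$ is the $n\times n$ matrix with entries ($\delta_{ij}$ the Kronecker delta) $$M_{ij}(x,t)=\frac{1}{s_{i-1}^{\uparrow}-s_j^{\downarrow}}\Big(-1+\delta_{ij}Z_i\,e^{\mathbf{i}\frac{s_{i-1}^{\uparrow}-s_i^{\downarrow}}{\overline{\varepsilon}}\left(x-\chi_i-\frac12(s_i^{\downarrow}+s_{i-1}^{\uparrow})t\right)}\Big),$$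 $$Z_i=\sqrt{\frac{s_{i-1}^{\uparrow}-s_n^{\uparrow}}{s_i^{\downarrow}-s_n^{\uparrow}}}\prod_{j\ne i}\sqrt{\frac{(s_i^{\downarrow}-s_j^{\downarrow})(s_{i-1}^{\uparrow}-s_{j-1}^{\uparrow})}{(s_{i-1}^{\uparrow}-s_j^{\downarrow})(s_i^{\downarrow}-s_{j-1}^{\uparrow})}}.$$ **Lax operator and number of gaps.** Write $w=e^{\mathbf{i}x}$, $\mathbb{T}=\{|w|=1\}$. The Hardy space $H_\bullet$ is the closure of $\mathbb{C}[w]$ in $L^2(\mathbb{T})$ (normalized measure $dx/2\pi$) with orthogonal projection $\pi_\bullet$ and orthonormal basis $|h\rangle=w^h$, $h\ge0$. For bounded real $2\pi$-periodic $v$, the Lax operator $L_\bullet(v;\overline{\varepsilon})=-\overline{\varepsilon}D_\bullet+\pi_\bullet L(v)\pi_\bullet$ is self-adjoint on $H_\bullet$, where $D_\bullet|h\rangle=h|h\rangle$ and $L(v)$ is multiplication by $v$. The function $\Phi_0^{BA}(u|v;\overline{\varepsilon})=\langle0|(u-L_\bullet(v;\overline{\varepsilon}))^{-1}|0\rangle$ is meromorphic in $u\in\mathbb{C}$ with simple real poles $S_i^{\uparrow}$ and simple real zeroes $S_i^{\downarrow}$ strictly interlacing as $\cdots<S_1^{\uparrow}<S_1^{\downarrow}<S_0^{\uparrow}$ with no accumulation point except $-\infty$. The dispersive action profile of $v$ is the piecewise-linear function of $c\in\mathbb{R}$ with slopes $\pm1$, local minima at the $S_i^{\uparrow}$ and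 local maxima at the $S_i^{\downarrow}$, asymptotic to $|c-a|$ as $c\to\pm\infty$, where $a=\int_0^{2\pi}v\,\frac{dx}{2\pi}$; its gaps are the intervals $(S_i^{\uparrow},S_i^{\downarrow})$, $i\ge1$, and $n_\star(v)\in\{0,1,2,\ldots\}\cup\{\infty\}$ is the number of non-empty gaps.
   Formalization: The case n = 0 is excluded (n ≥ 1 is assumed): for n = 0 the solution is the constant s_0^↑, Φ_0^{BA}(u|-v) = 1/(u + s_0^↑) has one pole and no zero, so n_⋆(-v) = 0 and the claim fails there. *)

(* Defs.v *)
From HB Require Import structures.
From mathcomp Require Import all_boot all_order all_algebra.
From mathcomp Require Import complex.
From mathcomp Require Import all_classical all_reals all_analysis.

Set Implicit Arguments.
Unset Strict Implicit.
Unset Printing Implicit Defensive.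

Import Order.TTheory GRing.Theory Num.Theory.
Import numFieldNormedType.Exports ComplexField.Normc.

Local Open Scope classical_set_scope.
Local Open Scope complex_scope.
Local Open Scope ring_scope.

(* exp(i x) for real x *)
Definition expi (R : realType) (x : R) : R[i] := cos x +i* sin x.

(* Derivative of a complex-valued function of a real variable. *)
Definition cderive1 (R : realType) (f : R -> R[i]) (x : R) : R[i] :=
  derive1 (fun y => complex.Re (f y)) x +i*
  derive1 (fun y => complex.Im (f y)) x.

Section MultiPhase.
Context {R : realType}.

(* With indices starting at 0, [su i] is s_i^up for 0 <= i <= n, while [sd i]
   and [chi i] are s_(i+1)^down and chi_(i+1) for 0 <= i < n.  Accordingly the
   1-based phase i+1 involves [sup_prev su i] = s_i^up, [sd i] = s_(i+1)^down
   and [sup_next su i] = s_(i+1)^up. *)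
Definition sup_prev n (su : 'I_n.+1 -> R) (i : 'I_n) : R :=
  su (widen_ord (leqnSn n) i).

Definition sup_next n (su : 'I_n.+1 -> R) (i : 'I_n) : R := su (lift ord0 i).

(* s_n^up < s_n^down < ... < s_1^up < s_1^down < s_0^up *)
Definition interlaced n (su : 'I_n.+1 -> R) (sd : 'I_n -> R) : Prop :=
  forall i : 'I_n, sup_next su i < sd i < sup_prev su i.

Definition phase_Z n (su : 'I_n.+1 -> R) (sd : 'I_n -> R) (i : 'I_n) : R :=
  Num.sqrt ((sup_prev su i - su ord_max) / (sd i - su ord_max)) *
  \prod_(j < n | j != i)
    Num.sqrt (((sd i - sd j) * (sup_prev su i - sup_prev su j)) /
              ((sup_prev su i - sd j) * (sd i - sup_prev su j))).

Definition phase_matrix (eps : R) n (su : 'I_n.+1 -> R) (sd chi : 'I_n -> R)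
    (x t : R) : 'M[R[i]]_n :=
  \matrix_(i < n, j < n)
    ((sup_prev su i - sd j)^-1%:C *
     (- 1 + (i == j)%:R * (phase_Z su sd i)%:C *
        expi ((sup_prev su i - sd i) / eps *
              (x - chi i - 2^-1 * (sd i + sup_prev su i) * t)))).

(* The x-derivative of log det M is the logarithmic derivative
   (det M)'/(det M), which needs no choice of a branch of log. *)
Definition multi_phase (eps : R) n (su : 'I_n.+1 -> R) (sd chi : 'I_n -> R)
    (x t : R) : R :=
  let tau y := \det (phase_matrix eps su sd chi y t) in
  su ord_max - \sum_(i < n) (sup_prev su i - sd i)
  + 2 * eps * complex.Im (cderive1 tau x / tau x).

End MultiPhase.

(* Functions on the circle T = {|w| = 1}, w = e^{ix}, are functions of
   x in [0, 2 pi]; only their values there matter, up to a null set. *)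
Section Circle.
Context {R : realType}.
Local Notation mu := (@lebesgue_measure R).

Definition circle : set R := `[0, 2 * pi].

(* \int_0^{2 pi} f dx / 2 pi *)
Definition cmean (f : R -> R[i]) : R[i] :=
  ((2 * pi)^-1)%:C *
  ((\int[mu]_(x in circle) complex.Re (f x)) +i*
   (\int[mu]_(x in circle) complex.Im (f x))).

Definition L2circle (f : R -> R[i]) : Prop :=
  [/\ measurable_fun circle (fun x => complex.Re (f x)),
      measurable_fun circle (fun x => complex.Im (f x)) &
      mu.-integrable circle (fun x => (normc (f x) ^+ 2)%:E)].

Definition inner (f g : R -> R[i]) : R[i] := cmean (fun x => (f x)^* * g x).

Definition sqnorm (f : R -> R[i]) : R := complex.Re (inner f f).

(* the basis vector |h> = w^h *)
Definition ket (h : nat) : R -> R[i] := fun x => expi x ^+ h.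

(* The Hardy space: the closure of C[w] in L^2(T). *)
Definition hardy (f : R -> R[i]) : Prop :=
  L2circle f /\
  forall e : R, 0 < e ->
    exists p : {poly R[i]}, sqnorm (fun x => f x - p.[expi x]) < e.

(* g is the orthogonal projection of f onto the Hardy space. *)
Definition szego_proj (f g : R -> R[i]) : Prop :=
  hardy g /\ forall q, hardy q -> inner q (fun x => f x - g x) = 0.

(* f lies in the domain of the self-adjoint operator D|h> = h|h>,
   and g = D f. *)
Definition Dop (f g : R -> R[i]) : Prop :=
  [/\ hardy f, hardy g &
      forall h : nat, inner (ket h) g = h%:R * inner (ket h) f].

(* f lies in the domain of the Lax operator L(v; eps) = - eps D + pi v pi,
   and g = L(v; eps) f. *)
Definition Lax (eps : R) (v : R -> R) (f g : R -> R[i]) : Prop :=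
  exists Df Tf, [/\ Dop f Df, szego_proj (fun x => (v x)%:C * f x) Tf &
    g = (fun x => - eps%:C * Df x + Tf x)].

(* Phi u = <0| (u - L)^-1 |0> = <0|f> where (u - L) f = |0>.  The default value
   0 is only taken at points u of the spectrum of L. *)
Definition Phi (eps : R) (v : R -> R) (u : R[i]) : R[i] :=
  xget 0 [set c | exists f Lf, [/\ Lax eps v f Lf,
    {ae mu, forall x, circle x -> u * f x - Lf x = ket 0 x} &
    c = inner (ket 0) f]].

(* Real poles S_i^up and zeroes S_i^down of the meromorphic function Phi, whose
   singularities are isolated: limits over punctured complex neighborhoods
   ignore the values of Phi on the spectrum, and so see through removable
   singularities (eigenvalues with eigenvector orthogonal to |0>). *)
Definition Phi_pole (eps : R) (v : R -> R) (s : R) : Prop :=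
  normc (Phi eps v u) @[u --> (s%:C : R[i]^o)^'] --> +oo.

Definition Phi_zero (eps : R) (v : R -> R) (s : R) : Prop :=
  normc (Phi eps v u) @[u --> (s%:C : R[i]^o)^'] --> (0 : R).

(* The gaps (S_i^up, S_i^down), i >= 1, of the dispersive action profile of v,
   as pairs of endpoints: a pole (local minimum of the profile) and the next
   zero above it (local maximum), with no further pole or zero in between. *)
Definition gaps (eps : R) (v : R -> R) : set (R * R) :=
  [set g | [/\ Phi_pole eps v g.1, Phi_zero eps v g.2, g.1 < g.2 &
    forall s, g.1 < s < g.2 -> ~ Phi_pole eps v s /\ ~ Phi_zero eps v s]].

(* n_star(v), in {0, 1, 2, ...} U {+oo} *)
Definition n_star (eps : R) (v : R -> R) : \bar R := counting (gaps eps v).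

End Circle.

(* Main.v *)
Require Import Defs.
From HB Require Import structures.
From mathcomp Require Import all_boot all_order all_algebra.
From mathcomp Require Import fingroup perm complex.
From mathcomp Require Import all_classical all_reals all_analysis.
From mathcomp Require Import measurable_realfun.
From mathcomp Require Import ring lra zify.

Set Implicit Arguments.
Unset Strict Implicit.
Unset Printing Implicit Defensive.

Import Order.TTheory GRing.Theory Num.Theory.
Import numFieldNormedType.Exports ComplexField.Normc.

Local Open Scope classical_set_scope.
Local Open Scope complex_scope.
Local Open Scope ring_scope.

Local Notation Re := complex.Re.
Local Notation Im := complex.Im.

(* For real x, det M(x) = c e^{iKx} nu(x) with nu = det (1 - N) and N = (DE)^-1 C,
   where C is a Cauchy matrix, E_i the exponentials and D_i = Z_i / (s_{i-1} - s_i).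
   The constants Z_i make N a strict contraction, for a weighted norm, in the half
   plane Im x <= 0; so nu = 1 + (exponentials of negative frequency) has no zero
   there and 1/nu is approximated by exponential sums of frequency <= 0.  If v is
   2pi-periodic, the difference of the logarithmic derivatives of nu at x + 2pi
   and x is real, so its square equals its squared modulus; the former has mean 0,
   hence nu is 2pi-periodic, i.e. nu = prod (1 - p e^{-ix}) with 0 < |p| < 1, and
     v = a + 2 eps Re sum_z z w / (1 - z w),   z ranging over the conjugates of p.

   The Lax operator L of -v is minus eps D plus a Toeplitz operator on sequences.
   Its eigenvalues S_j -> -oo and the masses a_j of |0> are limits of those of the
   truncated matrices, and Phi(u) = sum_j a_j / (u - S_j).  If only finitely many
   a_j were nonzero, then q(L)|0> = 0 for the nonzero polynomial q = prod (X - S_j).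
   But, as a power series in w, L^j |0> has a pole of order exactly j at w = 1/z:
   one more application of L raises the order by one and multiplies the leading
   coefficient by a nonzero multiple of j + mult(z), mult(z) being the multiplicity
   of z.  (For v itself the factor is j - mult(z), which vanishes at j = mult(z).)
   So Phi has infinitely many poles, and between consecutive poles it decreases
   from +oo to -oo through one zero. *)

(** * Complex numbers *)

(** L is unbounded, so its spectral decomposition is not taken for granted: [Phi] is read off finite
    hermitian truncations. Their limits are harmless because the Fourier coefficients of v decay
    geometrically. The Toeplitz part is then bounded for every weight (1 + h)^p, resolvent vectors
    and iterates L^j |0> decay faster than any power of h, and truncation errors vanish. Limits of
    distinct eigenvalues may coincide; masses are nonnegative, so nothing cancels. The strictness of
    the contraction comes from the first factor of Z_i. The products alone would make N an isometry
    on the real line; (s_{i-1}^up - s_n^up) / (s_i^down - s_n^up) > 1 supplies the ratio [theta] <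
    1. A priori nu has arbitrary real frequencies, and periodicity of v only concerns the imaginary
    part of nu'/nu. The mean-value argument that exploits it stays within finite exponential sums:
    1/nu is replaced by an approximate inverse with uniform error 1/8. *)

Section ComplexNorm.
Context {R : realType}.
Implicit Types (x y z : R[i]) (a b : R).

Lemma complex_eqP x y : Re x = Re y -> Im x = Im y -> x = y.
Proof. by case: x => a b; case: y => c d /= -> ->. Qed.

Lemma normc_ge0 x : 0 <= normc x.
Proof. by case: x => a b; exact: sqrtr_ge0. Qed.

Lemma sqr_normcE x : normc x ^+ 2 = Re x ^+ 2 + Im x ^+ 2.
Proof. by case: x => a b /=; rewrite sqr_sqrtr// addr_ge0 ?sqr_ge0. Qed.

Lemma mulcJ x : x * x^* = (normc x ^+ 2)%:C.
Proof.
rewrite sqr_normcE; case: x => a b; apply: complex_eqP => /=; last by ring.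
by rewrite mulrN opprK !expr2.
Qed.

Lemma mulJc x : x^* * x = (normc x ^+ 2)%:C.
Proof. by rewrite mulrC mulcJ. Qed.

Lemma normc_eq0 x : (normc x == 0) = (x == 0).
Proof.
by apply/eqP/eqP => [/eq0_normc //|->]; rewrite normc0.
Qed.

Lemma normc_gt0 x : (0 < normc x) = (x != 0).
Proof. by rewrite lt_def normc_ge0 andbT normc_eq0. Qed.

Lemma normcD x y : normc (x + y) <= normc x + normc y.
Proof. exact: le_normcD. Qed.

Lemma normcNE x : normc (- x) = normc x.
Proof. exact: normcN. Qed.

Lemma normcBC x y : normc (x - y) = normc (y - x).
Proof. by rewrite -normcNE opprB. Qed.

Lemma normcB_ge x y : normc x - normc y <= normc (x - y).
Proof. by rewrite lerBlDr -{1}(subrK y x) normcD. Qed.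

Lemma normcJE x : normc x^* = normc x.
Proof. by case: x => a b /=; rewrite sqrrN. Qed.

Lemma normcR a : normc a%:C = `|a|.
Proof. by rewrite /= expr0n addr0 sqrtr_sqr. Qed.

Lemma normc_nat n : normc (n%:R : R[i]) = n%:R.
Proof. by rewrite -(rmorph_nat (real_complex R)) normcR normr_nat. Qed.

Lemma normcXE x n : normc (x ^+ n) = normc x ^+ n.
Proof.
by elim: n => [|n IH]; rewrite ?expr0 ?normc1// !exprS normcM IH.
Qed.

Lemma normc_sum (I : Type) (r : seq I) (P : pred I) (F : I -> R[i]) :
  normc (\sum_(i <- r | P i) F i) <= \sum_(i <- r | P i) normc (F i).
Proof.
elim/big_rec2: _ => [|i y1 y2 _ h]; first by rewrite normc0.
by apply: le_trans (normcD _ _) _; rewrite lerD2l.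
Qed.

Lemma normc_prod (I : Type) (r : seq I) (P : pred I) (F : I -> R[i]) :
  normc (\prod_(i <- r | P i) F i) = \prod_(i <- r | P i) normc (F i).
Proof.
by elim/big_rec2: _ => [|i y1 y2 _ h]; rewrite ?normc1// normcM h.
Qed.

Lemma normc_Re x : `|Re x| <= normc x.
Proof.
rewrite -(@ler_pXn2r _ 2)// ?nnegrE ?normc_ge0// sqr_normcE real_normK ?num_real//.
by rewrite lerDl sqr_ge0.
Qed.

Lemma normc_Im x : `|Im x| <= normc x.
Proof.
rewrite -(@ler_pXn2r _ 2)// ?nnegrE ?normc_ge0// sqr_normcE real_normK ?num_real//.
by rewrite lerDr sqr_ge0.
Qed.

Lemma normc_leD x : normc x <= `|Re x| + `|Im x|.
Proof.
have -> : x = (Re x)%:C + 'i * (Im x)%:C.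
  by case: x => a b; apply: complex_eqP => /=; ring.
apply: le_trans (normcD _ _) _; rewrite normcM !normcR /= !(mul0r, mul1r, addr0, add0r, subr0).
by rewrite expr0n expr1n add0r sqrtr1 mul1r.
Qed.

Lemma ReD x y : Re (x + y) = Re x + Re y.
Proof. by case: x => a b; case: y => c d. Qed.
Lemma ImD x y : Im (x + y) = Im x + Im y.
Proof. by case: x => a b; case: y => c d. Qed.
Lemma ReN x : Re (- x) = - Re x. Proof. by case: x. Qed.
Lemma ImN x : Im (- x) = - Im x. Proof. by case: x. Qed.
Lemma ReM x y : Re (x * y) = Re x * Re y - Im x * Im y.
Proof. by case: x => a b; case: y => c d. Qed.
Lemma ImM x y : Im (x * y) = Re x * Im y + Im x * Re y.
Proof. by case: x => a b; case: y => c d. Qed.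
Lemma ReZ a x : Re (a%:C * x) = a * Re x.
Proof. by rewrite ReM /= mul0r subr0. Qed.
Lemma ReJ x : Re x^* = Re x. Proof. by case: x. Qed.
Lemma ImJ x : Im x^* = - Im x. Proof. by case: x. Qed.

Lemma Re_sum (I : Type) (r : seq I) (P : pred I) (F : I -> R[i]) :
  Re (\sum_(i <- r | P i) F i) = \sum_(i <- r | P i) Re (F i).
Proof. by elim/big_rec2: _ => //= i y1 y2 _ <-; rewrite ReD. Qed.
Lemma Im_sum (I : Type) (r : seq I) (P : pred I) (F : I -> R[i]) :
  Im (\sum_(i <- r | P i) F i) = \sum_(i <- r | P i) Im (F i).
Proof. by elim/big_rec2: _ => //= i y1 y2 _ <-; rewrite ImD. Qed.

Lemma conjcB x y : (x - y)^* = x^* - y^*. Proof. exact: rmorphB. Qed.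
Lemma conjcM x y : (x * y)^* = x^* * y^*. Proof. exact: rmorphM. Qed.
Lemma conjc_sum (I : Type) (r : seq I) (P : pred I) (F : I -> R[i]) :
  (\sum_(i <- r | P i) F i)^* = \sum_(i <- r | P i) (F i)^*.
Proof. exact: rmorph_sum. Qed.

Lemma expiD a b : expi (a + b) = expi a * expi b.
Proof.
rewrite /expi cosD sinD; apply: complex_eqP => /=; first by [].
by rewrite addrC.
Qed.

Lemma expi0 : expi (0 : R) = 1.
Proof. by rewrite /expi cos0 sin0. Qed.

Lemma expiN a : expi (- a) = (expi a)^*.
Proof. by rewrite /expi cosN sinN. Qed.

Lemma normc_expi a : normc (expi a) = 1.
Proof. by rewrite /expi /= cos2Dsin2 sqrtr1. Qed.

Lemma expi_neq0 a : expi a != 0.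
Proof. by rewrite -normc_gt0 normc_expi. Qed.

Lemma expiMn a n : expi (a *+ n) = expi a ^+ n.
Proof. by elim: n => [|n IH]; rewrite ?expi0// mulrS exprS expiD IH. Qed.

Lemma expi_period a : expi (a + 2 * pi) = expi a.
Proof.
rewrite /expi.
have -> : a + 2 * pi = a + pi *+ 2 by rewrite mulr_natl.
by rewrite cosD2pi sinD2pi.
Qed.

End ComplexNorm.

(** * Limits along an ultrafilter *)

(* Ultralimits make every bounded sequence converge, which replaces the diagonal
   extraction of subsequences. *)
Definition nat_ultra : set_system nat :=
  sval (cid (ultraFilterLemma eventually_filter)).

Instance nat_ultra_ultra : UltraFilter nat_ultra.
Proof. by case: (svalP (cid (ultraFilterLemma eventually_filter))). Qed.

Instance nat_ultra_proper : ProperFilter nat_ultra.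
Proof. exact: ultra_proper. Qed.

Lemma near_ultra (P : nat -> Prop) (N : nat) :
  (forall n, (N <= n)%N -> P n) -> \forall n \near nat_ultra, P n.
Proof.
move=> h; have [_ sub] := svalP (cid (ultraFilterLemma eventually_filter)).
by apply: sub; exists N.
Qed.

Section UltraLimit.
Context {R : realType}.
Local Notation U := nat_ultra.
Implicit Types (f g : nat -> R) (F G : nat -> R[i]).

Definition ulim f : R := lim (f @ U).

Definition ubounded f := exists X, \forall n \near U, `|f n| <= X.

(** Compactness of [-X, X] gives a cluster point, and a cluster point of an ultrafilter is a
    limit. *)
Lemma ulim_cvg f : ubounded f -> f @ U --> ulim f.
Proof.
move=> [X fX]; apply/cvg_ex.
have cK : compact `[-X, X]%classic by exact: segment_compact.
have fK : (f @ U) `[-X, X]%classic.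
  by apply: filterS fX => n /=; rewrite in_itv /= ler_norml.
have [p [_ pc]] := cK _ _ fK.
exists p => A pA.
have [//|nA] := @in_ultra_setVsetC _ U (f @^-1` A) _.
have [q [/= nAq Aq]] := pc (~` A) A nA pA.
by case: nAq.
Qed.

Lemma ulimE f l : f @ U --> l -> ulim f = l.
Proof. exact: cvg_lim. Qed.

Lemma ubounded_cst (a : R) : ubounded (fun=> a).
Proof. by exists `|a|; near=> n. Unshelve. all: end_near. Qed.

Lemma uboundedD f g : ubounded f -> ubounded g -> ubounded (fun n => f n + g n).
Proof.
move=> [X fX] [Y gY]; exists (X + Y); near=> n.
by apply: le_trans (ler_normD _ _) _; apply: lerD; near: n.
Unshelve. all: end_near. Qed.

Lemma uboundedM f g : ubounded f -> ubounded g -> ubounded (fun n => f n * g n).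
Proof.
move=> [X fX] [Y gY]; exists (X * Y); near=> n.
by rewrite normrM; apply: ler_pM => //; near: n.
Unshelve. all: end_near. Qed.

Lemma uboundedN f : ubounded f -> ubounded (fun n => - f n).
Proof. by move=> [X fX]; exists X; near=> n; rewrite normrN; near: n.
Unshelve. all: end_near. Qed.

Lemma ulim_cst (a : R) : ulim (fun=> a) = a.
Proof. by apply: ulimE; exact: cvg_cst. Qed.

Lemma ulimD f g : ubounded f -> ubounded g ->
  ulim (fun n => f n + g n) = ulim f + ulim g.
Proof. by move=> bf bg; apply: ulimE; apply: cvgD; exact: ulim_cvg. Qed.

Lemma ulimM f g : ubounded f -> ubounded g ->
  ulim (fun n => f n * g n) = ulim f * ulim g.
Proof. by move=> bf bg; apply: ulimE; apply: cvgM; exact: ulim_cvg. Qed.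

Lemma ulimN f : ubounded f -> ulim (fun n => - f n) = - ulim f.
Proof. by move=> bf; apply: ulimE; apply: cvgN; exact: ulim_cvg. Qed.

Lemma ulim_le f g : ubounded f -> ubounded g ->
  (\forall n \near U, f n <= g n) -> ulim f <= ulim g.
Proof.
move=> bf bg fg.
by apply: (ler_cvg_to (ulim_cvg bf) (ulim_cvg bg)) fg.
Qed.

Lemma near_eq_ulim f g : (\forall n \near U, f n = g n) -> ulim f = ulim g.
Proof.
move=> fg; congr (lim _); apply/seteqP; split => A /=; rewrite /fmap /nbhs /=;
  by apply: filterS2 fg => n; rewrite /preimage /= => ->.
Qed.

Lemma ulim_near f (e : R) : ubounded f -> 0 < e ->
  \forall n \near U, `|f n - ulim f| < e.
Proof.
move=> bf e0; have /cvgrPdist_lt/(_ e e0) := ulim_cvg bf.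
by apply: filterS => n; rewrite distrC.
Qed.

Definition culim F : R[i] :=
  ulim (fun n => Re (F n)) +i* ulim (fun n => Im (F n)).

Definition cbounded F := exists X, \forall n \near U, normc (F n) <= X.

Lemma cbounded_Re F : cbounded F -> ubounded (fun n => Re (F n)).
Proof.
move=> [X FX]; exists X; apply: filterS FX => n; exact: le_trans (normc_Re _).
Qed.

Lemma cbounded_Im F : cbounded F -> ubounded (fun n => Im (F n)).
Proof.
move=> [X FX]; exists X; apply: filterS FX => n; exact: le_trans (normc_Im _).
Qed.

Hint Resolve cbounded_Re cbounded_Im : core.

Lemma cbounded_cst (a : R[i]) : cbounded (fun=> a).
Proof. by exists (normc a); near=> n. Unshelve. all: end_near. Qed.

Lemma cboundedD F G : cbounded F -> cbounded G -> cbounded (fun n => F n + G n).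
Proof.
move=> [X fX] [Y gY]; exists (X + Y); near=> n.
by apply: le_trans (normcD _ _) _; apply: lerD; near: n.
Unshelve. all: end_near. Qed.

Lemma cboundedM F G : cbounded F -> cbounded G -> cbounded (fun n => F n * G n).
Proof.
move=> [X fX] [Y gY]; exists (X * Y); near=> n.
by rewrite normcM; apply: ler_pM; rewrite ?normc_ge0//; near: n.
Unshelve. all: end_near. Qed.

Lemma cboundedN F : cbounded F -> cbounded (fun n => - F n).
Proof. by move=> [X fX]; exists X; near=> n; rewrite normcNE; near: n.
Unshelve. all: end_near. Qed.

Lemma cbounded_sum (I : Type) (r : seq I) (F : I -> nat -> R[i]) :
  (forall i, cbounded (F i)) -> cbounded (fun n => \sum_(i <- r) F i n).
Proof.
move=> bF; elim: r => [|i r IH].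
  by under [X in cbounded X]eq_fun do rewrite big_nil; exact: cbounded_cst.
by under [X in cbounded X]eq_fun do rewrite big_cons; exact: cboundedD.
Qed.

Lemma cboundedR f : ubounded f -> cbounded (fun n => (f n)%:C).
Proof. by move=> [X fX]; exists X; near=> n; rewrite normcR; near: n.
Unshelve. all: end_near. Qed.

Lemma culimR f : culim (fun n => (f n)%:C) = (ulim f)%:C.
Proof. by apply: complex_eqP => //=; rewrite ulim_cst. Qed.

Lemma culim_cst (a : R[i]) : culim (fun=> a) = a.
Proof. by case: a => a b; rewrite /culim !ulim_cst. Qed.

Lemma culimD F G : cbounded F -> cbounded G ->
  culim (fun n => F n + G n) = culim F + culim G.
Proof.
move=> bF bG; apply: complex_eqP; rewrite ?ReD ?ImD /=.
  by rewrite -ulimD; auto; congr ulim; apply/funext => n; rewrite ReD.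
by rewrite -ulimD; auto; congr ulim; apply/funext => n; rewrite ImD.
Qed.

Lemma culimM F G : cbounded F -> cbounded G ->
  culim (fun n => F n * G n) = culim F * culim G.
Proof.
move=> bF bG; apply: complex_eqP; rewrite ?ReM ?ImM /=.
  under [X in ulim X]eq_fun do rewrite ReM.
  rewrite ulimD ?ulimN ?ulimM //; auto using uboundedM, uboundedN.
under [X in ulim X]eq_fun do rewrite ImM.
rewrite ulimD ?ulimM //; auto using uboundedM.
Qed.

Lemma culimN F : cbounded F -> culim (fun n => - F n) = - culim F.
Proof.
move=> bF; apply: complex_eqP; rewrite ?ReN ?ImN /= -ulimN; auto;
congr ulim; apply/funext => n; by rewrite ?ReN ?ImN.
Qed.

Lemma culimB F G : cbounded F -> cbounded G ->
  culim (fun n => F n - G n) = culim F - culim G.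
Proof. by move=> bF bG; rewrite culimD ?culimN//; exact: cboundedN. Qed.

Lemma culim_sum (I : Type) (r : seq I) (F : I -> nat -> R[i]) :
  (forall i, cbounded (F i)) ->
  culim (fun n => \sum_(i <- r) F i n) = \sum_(i <- r) culim (F i).
Proof.
move=> bF; elim: r => [|i r IH].
  by under [X in culim X]eq_fun do rewrite big_nil; rewrite culim_cst big_nil.
under [X in culim X]eq_fun do rewrite big_cons.
by rewrite big_cons culimD ?IH//; exact: cbounded_sum.
Qed.

Lemma near_eq_culim F G : (\forall n \near U, F n = G n) -> culim F = culim G.
Proof.
by move=> fg; apply: complex_eqP; apply: near_eq_ulim;
  apply: filterS fg => n ->.
Qed.

Lemma culim_near F (e : R) : cbounded F -> 0 < e ->
  \forall n \near U, normc (F n - culim F) <= e.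
Proof.
move=> bF e0; near=> n.
apply: le_trans (normc_leD _) _; rewrite ReD ImD ReN ImN (splitr e); apply: lerD.
  by apply/ltW; near: n; apply: ulim_near; auto; exact: divr_gt0.
by apply/ltW; near: n; apply: ulim_near; auto; exact: divr_gt0.
Unshelve. all: end_near. Qed.

Lemma normc_culim F X : (\forall n \near U, normc (F n) <= X) ->
  normc (culim F) <= X.
Proof.
move=> FX; apply/ler_addgt0Pr => e e0.
have bF : cbounded F by exists X.
have h : \forall n \near U, normc (culim F) <= X + e.
  near=> n; rewrite -(subrK (F n) (culim F)) addrC.
  apply: le_trans (normcD _ _) _; apply: lerD; first by near: n.
  by rewrite normcBC; near: n; exact: culim_near.
by have [n] := filter_ex h.
Unshelve. all: end_near. Qed.

Lemma culimP F l : (forall e : R, 0 < e -> \forall n \near U, normc (F n - l) <= e) ->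
  culim F = l.
Proof.
move=> h; have bF : cbounded F.
  exists (1 + normc l); apply: filterS (h 1 ltr01) => n hn.
  by rewrite -{1}(subrK l (F n)); apply: le_trans (normcD _ _) _; rewrite lerD2r.
apply/eqP; rewrite -subr_eq0 -normc_eq0 eq_le normc_ge0 andbT.
apply/ler_addgt0Pr => e e0; rewrite add0r.
have -> : culim F - l = culim (fun n => F n - l).
  by rewrite culimB ?culim_cst//; exact: cbounded_cst.
exact: normc_culim (h _ e0).
Qed.

Lemma normc_culimB F l X : (\forall n \near U, normc (F n - l) <= X) ->
  normc (culim F - l) <= X.
Proof.
move=> h; have bF : cbounded F.
  exists (X + normc l); apply: filterS h => n hn.
  by rewrite -{1}(subrK l (F n)); apply: le_trans (normcD _ _) _; rewrite lerD2r.
have -> : culim F - l = culim (fun n => F n - l).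
  by rewrite culimB ?culim_cst//; exact: cbounded_cst.
exact: normc_culim.
Qed.

End UltraLimit.

(** * Eigenvalues of hermitian matrices *)

Section HermitianSpectral.
Context {R : realType}.
Local Notation C := R[i].
Local Open Scope sesquilinear_scope.

(** Everything is indexed by natural numbers, so that truncations of different sizes M can be
    compared and a limit in M taken. The decreasing order is the one that the min-max bounds
    need. *)
Lemma hermitian_eigenbasis (A : nat -> nat -> C) (M : nat)
    (A_herm : forall h k, A h k = (A k h)^*) :
  exists (S : nat -> R) (phi : nat -> nat -> C),
  [/\ forall j k, (j < M)%N -> (k < M)%N ->
        \sum_(h < M) (phi j h)^* * phi k h = (j == k)%:R,
      forall h k, (h < M)%N -> (k < M)%N ->
        \sum_(j < M) phi j h * (phi j k)^* = (h == k)%:R,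
      forall j h, (j < M)%N -> (h < M)%N ->
        \sum_(k < M) A h k * phi j k = (S j)%:C * phi j h &
      forall j k, (j <= k)%N -> (k < M)%N -> S k <= S j].
Proof.
case: M => [|m]; first by exists (fun=> 0), (fun _ _ => 0); split.
set M := m.+1.
pose B : 'M[C]_M := \matrix_(i, j) A i j.
have Bh : B \is hermsymmx.
  apply/is_hermitianmxP; rewrite expr0 scale1r.
  by apply/matrixP => i j; rewrite !mxE [LHS]A_herm.
have sreal := hermitian_spectral_diag_real Bh.
have /orthomx_spectralP := hermitian_normalmx Bh.
set P := spectralmx B; set sp := spectral_diag B => BE.
have PU : P \is unitarymx := spectral_unitarymx B.
have PPt : P *m P ^t* = 1%:M by apply/unitarymxP.
have PtP : P ^t* *m P = 1%:M by rewrite -(invmx_unitary PU) mulVmx// unitarymx_unit.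
have BP : B *m P ^t* = P ^t* *m diag_mx sp.
  by rewrite {1}BE (invmx_unitary PU) -!mulmxA PPt mulmx1.
pose lam (i : 'I_M) : R := Re (sp 0 i).
have spE i : sp 0 i = (lam i)%:C.
  have /complex_realP[k ek] : sp 0 i \is Num.real.
    by move/mxOverP : sreal => /(_ 0 i).
  by rewrite /lam ek.
pose le_lam (i j : 'I_M) := lam j <= lam i.
pose s := sort le_lam (enum 'I_M).
have ss : size s = M by rewrite size_sort size_enum_ord.
have us : uniq s by rewrite sort_uniq enum_uniq.
have sord : sorted le_lam s by apply: sort_sorted => i j; exact: le_total.
pose idx j := nth ord0 s j.
have sumidx (f : 'I_M -> C) : \sum_(j < M) f (idx j) = \sum_i f i.
  have -> : \sum_i f i = \sum_(i <- s) f i.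
    rewrite -big_enum; apply: perm_big; rewrite perm_sym.
    by rewrite /s perm_sort enumT.
  by rewrite [RHS](big_nth ord0) ss big_mkord.
(* By [BP] the eigenvectors are the columns of the adjoint of [P], that is the conjugated rows of
   [P]; [idx] lists them by decreasing eigenvalue. *)
exists (fun j => lam (idx j)), (fun j h => (P (idx j) (inord h))^*); split.
- move=> j k jM kM.
  have /matrixP/(_ (idx j) (idx k)) := PPt; rewrite !mxE.
  rewrite /idx nth_uniq ?ss// => <-; apply: eq_bigr => h _.
  by rewrite !mxE conjCK inord_val.
- move=> h k hM kM; rewrite (sumidx (fun i => (P i (inord h))^* * (P i (inord k))^*^*)).
  have /matrixP/(_ (inord h) (inord k)) := PtP; rewrite !mxE.
  rewrite -val_eqE /= !inordK// => <-; apply: eq_bigr => i _.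
  by rewrite !mxE conjCK.
- move=> j h jM hM.
  have /matrixP/(_ (inord h) (idx j)) := BP; rewrite !mxE.
  under eq_bigr do rewrite !mxE.
  rewrite inordK// => BE'.
  under eq_bigr do rewrite inord_val.
  rewrite BE' (bigD1 (idx j))//= big1 => [|i ij].
    by rewrite !mxE eqxx mulr1n spE addr0 mulrC.
  by rewrite !mxE (negbTE ij) mulr0n mulr0.
- move=> j k jk kM; rewrite /=.
  have := @sorted_leq_nth _ le_lam _ _ ord0 s sord j k.
  by apply => //; rewrite ?inE ?ss ?(leq_ltn_trans jk)//; [move=> ? ? ?; rewrite /le_lam => h1 h2; exact: le_trans h2 h1 | move=> ?; exact: lexx].
Qed.

End HermitianSpectral.

Definition ndist (h k : nat) : nat := ((h - k) + (k - h))%N.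

(** * Eigenvector expansions and min-max bounds *)

Section Truncation.
Context {R : realType}.
Local Notation C := R[i].

Lemma sum_kronecker (M h : nat) (f : nat -> C) : (h < M)%N ->
  \sum_(k < M) f k * (h == k)%:R = f h.
Proof.
move=> hM; rewrite (bigD1 (Ordinal hM))//= eqxx mulr1 big1 ?addr0// => k.
rewrite -val_eqE /= eq_sym => /negbTE ->; by rewrite mulr0.
Qed.

(** A homogeneous system of j equations in j + 1 unknowns has a nonzero solution. *)
Lemma exists_annihilated (j : nat) (G : nat -> nat -> C) :
  exists y : nat -> C, (exists2 i, (i <= j)%N & y i != 0) /\
    forall l, (l < j)%N -> \sum_(i < j.+1) y i * G i l = 0.
Proof.
pose B : 'M[C]_(j.+1, j) := \matrix_(i, l) G i l.
have kn0 : kermx B != 0.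
  rewrite -mxrank_eq0 mxrank_ker subn_eq0 -ltnNge.
  by apply: leq_ltn_trans (rank_leq_col B) _.
have /rowV0Pn[v vK v0] := kn0.
have vB : v *m B = 0 by apply/sub_kermxP.
exists (fun i => v 0 (inord i)); split.
  have /rV0Pn[i vi] : v != 0 by [].
  by exists (val i); rewrite ?inord_val// -ltnS ltn_ord.
move=> l lj; have /matrixP/(_ 0 (Ordinal lj)) := vB.
rewrite mxE [RHS]mxE => e; rewrite -[RHS]e; apply: eq_bigr => i _.
by rewrite !mxE inord_val.
Qed.

Section Eigen.
Context (A : nat -> nat -> C) (M : nat) (S : nat -> R) (phi : nat -> nat -> C).
Hypotheses
  (phi_on : forall j k, (j < M)%N -> (k < M)%N ->
     \sum_(h < M) (phi j h)^* * phi k h = (j == k)%:R)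
  (phi_full : forall h k, (h < M)%N -> (k < M)%N ->
     \sum_(j < M) phi j h * (phi j k)^* = (h == k)%:R)
  (phi_eig : forall j h, (j < M)%N -> (h < M)%N ->
     \sum_(k < M) A h k * phi j k = (S j)%:C * phi j h)
  (S_dec : forall j k, (j <= k)%N -> (k < M)%N -> S k <= S j).

Definition eigcoef (x : nat -> C) (i : nat) : C :=
  locked (\sum_(h < M) (phi i h)^* * x h).

Lemma eigcoef_def x i : eigcoef x i = \sum_(h < M) (phi i h)^* * x h.
Proof. by rewrite /eigcoef -lock. Qed.

Lemma eigcoefJ (x : nat -> C) i :
  (eigcoef x i)^* = \sum_(h < M) phi i h * (x h)^*.
Proof.
rewrite eigcoef_def conjc_sum; apply: eq_bigr => h _.
by rewrite conjcM conjCK.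
Qed.

Lemma eigcoefE (x : nat -> C) h : (h < M)%N -> x h = \sum_(i < M) eigcoef x i * phi i h.
Proof.
move=> hM; rewrite -(sum_kronecker x hM).
under [RHS]eq_bigr do rewrite eigcoef_def mulr_suml.
rewrite exchange_big /=; apply: eq_bigr => k _.
rewrite -phi_full// mulr_sumr; apply: eq_bigr => i _; ring.
Qed.

Lemma eig_apply (x : nat -> C) h : (h < M)%N ->
  \sum_(k < M) A h k * x k = \sum_(i < M) (S i)%:C * eigcoef x i * phi i h.
Proof.
move=> hM.
under eq_bigr do rewrite (eigcoefE x)// mulr_sumr.
rewrite exchange_big /=; apply: eq_bigr => i _.
rewrite mulrAC -phi_eig// mulr_suml; apply: eq_bigr => k _; ring.
Qed.

Lemma eig_quad (x : nat -> C) :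
  \sum_(h < M) (x h)^* * (\sum_(k < M) A h k * x k) =
  (\sum_(i < M) S i * normc (eigcoef x i) ^+ 2)%:C.
Proof.
under eq_bigr => h _ do rewrite eig_apply// mulr_sumr.
rewrite exchange_big rmorph_sum /=; apply: eq_bigr => i _.
rewrite rmorphM /= -mulcJ eigcoefJ mulrA mulr_sumr.
by apply: eq_bigr => h _; ring.
Qed.

Lemma eig_parseval (x : nat -> C) :
  \sum_(h < M) normc (x h) ^+ 2 = \sum_(i < M) normc (eigcoef x i) ^+ 2.
Proof.
apply: complexI; rewrite !rmorph_sum /=.
transitivity (\sum_(h < M) (x h)^* * (\sum_(i < M) eigcoef x i * phi i h)).
  by apply: eq_bigr => h _; rewrite -eigcoefE// mulJc.
under [LHS]eq_bigr do rewrite mulr_sumr.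
rewrite exchange_big /=; apply: eq_bigr => i _.
rewrite -mulcJ eigcoefJ mulr_sumr.
by apply: eq_bigr => h _; ring.
Qed.

Lemma eig_sum_weights (h : nat) : (h < M)%N -> \sum_(j < M) normc (phi j h) ^+ 2 = 1.
Proof.
move=> hM; apply: complexI; rewrite rmorph_sum /=.
transitivity (\sum_(j < M) phi j h * (phi j h)^*); last by rewrite phi_full// eqxx.
by apply: eq_bigr => j _; rewrite mulcJ.
Qed.

Lemma eigcoef_comb (c : nat -> C) (j i : nat) : (j < M)%N -> (i < M)%N ->
  eigcoef (fun h => \sum_(l < j.+1) c l * phi l h) i = if (i <= j)%N then c i else 0.
Proof.
move=> jM iM; rewrite eigcoef_def; under eq_bigr do rewrite mulr_sumr.
rewrite exchange_big /=.
transitivity (\sum_(l < j.+1) c l * (i == l)%:R).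
  apply: eq_bigr => l _; rewrite -phi_on//; last by apply: leq_trans jM.
  by rewrite mulr_sumr; apply: eq_bigr => h _; ring.
case: leqP => ij; first by rewrite sum_kronecker.
apply: big1 => l _; case: eqP => [e|]; last by rewrite mulr0.
by move: ij; rewrite e ltnNge -ltnS ltn_ord.
Qed.

(* Courant-Fischer: some combination of phi_0, ..., phi_j vanishes at the first j
   coordinates. *)
Lemma eig_upper (j : nat) (X : R) : (j < M)%N ->
  (forall x : nat -> C, (forall h, (h < j)%N -> x h = 0) ->
    Re (\sum_(h < M) (x h)^* * (\sum_(k < M) A h k * x k)) <=
    X * \sum_(h < M) normc (x h) ^+ 2) ->
  S j <= X.
Proof.
move=> jM hX.
have [y [[i0 i0j yi0] yG]] := exists_annihilated j (fun i l => phi i l).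
pose x h := \sum_(l < j.+1) y l * phi l h.
have /hX : forall h, (h < j)%N -> x h = 0 by move=> h hj; exact: yG.
rewrite eig_quad eig_parseval mulr_sumr /=.
have pos : 0 < \sum_(i < M) normc (eigcoef x i) ^+ 2.
  rewrite lt_def sumr_ge0 ?andbT => [|i _]; last exact: sqr_ge0.
  have i0M : (i0 < M)%N by exact: leq_ltn_trans jM.
  rewrite (bigD1 (Ordinal i0M))//= gt_eqF// ltr_pwDl//; last first.
    by apply: sumr_ge0 => i _; exact: sqr_ge0.
  by rewrite exprn_gt0// normc_gt0 eigcoef_comb// i0j.
move=> le2.
have {le2} : S j * \sum_(i < M) normc (eigcoef x i) ^+ 2 <=
   X * \sum_(i < M) normc (eigcoef x i) ^+ 2.
  rewrite [leRHS]mulr_sumr; apply: le_trans le2; rewrite mulr_sumr.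
  apply: ler_sum => i _; rewrite eigcoef_comb//.
  case: leqP => ij; last by rewrite normc0 expr0n /= !mulr0.
  by rewrite ler_wpM2r ?sqr_ge0// S_dec.
by rewrite ler_pM2r.
Qed.

(** Dual to [eig_upper]: some nonzero vector supported on the coordinates 0, ..., j is orthogonal to
    phi_0, ..., phi_(j-1), so only eigenvalues at most S_j enter its quadratic form. *)
Lemma eig_lower (j : nat) (X : R) : (j < M)%N ->
  (forall x : nat -> C, (forall h, (j < h)%N -> x h = 0) ->
    X * \sum_(h < M) normc (x h) ^+ 2 <=
    Re (\sum_(h < M) (x h)^* * (\sum_(k < M) A h k * x k))) ->
  X <= S j.
Proof.
move=> jM hX.
have [y [[i0 i0j yi0] yG]] := exists_annihilated j (fun i l => (phi l i)^*).
pose x h := if (h <= j)%N then y h else 0.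
have /hX : forall h, (j < h)%N -> x h = 0.
  by move=> h hj; rewrite /x leqNgt hj.
have xG l : (l < j)%N -> eigcoef x l = 0.
  move=> lj; rewrite eigcoef_def -[RHS](yG _ lj).
  rewrite (big_ord_widen_cond M xpredT (fun i => y i * (phi l i)^*))//.
  rewrite [RHS]big_mkcond /=; apply: eq_bigr => i _; rewrite /x ltnS.
  by case: ifP => _; rewrite ?mulr0// mulrC.
have pos : 0 < \sum_(h < M) normc (x h) ^+ 2.
  rewrite lt_def sumr_ge0 ?andbT => [|i _]; last exact: sqr_ge0.
  have i0M : (i0 < M)%N by exact: leq_ltn_trans jM.
  rewrite (bigD1 (Ordinal i0M))//= gt_eqF// ltr_pwDl//; last first.
    by apply: sumr_ge0 => i _; exact: sqr_ge0.
  by rewrite exprn_gt0// normc_gt0 /x i0j.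
rewrite eig_quad /= => le1.
have {le1} : X * \sum_(h < M) normc (x h) ^+ 2 <= S j * \sum_(h < M) normc (x h) ^+ 2.
  apply: le_trans le1 _; rewrite eig_parseval mulr_sumr.
  apply: ler_sum => i _.
  have [ij|ji] := ltnP i j; first by rewrite xG// normc0 expr0n /= !mulr0.
  by rewrite ler_wpM2r ?sqr_ge0// S_dec.
by rewrite ler_pM2r.
Qed.

End Eigen.

End Truncation.

(** * The Lax operator on sequences *)

Section LaxSequences.
Context {R : realType}.
Local Notation C := R[i].
Context (W : nat -> nat -> C) (Bw : nat -> R).

Definition e0 (h : nat) : C := (h == 0%N)%:R.

(* The series converges for bounded x under [W_bnd]; [culim] names its sum. *)
Definition Wop (x : nat -> C) (h : nat) : C :=
  culim (fun N => \sum_(k < N) W h k * x k).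

Section Weights.
Hypothesis W_bnd : forall p h N,
  \sum_(k < N) normc (W h k) * (1 + (ndist h k)%:R) ^+ p <= Bw p.

Lemma Bw_ge0 p : 0 <= Bw p.
Proof. by have := W_bnd p 0 0; rewrite big_ord0. Qed.

Lemma W_bnd0 h N : \sum_(k < N) normc (W h k) <= Bw 0.
Proof. by apply: le_trans (W_bnd 0 h N); under [leRHS]eq_bigr do rewrite expr0 mulr1. Qed.

(** The inequality 1 + h <= (1 + |h - k|) (1 + k) moves the weight from the output index to the
    input index, at the price of a weighted row sum of [W]. *)
Lemma W_weight p (X : R) (x : nat -> C) h N : 0 <= X ->
  (forall k, (k < N)%N -> normc (x k) * (1 + k%:R) ^+ p <= X) ->
  normc (\sum_(k < N) W h k * x k) * (1 + h%:R) ^+ p <= Bw p * X.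
Proof.
move=> X0 hx.
apply: (@le_trans _ _ ((\sum_(k < N) normc (W h k) * (1 + (ndist h k)%:R) ^+ p) * X)); last first.
  by rewrite ler_wpM2r// W_bnd.
rewrite mulr_suml; apply: le_trans (ler_wpM2r _ (normc_sum _ _ _)) _.
  by rewrite exprn_ge0// addr_ge0.
rewrite mulr_suml; apply: ler_sum => k _.
rewrite normcM -!mulrA ler_wpM2l ?normc_ge0//.
apply: (@le_trans _ _ ((1 + (ndist h k)%:R) ^+ p * (normc (x k) * (1 + k%:R) ^+ p))); last first.
  by rewrite ler_wpM2l ?hx// exprn_ge0// addr_ge0.
rewrite mulrCA ler_wpM2l ?normc_ge0// -exprMn.
apply: lerXn2r; rewrite ?nnegrE ?mulr_ge0 ?addr_ge0//.
rewrite -!(natrD _ 1) -natrM ler_nat /ndist; nia.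
Qed.

(** Beyond column h + m the weight 1 + |h - k| exceeds m, so the tail is at most [Bw 1] / m,
    uniformly in N. *)
Lemma W_tail h (e : R) : 0 < e -> exists K, forall N, (K <= N)%N ->
  \sum_(K <= k < N) normc (W h k) <= e.
Proof.
move=> e0'.
pose m := (Num.truncn (Bw 1 / e)).+1.
have mP : Bw 1 / e < m%:R by exact: truncnS_gt.
exists (h + m)%N => N KN.
have m0 : 0 < m%:R :> R by rewrite ltr0n.
rewrite -(ler_pM2r m0).
have : Bw 1 <= e * m%:R by rewrite mulrC -ler_pdivrMr// ltW.
apply: le_trans; apply: le_trans (W_bnd 1 h N).
rewrite -(big_mkord xpredT (fun k => normc (W h k) * (1 + (ndist h k)%:R) ^+ 1)).
rewrite (big_cat_nat (leq0n (h + m)) KN) /=; apply: ler_wpDl.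
  by apply: sumr_ge0 => k _; rewrite mulr_ge0 ?normc_ge0 ?exprn_ge0 ?addr_ge0.
rewrite mulr_suml !big_nat; apply: ler_sum => k /andP[hk _].
by rewrite ler_wpM2l ?normc_ge0// expr1 -(natrD _ 1) ler_nat /ndist; lia.
Qed.

Lemma W_sum_tail h (e X : R) : 0 < e -> 0 <= X ->
  exists K, forall N (x : nat -> C), (K <= N)%N -> (forall k, (k < N)%N -> normc (x k) <= X) ->
  normc (\sum_(k < N) W h k * x k - \sum_(k < K) W h k * x k) <= e.
Proof.
move=> e0' X0.
have [K hK] := @W_tail h (e / (X + 1)) (divr_gt0 e0' (ltr_wpDl X0 ltr01)).
exists K => N x KN hx.
rewrite -!(big_mkord xpredT (fun k => W h k * x k)) (big_cat_nat (leq0n K) KN) /= addrAC subrr add0r.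
apply: le_trans (normc_sum _ _ _) _.
apply: (@le_trans _ _ ((\sum_(K <= k < N) normc (W h k)) * X)).
  rewrite mulr_suml !big_nat; apply: ler_sum => k /andP[_ kN].
  by rewrite normcM ler_wpM2l ?normc_ge0 ?hx.
apply: le_trans (ler_wpM2r X0 (hK _ KN)) _.
rewrite mulrAC ler_pdivrMr ?ltr_wpDl//.
by rewrite ler_wpM2l ?lerDl// ltW.
Qed.

(** Dominated convergence: a head of fixed length converges term by term, and the common bound X
    makes both tails at most e / 2. *)
Lemma Wop_lim (xM : nat -> nat -> C) (x : nat -> C) (X : R) h : 0 <= X ->
  (\forall M \near nat_ultra, forall k, (k < M)%N -> normc (xM M k) <= X) ->
  (forall k, x k = culim (fun M => xM M k)) ->
  culim (fun M => \sum_(k < M) W h k * xM M k) = Wop x h.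
Proof.
move=> X0 bx xE.
have bxk k : \forall M \near nat_ultra, normc (xM M k) <= X.
  have kM : \forall M \near nat_ultra, (k < M)%N by exact: (near_ultra (N := k.+1)).
  by apply: filterS2 bx kM => M hM kM; exact: hM.
have xk k : normc (x k) <= X by rewrite xE; exact: normc_culim.
apply/eqP; rewrite -subr_eq0 -normc_eq0 eq_le normc_ge0 andbT.
apply/ler_addgt0Pr => e e0'; rewrite add0r.
have e2 : 0 < e / 2 by rewrite divr_gt0.
have [K hK] := @W_sum_tail h (e / 2) X e2 X0.
rewrite -(subrKA (\sum_(k < K) W h k * x k)) (splitr e).
apply: le_trans (normcD _ _) _; apply: lerD; last first.
  rewrite normcBC; apply: normc_culimB; apply: (near_ultra (N := K)) => N KN.
  by apply: hK.
have xsum : \sum_(k < K) W h k * x k = culim (fun M => \sum_(k < K) W h k * xM M k).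
  rewrite culim_sum => [|i]; last by apply: cboundedM; [exact: cbounded_cst|exists X].
  apply: eq_bigr => i _; rewrite culimM ?culim_cst -?xE//; first exact: cbounded_cst.
  by exists X.
have b1 : cbounded (fun M => \sum_(k < M) W h k * xM M k).
  exists (Bw 0 * X); apply: filterS bx => M hM.
  have := @W_weight 0 X (xM M) h M X0; rewrite expr0 mulr1; apply => k kM.
  by rewrite expr0 mulr1 hM.
have b2 : cbounded (fun M => \sum_(k < K) W h k * xM M k).
  by apply: cbounded_sum => i; apply: cboundedM; [exact: cbounded_cst|exists X].
rewrite xsum -culimB//; apply: normc_culim.
have KM : \forall M \near nat_ultra, (K <= M)%N by exact: (near_ultra (N := K)).
by apply: filterS2 bx KM => M hM KM; apply: hK.
Qed.

Lemma Wop_weight p (X : R) (x : nat -> C) h :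
  (forall k, normc (x k) * (1 + k%:R) ^+ p <= X) ->
  normc (Wop x h) * (1 + h%:R) ^+ p <= Bw p * X.
Proof.
move=> hx.
have X0 : 0 <= X by apply: le_trans (hx 0%N); rewrite mulr_ge0 ?normc_ge0 ?exprn_ge0 ?addr_ge0.
have h0 : 0 < (1 + h%:R) ^+ p :> R by rewrite exprn_gt0// ltr_pwDl.
rewrite -ler_pdivlMr//; apply: normc_culim; apply: (near_ultra (N := 0%N)) => N _.
by rewrite ler_pdivlMr//; exact: W_weight.
Qed.

(** Schur's test: |x_h x_k| <= (|x_h|^2 + |x_k|^2) / 2, and the two resulting sums are equal by
    hermitian symmetry and bounded through row sums. *)
Lemma schur_bound (W_herm : forall h k, W h k = (W k h)^*) M (x : nat -> C) :
  normc (\sum_(h < M) (x h)^* * \sum_(k < M) W h k * x k) <=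
  Bw 0 * \sum_(h < M) normc (x h) ^+ 2.
Proof.
pose w h k := normc (W h k).
have wC h k : w h k = w k h by rewrite /w W_herm normcJE.
have half : \sum_(h < M) \sum_(k < M) w h k * normc (x h) ^+ 2 <=
    Bw 0 * \sum_(h < M) normc (x h) ^+ 2.
  rewrite mulr_sumr; apply: ler_sum => h _; rewrite -mulr_suml.
  by rewrite ler_wpM2r ?sqr_ge0// W_bnd0.
apply: le_trans (normc_sum _ _ _) _.
apply: (@le_trans _ _ (\sum_(h < M) \sum_(k < M)
   (2^-1 * (w h k * normc (x h) ^+ 2) + 2^-1 * (w h k * normc (x k) ^+ 2)))).
  apply: ler_sum => h _; rewrite normcM normcJE.
  apply: le_trans (ler_wpM2l (normc_ge0 _) (normc_sum _ _ _)) _.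
  rewrite mulr_sumr; apply: ler_sum => k _; rewrite normcM -/(w h k).
  have := sqr_ge0 (normc (x h) - normc (x k)).
  have : 0 <= w h k by exact: normc_ge0.
  move=> w0 s0; have := mulr_ge0 w0 s0; lra.
under eq_bigr do rewrite big_split.
rewrite big_split /=; under eq_bigr do rewrite -mulr_sumr.
under [X in _ + X]eq_bigr do rewrite -mulr_sumr.
rewrite -!mulr_sumr [X in _ + 2^-1 * X]exchange_big /=.
under [X in _ + 2^-1 * X]eq_bigr do under eq_bigr do rewrite wC.
lra.
Qed.

End Weights.

Context (eps : R).

Definition lax_mx (h k : nat) : C := W h k - (eps * h%:R)%:C * (h == k)%:R.

Definition lax_op (x : nat -> C) (h : nat) : C := Wop x h - (eps * h%:R)%:C * x h.

Lemma lax_mx_herm (W_herm : forall h k, W h k = (W k h)^*) h k :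
  lax_mx h k = (lax_mx k h)^*.
Proof.
rewrite /lax_mx conjcB conjcM -W_herm; congr (_ - _).
rewrite [in RHS]eq_sym; case: eqP => [->|_]; last by rewrite !mulr0 rmorph0 mulr0.
by rewrite rmorph1; congr (_ * _); apply: complex_eqP => /=; rewrite ?oppr0.
Qed.

Lemma lax_mx_sum M (x : nat -> C) h : (h < M)%N ->
  \sum_(k < M) lax_mx h k * x k = \sum_(k < M) W h k * x k - (eps * h%:R)%:C * x h.
Proof.
move=> hM; under eq_bigr do rewrite mulrBl.
rewrite sumrB; congr (_ - _).
by rewrite -(sum_kronecker x hM) mulr_sumr; apply: eq_bigr => k _; ring.
Qed.

(** Bootstrap in p. The equation reads (u + eps h) x_h = (W x)_h + y_h; its right side inherits the
    weight p from x, and dividing by u + eps h gains one power of h. *)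
Lemma resolvent_decay (eps_gt0 : 0 < eps)
  (W_bnd : forall p h N,
     \sum_(k < N) normc (W h k) * (1 + (ndist h k)%:R) ^+ p <= Bw p)
  (u : C) (x y : nat -> C) (X : R) :
  (forall h, normc (x h) <= X) ->
  (forall p, exists Y, forall h, normc (y h) * (1 + h%:R) ^+ p <= Y) ->
  (forall h, u * x h - lax_op x h = y h) ->
  forall p, exists Y, forall h, normc (x h) * (1 + h%:R) ^+ p <= Y.
Proof.
move=> bx by_ xE; elim=> [|p [Y hY]].
  by exists X => h; rewrite expr0 mulr1.
have [Z hZ] := by_ p.
(* Beyond [H] the modulus of u + eps h is at least eps (1 + h) / 2; the finitely many smaller h are
   absorbed by the constant. *)
pose H := (Num.truncn ((eps + 2 * normc u) / eps)).+1.
have HP : (eps + 2 * normc u) / eps < H%:R by exact: truncnS_gt.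
exists (Y * (1 + H%:R) + 2 / eps * (Bw p * Y + Z)) => h.
have Y0 : 0 <= Y.
  by apply: le_trans (hY 0%N); rewrite mulr_ge0 ?normc_ge0 ?exprn_ge0 ?addr_ge0.
have Z0 : 0 <= Z.
  by apply: le_trans (hZ 0%N); rewrite mulr_ge0 ?normc_ge0 ?exprn_ge0 ?addr_ge0.
have pos2 : 0 <= 2 / eps * (Bw p * Y + Z).
  by rewrite mulr_ge0 ?divr_ge0 ?addr_ge0 ?mulr_ge0 ?(Bw_ge0 W_bnd)// ltW.
have pos1 : 0 <= Y * (1 + H%:R) by rewrite mulr_ge0// addr_ge0.
have h1 : 0 < 1 + h%:R :> R by rewrite ltr_pwDl.
have [hH|Hh] := leqP h H.
  rewrite exprSr mulrA; apply: le_trans (_ : Y * (1 + H%:R) <= _); last by rewrite lerDl.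
  by apply: ler_pM => //; rewrite ?mulr_ge0 ?normc_ge0 ?exprn_ge0 ?lerD2l ?ler_nat// ltW.
apply: le_trans (_ : 2 / eps * (Bw p * Y + Z) <= _); last by rewrite lerDr.
have step : (u + (eps * h%:R)%:C) * x h = Wop x h + y h.
  by rewrite -xE /lax_op; ring.
have : normc (u + (eps * h%:R)%:C) * normc (x h) * (1 + h%:R) ^+ p <= Bw p * Y + Z.
  rewrite -normcM step.
  apply: le_trans (ler_wpM2r _ (normcD _ _)) _; first by rewrite exprn_ge0// ltW.
  by rewrite mulrDl lerD// ?(Wop_weight W_bnd).
have : eps / 2 * (1 + h%:R) <= normc (u + (eps * h%:R)%:C).
  have h2 : eps * h%:R - normc u <= normc (u + (eps * h%:R)%:C).
    have := normcB_ge (eps * h%:R)%:C (- u).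
    rewrite opprK normcNE [(_)%:C + u]addrC normcR ger0_norm//.
    by rewrite mulr_ge0// ltW.
  have : (eps + 2 * normc u) / eps < h%:R by apply: lt_trans HP _; rewrite ltr_nat.
  rewrite ltr_pdivrMr// mulrC => h3; lra.
move=> h2 h3.
rewrite -(ler_pM2l (_ : 0 < eps / 2)) ?divr_gt0//.
have -> : eps / 2 * (2 / eps * (Bw p * Y + Z)) = Bw p * Y + Z by field; rewrite gt_eqF.
apply: le_trans h3; rewrite exprS.
have -> : eps / 2 * (normc (x h) * ((1 + h%:R) * (1 + h%:R) ^+ p)) =
  (eps / 2 * (1 + h%:R)) * normc (x h) * (1 + h%:R) ^+ p by ring.
by apply: ler_wpM2r; [rewrite exprn_ge0// ltW|rewrite ler_wpM2r ?normc_ge0].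
Qed.

End LaxSequences.

Lemma conjcV {R : realType} (x : R[i]) : x^-1^* = (x^*)^-1.
Proof. exact: fmorphV. Qed.

Lemma conjcR {R : realType} (a : R) : (a%:C : R[i])^* = a%:C.
Proof. by apply: complex_eqP => //=; rewrite oppr0. Qed.

(** * Spectrum and resolvent of the truncated matrices, and their limits *)

Section TruncatedSpectrum.
Context {R : realType}.
Local Notation C := R[i].
Context (eps : R) (W : nat -> nat -> C) (Bw : nat -> R).
Hypotheses (eps_gt0 : 0 < eps)
  (W_herm : forall h k, W h k = (W k h)^*)
  (W_bnd : forall p h N,
     \sum_(k < N) normc (W h k) * (1 + (ndist h k)%:R) ^+ p <= Bw p).
Context (S : nat -> nat -> R) (phi : nat -> nat -> nat -> C).
Hypothesis eigP : forall M,
  [/\ forall j k, (j < M)%N -> (k < M)%N ->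
        \sum_(h < M) (phi M j h)^* * phi M k h = (j == k)%:R,
      forall h k, (h < M)%N -> (k < M)%N ->
        \sum_(j < M) phi M j h * (phi M j k)^* = (h == k)%:R,
      forall j h, (j < M)%N -> (h < M)%N ->
        \sum_(k < M) lax_mx W eps h k * phi M j k = (S M j)%:C * phi M j h &
      forall j k, (j <= k)%N -> (k < M)%N -> S M k <= S M j].

Local Notation U := nat_ultra.
Local Notation B0 := (Bw 0).

Let phi_on M := let: And4 h _ _ _ := eigP M in h.
Let phi_full M := let: And4 _ h _ _ := eigP M in h.
Let phi_eig M := let: And4 _ _ h _ := eigP M in h.
Let S_dec M := let: And4 _ _ _ h := eigP M in h.

Lemma lax_quad M (x : nat -> C) :
  \sum_(h < M) (x h)^* * (\sum_(k < M) lax_mx W eps h k * x k) =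
  \sum_(h < M) (x h)^* * (\sum_(k < M) W h k * x k) -
  (eps * \sum_(h < M) h%:R * normc (x h) ^+ 2)%:C.
Proof.
rewrite mulr_sumr rmorph_sum -sumrB; apply: eq_bigr => h _.
rewrite lax_mx_sum// mulrBr; congr (_ - _).
by rewrite mulrCA mulJc -rmorphM -mulrA.
Qed.

(** On vectors vanishing below j the form of - eps D is at most - eps j, and the Toeplitz part adds
    at most [B0] by Schur's test. With the companion lower bound, the j-th eigenvalue stays within
    [B0] of - eps j for every M, which yields both its limit in M and the divergence to -oo in j. *)
Lemma trunc_eig_upper M j : (j < M)%N -> S M j <= B0 - eps * j%:R.
Proof.
move=> jM; apply: (eig_upper (@phi_on M) (@phi_full M) (@phi_eig M) (@S_dec M)) => //.
move=> x x0; rewrite lax_quad ReD ReN mulrBl; apply: lerB.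
  by apply: le_trans (ler_norm _) (le_trans (normc_Re _) _); exact: schur_bound.
rewrite /= -mulrA (ler_wpM2l (ltW eps_gt0))// mulr_sumr; apply: ler_sum => h _.
have [hj|jh] := ltnP h j; first by rewrite x0// normc0 expr0n /= !mulr0.
by rewrite ler_wpM2r ?sqr_ge0// ler_nat.
Qed.

Lemma trunc_eig_lower M j : (j < M)%N -> - B0 - eps * j%:R <= S M j.
Proof.
move=> jM; apply: (eig_lower (@phi_full M) (@phi_eig M) (@S_dec M)) => //.
move=> x x0; rewrite lax_quad ReD ReN mulrBl mulNr; apply: lerB.
  rewrite lerNl; apply: le_trans (schur_bound W_bnd W_herm M x).
  by apply: le_trans (normc_Re _); rewrite -normrN ler_norm.
rewrite /= -mulrA (ler_wpM2l (ltW eps_gt0))// mulr_sumr; apply: ler_sum => h _.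
have [hj|jh] := ltnP j h; first by rewrite x0// normc0 expr0n /= !mulr0.
by rewrite ler_wpM2r ?sqr_ge0// ler_nat.
Qed.

(* [S M] and [phi M] are the eigenvalues, in decreasing order, and eigenvectors of
   the truncated matrix of size M. *)
Definition lim_eig j : R := ulim (fun M => S M j).
Definition trunc_weight M j : R := normc (phi M j 0%N) ^+ 2.
Definition lim_weight j : R := ulim (fun M => trunc_weight M j).

Lemma ubounded_S j : ubounded (fun M => S M j).
Proof.
exists (B0 + eps * j%:R); apply: (near_ultra (N := j.+1)) => M jM.
have pos : 0 <= eps * j%:R by rewrite mulr_ge0// ltW.
rewrite ler_norml opprD trunc_eig_lower//=.
by apply: le_trans (trunc_eig_upper jM) _; lra.
Qed.

Lemma sum_weight_le M (J : nat) : (0 < M)%N -> (J <= M)%N -> \sum_(j < J) trunc_weight M j <= 1.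
Proof.
move=> M0 JM; have <- := eig_sum_weights (@phi_full M) M0.
rewrite -!(big_mkord xpredT (fun j => normc (phi M j 0%N) ^+ 2)).
rewrite (big_cat_nat (leq0n J) JM) /= lerDl.
by apply: sumr_ge0 => j _; exact: sqr_ge0.
Qed.

Lemma sum_weight_eq M : (0 < M)%N -> \sum_(j < M) trunc_weight M j = 1.
Proof. exact: (eig_sum_weights (@phi_full M)). Qed.

Lemma weight_ge0 M j : 0 <= trunc_weight M j. Proof. exact: sqr_ge0. Qed.

Lemma weight_le1 M j : (j < M)%N -> trunc_weight M j <= 1.
Proof.
move=> jM; have M0 : (0 < M)%N by exact: leq_ltn_trans jM.
rewrite -(sum_weight_eq M0) (bigD1 (Ordinal jM))//= lerDl.
by apply: sumr_ge0 => *; exact: weight_ge0.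
Qed.

Lemma ubounded_weight j : ubounded (fun M => trunc_weight M j).
Proof.
exists 1; apply: (near_ultra (N := j.+1)) => M jM.
by rewrite ger0_norm ?weight_ge0// weight_le1.
Qed.

Lemma Sl_upper j : lim_eig j <= B0 - eps * j%:R.
Proof.
rewrite -(ulim_cst (B0 - eps * j%:R)); apply: ulim_le.
- exact: ubounded_S.
- exact: ubounded_cst.
- by apply: (near_ultra (N := j.+1)) => M; exact: trunc_eig_upper.
Qed.

Lemma al_ge0 j : 0 <= lim_weight j.
Proof.
rewrite -(ulim_cst 0); apply: ulim_le.
- exact: ubounded_cst.
- exact: ubounded_weight.
- by apply: (near_ultra (N := 0%N)) => M _; exact: weight_ge0.
Qed.

Lemma ulim_sum (J : nat) (f : nat -> nat -> R) : (forall j, ubounded (f j)) ->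
  ulim (fun M => \sum_(j < J) f j M) = \sum_(j < J) ulim (f j) /\
  ubounded (fun M => \sum_(j < J) f j M).
Proof.
move=> bf; elim: J => [|J [IH1 IH2]].
  split; last by under [X in ubounded X]eq_fun do rewrite big_ord0; exact: ubounded_cst.
  by under [X in ulim X]eq_fun do rewrite big_ord0; rewrite ulim_cst big_ord0.
split.
  under [X in ulim X]eq_fun do rewrite big_ord_recr.
  by rewrite ulimD// IH1 big_ord_recr.
by under [X in ubounded X]eq_fun do rewrite big_ord_recr; exact: uboundedD.
Qed.

Lemma sum_al_le1 J : \sum_(j < J) lim_weight j <= 1.
Proof.
have [e b] := @ulim_sum J (fun j M => trunc_weight M j) ubounded_weight.
rewrite -e -(ulim_cst 1); apply: ulim_le => //; first exact: ubounded_cst.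
by apply: (near_ultra (N := J.+1)) => M JM; apply: sum_weight_le => //; lia.
Qed.

(** Only finitely many eigenvalues need a limit argument: beyond some index J the uniform upper
    bound keeps them at distance at least 1 from u. *)
Lemma spectrum_dist (u : C) : (forall j, u != (lim_eig j)%:C) ->
  exists2 d : R, 0 < d & \forall M \near U, forall j, (j < M)%N -> d <= normc (u - (S M j)%:C).
Proof.
move=> uS.
have [J hJ] : exists J : nat, B0 + normc u + 1 <= eps * J%:R.
  exists (Num.truncn ((B0 + normc u + 1) / eps)).+1.
  by rewrite mulrC -ler_pdivrMr// ltW// truncnS_gt.
have far M j : (j < M)%N -> (J <= j)%N -> 1 <= normc (u - (S M j)%:C).
  move=> jM Jj; have := trunc_eig_upper jM.
  have : eps * J%:R <= eps * j%:R by rewrite (ler_wpM2l (ltW eps_gt0)) ?ler_nat.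
  have := normcB_ge (S M j)%:C u; rewrite [normc (_ - u)]normcBC normcR.
  by have := ler_norm (- S M j); rewrite normrN; move=> h1 h2 h3 h4; lra.
have : exists2 d : R, 0 < d & \forall M \near U, forall j, (j < J)%N -> d <= normc (u - (S M j)%:C).
  elim: J {hJ far} => [|J [d d0 hd]]; first by exists 1 => //; apply: (near_ultra (N := 0%N)).
  set e := normc (u - (lim_eig J)%:C) / 2.
  have e0' : 0 < e by rewrite divr_gt0// normc_gt0 subr_eq0.
  exists (Num.min d e); first by rewrite lt_min d0.
  have := ulim_near (ubounded_S J) e0'; apply: filterS2 hd => M hM SM j.
  rewrite ltnS leq_eqVlt => /predU1P[->|jJ]; rewrite ge_min; last by rewrite hM.
  apply/orP; right.
  have := normcD (u - (S M J)%:C) ((S M J)%:C - (lim_eig J)%:C).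
  rewrite addrA subrK -rmorphB normcR => h; rewrite /e in SM *.
  by move: SM; rewrite -/(lim_eig J) => SM; lra.
move=> [d d0 hd]; exists (Num.min d 1); first by rewrite lt_min d0 ltr01.
apply: filterS hd => M hM j jM; rewrite ge_min.
by case: (ltnP j J) => h; [rewrite hM|rewrite far ?orbT].
Qed.

(** The vector (u - L_M)^-1 |0> in the eigenbasis of the truncation L_M; it is meaningful for h <
    M. *)
Definition resM (u : C) M h : C :=
  \sum_(j < M) phi M j h * (phi M j 0%N)^* / (u - (S M j)%:C).

Definition res (u : C) h : C := culim (fun M => resM u M h).

Lemma resM_bound (u : C) M (d : R) h : 0 < d -> (h < M)%N ->
  (forall j, (j < M)%N -> d <= normc (u - (S M j)%:C)) -> normc (resM u M h) <= d^-1.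
Proof.
move=> d0 hM hd; apply: le_trans (normc_sum _ _ _) _.
have M0 : (0 < M)%N by exact: leq_ltn_trans hM.
apply: (@le_trans _ _ (\sum_(j < M) d^-1 *
   (2^-1 * normc (phi M j h) ^+ 2 + 2^-1 * normc (phi M j 0%N) ^+ 2))).
  apply: ler_sum => j _; rewrite !normcM normcJE normcV mulrC.
  have dj := hd j (ltn_ord j).
  apply: ler_pM; rewrite ?invr_ge0 ?mulr_ge0 ?normc_ge0//.
    by rewrite lef_pV2// posrE// (lt_le_trans d0).
  have := sqr_ge0 (normc (phi M j h) - normc (phi M j 0%N)); lra.
rewrite -mulr_sumr big_split /= -!mulr_sumr (eig_sum_weights (@phi_full M) hM).
rewrite (eig_sum_weights (@phi_full M) M0) !mulr1; lra.
Qed.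

Lemma resM_eq (u : C) M h : (h < M)%N ->
  (forall j, (j < M)%N -> u != (S M j)%:C) ->
  u * resM u M h - \sum_(k < M) lax_mx W eps h k * resM u M k = (h == 0%N)%:R.
Proof.
move=> hM uS; have M0 : (0 < M)%N by exact: leq_ltn_trans hM.
rewrite -(phi_full hM M0).
have -> : \sum_(k < M) lax_mx W eps h k * resM u M k =
  \sum_(j < M) (S M j)%:C * phi M j h * (phi M j 0%N)^* / (u - (S M j)%:C).
  under eq_bigr do rewrite mulr_sumr.
  rewrite exchange_big /=; apply: eq_bigr => j _.
  rewrite -phi_eig// !mulr_suml; apply: eq_bigr => k _; by rewrite !mulrA.
rewrite mulr_sumr -sumrB; apply: eq_bigr => j _.
have := uS j (ltn_ord j); rewrite -subr_eq0 => hu.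
rewrite -[X in _ = X]mulr1 -(divff hu); ring.
Qed.

Lemma resM_conj (u : C) M : (resM u^* M 0)^* = resM u M 0.
Proof.
rewrite /resM conjc_sum; apply: eq_bigr => j _.
by rewrite !conjcM conjcV conjcB !conjCK conjcR [X in X / _]mulrC.
Qed.

Lemma res_bound (u : C) : (forall j, u != (lim_eig j)%:C) ->
  exists X : R, (forall h, normc (res u h) <= X) /\
  \forall M \near U, forall h, (h < M)%N -> normc (resM u M h) <= X.
Proof.
move=> /spectrum_dist[d d0 hd]; exists d^-1.
have hb : \forall M \near U, forall h, (h < M)%N -> normc (resM u M h) <= d^-1.
  by apply: filterS hd => M hM h hhM; exact: resM_bound.
split => // h; apply: normc_culim.
have hM : \forall M \near U, (h < M)%N by exact: (near_ultra (N := h.+1)).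
by apply: filterS2 hb hM => M h1 h2; exact: h1.
Qed.

Lemma near_spectrum_neq (u : C) : (forall j, u != (lim_eig j)%:C) ->
  \forall M \near U, forall j, (j < M)%N -> u != (S M j)%:C.
Proof.
move=> /spectrum_dist[d d0 hd]; apply: filterS hd => M hM j jM.
by rewrite -subr_eq0 -normc_gt0 (lt_le_trans d0)// hM.
Qed.

Lemma res_eq (u : C) : (forall j, u != (lim_eig j)%:C) ->
  forall h, u * res u h - lax_op W eps (res u) h = e0 h.
Proof.
move=> uS h; have [X [bX bM]] := res_bound uS.
have X0 : 0 <= X by exact: le_trans (normc_ge0 _) (bX 0%N).
have hM : \forall M \near U, (h < M)%N by exact: (near_ultra (N := h.+1)).
have bh : cbounded (fun M => resM u M h).
  by exists X; apply: filterS2 bM hM => M h1 h2; exact: h1.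
have bW : cbounded (fun M => \sum_(k < M) W h k * resM u M k).
  exists (B0 * X); apply: filterS bM => M h1.
  have := W_weight W_bnd (p := 0) (x := resM u M) h (N := M) X0.
  by rewrite expr0 mulr1; apply => k kM; rewrite expr0 mulr1 h1.
have <- : culim (fun M => (u + (eps * h%:R)%:C) * resM u M h -
   \sum_(k < M) W h k * resM u M k) = e0 h.
  rewrite (@near_eq_culim _ _ (fun=> e0 h)) ?culim_cst//.
  apply: filterS2 (near_spectrum_neq uS) hM => M uM hM'.
  by rewrite /e0 -(resM_eq hM' uM) lax_mx_sum//; ring.
rewrite culimB//; last by apply: cboundedM => //; exact: cbounded_cst.
rewrite culimM ?culim_cst//; last exact: cbounded_cst.
rewrite (Wop_lim W_bnd _ X0 bM (x := res u))// /lax_op -/(res u h); ring.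
Qed.

Lemma e0_decay p : exists Y : R, forall h, normc (e0 h : C) * (1 + h%:R) ^+ p <= Y.
Proof.
exists 1; case=> [|h]; rewrite /e0 normc_nat ?mul0r ?ler01//.
by rewrite mul1r addr0 expr1n.
Qed.

Lemma res_decay (u : C) : (forall j, u != (lim_eig j)%:C) ->
  forall p, exists Y : R, forall h, normc (res u h) * (1 + h%:R) ^+ p <= Y.
Proof.
move=> uS; have [X [bX _]] := res_bound uS.
by apply: (resolvent_decay eps_gt0 W_bnd bX e0_decay); exact: res_eq.
Qed.

(** The solution x is paired with y = (conj u - L_M)^-1 |0>. Symmetry of L_M gives x_0 = conj y_0
    plus the pairing of y with the part of W x that the truncation drops. As x decays to order 2,
    each of the M dropped entries is O(M^-2) while y is bounded, so this error tends to 0. *)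
Lemma resolvent_unique (u : C) (x : nat -> C) (X : R) : (forall j, u != (lim_eig j)%:C) ->
  (forall h, normc (x h) <= X) ->
  (forall h, u * x h - lax_op W eps x h = e0 h) -> x 0%N = res u 0%N.
Proof.
move=> uS bX xE.
have [Y hY] := resolvent_decay eps_gt0 W_bnd bX e0_decay xE 2.
have uJS j : u^* != (lim_eig j)%:C.
  by rewrite -(inj_eq (inv_inj (@conjCK _))) conjCK conjcR.
have Y0 : 0 <= Y by apply: le_trans (hY 0%N); rewrite mulr_ge0 ?normc_ge0 ?exprn_ge0 ?addr_ge0.
have [d d0 hd] := spectrum_dist uJS.
apply/esym/culimP => e e0'.
have [m hm] : exists m : nat, d^-1 * (B0 * Y) / e <= m%:R.
  by exists (Num.truncn (d^-1 * (B0 * Y) / e)).+1; rewrite ltW// truncnS_gt.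
have mM : \forall M \near U, (m.+1 <= M)%N by exact: (near_ultra (N := m.+1)).
apply: filterS3 hd (near_spectrum_neq uJS) mM => M hM uM mM'.
have M0 : (0 < M)%N by exact: leq_ltn_trans mM'.
rewrite -resM_conj; set y := resM u^* M.
pose r h := Wop W x h - \sum_(k < M) W h k * x k.
have key : \sum_(h < M) (y h)^* * (u * x h - \sum_(k < M) lax_mx W eps h k * x k) = x 0%N.
  under eq_bigr do rewrite mulrBr.
  rewrite sumrB -(sum_kronecker x M0).
  under [X in _ - X]eq_bigr do rewrite mulr_sumr.
  rewrite [X in _ - X]exchange_big /= -sumrB; apply: eq_bigr => h _.
  have -> : (0%N == h :> nat)%:R = ((h == 0%N :> nat)%:R : C)^* by rewrite eq_sym rmorph_nat.
  rewrite -(resM_eq (ltn_ord h) uM) conjcB conjcM conjCK -/y mulrBr.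
  congr (_ - _); first by ring.
  rewrite conjc_sum mulr_sumr; apply: eq_bigr => k _.
  by rewrite conjcM (lax_mx_herm _ W_herm k h); ring.
have key2 : x 0%N = (y 0%N)^* + \sum_(h < M) (y h)^* * r h.
  rewrite -[LHS]key -[X in X + _](sum_kronecker (fun h => (y h)^*) M0) -big_split /=.
  apply: eq_bigr => h _; rewrite -mulrDr; congr (_ * _).
  have -> : (0%N == h :> nat)%:R = e0 h :> C by rewrite /e0 eq_sym.
  by rewrite -xE lax_mx_sum// /lax_op /r; ring.
rewrite key2 opprD addNKr normcNE.
apply: le_trans (normc_sum _ _ _) _.
have M1 : 0 < 1 + M%:R :> R by rewrite ltr_pwDl.
have rb h : normc (r h) <= B0 * Y / (1 + M%:R) ^+ 2.
  rewrite /r; apply: normc_culimB; apply: (near_ultra (N := M)) => N MN.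
  rewrite -!(big_mkord xpredT (fun k => W h k * x k)).
  rewrite (big_cat_nat (leq0n M) MN) /= addrAC subrr add0r.
  apply: le_trans (normc_sum _ _ _) _.
  apply: (@le_trans _ _ ((\sum_(0 <= k < N) normc (W h k)) * (Y / (1 + M%:R) ^+ 2))); last first.
    rewrite -mulrA ler_wpM2r ?divr_ge0 ?exprn_ge0 ?addr_ge0//.
    by rewrite big_mkord (W_bnd0 W_bnd).
  rewrite (big_cat_nat (leq0n M) MN) /= mulrDl ler_wpDl//.
    by rewrite mulr_ge0 ?divr_ge0 ?exprn_ge0 ?addr_ge0// sumr_ge0// => *; exact: normc_ge0.
  rewrite mulr_suml !big_nat; apply: ler_sum => k /andP[Mk _].
  rewrite normcM ler_wpM2l ?normc_ge0// ler_pdivlMr ?exprn_gt0//.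
  apply: le_trans (hY k); rewrite ler_wpM2l ?normc_ge0//.
  by apply: lerXn2r; rewrite ?nnegrE ?addr_ge0// lerD2l ler_nat.
apply: (@le_trans _ _ (\sum_(h < M) d^-1 * (B0 * Y / (1 + M%:R) ^+ 2))).
  apply: ler_sum => h _; rewrite normcM normcJE; apply: ler_pM; rewrite ?normc_ge0//.
  exact: resM_bound.
rewrite sumr_const card_ord -[X in X <= _]mulr_natr.
have : d^-1 * (B0 * Y) <= e * m%:R
  by move: hm; rewrite ler_pdivrMr// [m%:R * e]mulrC.
have dB : 0 <= d^-1 * (B0 * Y).
  by rewrite !mulr_ge0 ?invr_ge0 ?(Bw_ge0 W_bnd)// ltW.
move=> hm2.
have -> : d^-1 * (B0 * Y / (1 + M%:R) ^+ 2) * M%:R =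
  (d^-1 * (B0 * Y)) * M%:R / (1 + M%:R) ^+ 2 by ring.
rewrite ler_pdivrMr ?exprn_gt0//.
have mM2 : m%:R <= M%:R :> R by rewrite ler_nat ltnW.
apply: (@le_trans _ _ (e * M%:R * M%:R)).
  by rewrite ler_wpM2r// (le_trans hm2)// (ler_wpM2l (ltW e0')).
rewrite -mulrA (ler_wpM2l (ltW e0'))//.
have : 0 <= M%:R :> R by []. nra.
Qed.

(** Eigenvalues of index at least J lie at distance at least eps J - [B0] - |u| from u, and the
    masses of a truncation sum to 1; so the dropped terms are bounded by the inverse distance,
    uniformly in M. *)
Lemma res_series (u : C) J : (forall j, u != (lim_eig j)%:C) ->
  B0 + normc u < eps * J%:R ->
  normc (res u 0%N - \sum_(j < J) (lim_weight j)%:C / (u - (lim_eig j)%:C)) <=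
  (eps * J%:R - B0 - normc u)^-1.
Proof.
move=> uS hJ; set D := eps * J%:R - B0 - normc u.
have D0 : 0 < D by rewrite /D; lra.
have [d d0 hd] := spectrum_dist uS.
pose T M j := (trunc_weight M j)%:C / (u - (S M j)%:C).
have bS j : cbounded (fun M => (S M j)%:C) by exact: cboundedR (ubounded_S j).
have jM j : \forall M \near U, (j < M)%N by exact: (near_ultra (N := j.+1)).
have bI j : cbounded (fun M => (u - (S M j)%:C)^-1).
  exists d^-1; apply: filterS2 hd (jM j) => M h1 h2.
  by rewrite normcV lef_pV2 ?posrE// ?(lt_le_trans d0)// h1.
have limI j : culim (fun M => (u - (S M j)%:C)^-1) = (u - (lim_eig j)%:C)^-1.
  have uj : u - (lim_eig j)%:C != 0 by rewrite subr_eq0.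
  apply: (mulIf uj); rewrite mulVf//.
  have -> : u - (lim_eig j)%:C = culim (fun M => u - (S M j)%:C).
    by rewrite culimB ?culim_cst ?culimR//; exact: cbounded_cst.
  rewrite -culimM//; last first.
    by apply: cboundedD; [exact: cbounded_cst|exact: cboundedN].
  rewrite (@near_eq_culim _ _ (fun=> 1)) ?culim_cst//.
  apply: filterS2 hd (jM j) => M h1 h2; rewrite mulVf// -normc_gt0.
  by rewrite (lt_le_trans d0)// h1.
have bT j : cbounded (fun M => T M j).
  by apply: cboundedM => //; apply: cboundedR; exact: ubounded_weight.
have limT j : culim (fun M => T M j) = (lim_weight j)%:C / (u - (lim_eig j)%:C).
  by rewrite culimM ?limI ?culimR//; apply: cboundedR; exact: ubounded_weight.
have -> : \sum_(j < J) (lim_weight j)%:C / (u - (lim_eig j)%:C) = culim (fun M => \sum_(j < J) T M j).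
  by rewrite culim_sum//; apply: eq_bigr => j _; rewrite limT.
have [X [_ bX]] := res_bound uS.
have b0 : cbounded (fun M => resM u M 0).
  by exists X; apply: filterS2 bX (jM 0%N) => M h1 h2; exact: h1.
rewrite -culimB//; last exact: cbounded_sum.
apply: normc_culim; apply: (near_ultra (N := J.+1)) => M JM.
have M0 : (0 < M)%N by lia.
have -> : resM u M 0 = \sum_(j < M) T M j.
  by apply: eq_bigr => j _; rewrite mulcJ.
rewrite -!(big_mkord xpredT (T M)) (big_cat_nat (leq0n J) (ltnW JM)) /=.
rewrite addrAC subrr add0r; apply: le_trans (normc_sum _ _ _) _.
apply: (@le_trans _ _ (\sum_(J <= j < M) trunc_weight M j * D^-1)).
  rewrite !big_nat; apply: ler_sum => j /andP[Jj jM'].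
  rewrite normcM normcV normcR ger0_norm ?weight_ge0//.
  rewrite ler_wpM2l ?weight_ge0// lef_pV2 ?posrE//; last first.
    have := near_spectrum_neq uS => _.
    rewrite normc_gt0.
    apply: contraTneq (trunc_eig_upper jM') => /eqP; rewrite subr_eq0 => /eqP ue.
    rewrite -ltNge; have : eps * J%:R <= eps * j%:R by rewrite (ler_wpM2l (ltW eps_gt0)) ?ler_nat.
    move: hJ; rewrite ue normcR; have := ler_norm (- S M j); rewrite normrN; lra.
  have := trunc_eig_upper jM'.
  have : eps * J%:R <= eps * j%:R by rewrite (ler_wpM2l (ltW eps_gt0)) ?ler_nat.
  have := normcB_ge (S M j)%:C u; rewrite [normc (_ - u)]normcBC normcR /D.
  by have := ler_norm (- S M j); rewrite normrN; move=> h1 h2 h3 h4; lra.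
rewrite -mulr_suml ler_piMl ?invr_ge0 ?(ltW D0)// -(sum_weight_eq M0).
rewrite -(big_mkord xpredT (trunc_weight M)) (big_cat_nat (leq0n J) (ltnW JM)) /= lerDr.
by apply: sumr_ge0 => *; exact: weight_ge0.
Qed.

End TruncatedSpectrum.

Lemma sum_inv_sq {R : realType} (M : nat) :
  \sum_(h < M) ((1 + h%:R) ^+ 2)^-1 <= 2 :> R.
Proof.
case: M => [|M]; first by rewrite big_ord0.
(* The sharper bound is the one that passes through the induction, by telescoping. *)
apply: (@le_trans _ _ (2 - (M.+1%:R)^-1)); last by rewrite gerBl invr_ge0.
elim: M => [|M IH]; first by rewrite big_ord1 addr0 expr1n invr1; lra.
rewrite big_ord_recr /=; apply: le_trans (lerD IH (lexx _)) _.
set a : R := M.+1%:R; have a0 : 0 < a by rewrite ltr0n.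
have -> : M.+2%:R = a + 1 :> R by rewrite /a -natr1.
rewrite [1 + a]addrC.
rewrite -subr_ge0.
have -> : 2 - (a + 1)^-1 - (2 - a^-1 + ((a + 1) ^+ 2)^-1) = (a * (a + 1) ^+ 2)^-1.
  by field; apply/andP; split; apply: lt0r_neq0; lra.
by rewrite invr_ge0 mulr_ge0 ?sqr_ge0 ?ltW.
Qed.

(** * Finitely many masses force a polynomial relation on the iterates of L *)

Section FiniteSupport.
Context {R : realType}.
Local Notation C := R[i].
Context (eps : R) (W : nat -> nat -> C) (Bw : nat -> R).
Hypotheses (eps_gt0 : 0 < eps)
  (W_herm : forall h k, W h k = (W k h)^*)
  (W_bnd : forall p h N,
     \sum_(k < N) normc (W h k) * (1 + (ndist h k)%:R) ^+ p <= Bw p).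
Context (S : nat -> nat -> R) (phi : nat -> nat -> nat -> C).
Hypothesis eigP : forall M,
  [/\ forall j k, (j < M)%N -> (k < M)%N ->
        \sum_(h < M) (phi M j h)^* * phi M k h = (j == k)%:R,
      forall h k, (h < M)%N -> (k < M)%N ->
        \sum_(j < M) phi M j h * (phi M j k)^* = (h == k)%:R,
      forall j h, (j < M)%N -> (h < M)%N ->
        \sum_(k < M) lax_mx W eps h k * phi M j k = (S M j)%:C * phi M j h &
      forall j k, (j <= k)%N -> (k < M)%N -> S M k <= S M j].

Local Notation U := nat_ultra.
Local Notation B0 := (Bw 0).
Local Notation Sl := (lim_eig S).
Local Notation al := (lim_weight phi).
Local Notation weight := (trunc_weight phi).

Definition trunc_op M (x : nat -> C) h := \sum_(k < M) lax_mx W eps h k * x k.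

Lemma iter_trunc_eig M i h : (h < M)%N ->
  iter i (trunc_op M) e0 h =
  \sum_(j < M) (S M j)%:C ^+ i * (phi M j h * (phi M j 0%N)^*).
Proof.
have [_ full eig _] := eigP M.
elim: i h => [|i IH] h hM.
  have M0 : (0 < M)%N by exact: leq_ltn_trans hM.
  by rewrite /= /e0 -full//; apply: eq_bigr => j _; rewrite expr0 mul1r.
rewrite iterS {1}/trunc_op; under eq_bigr => k _ do rewrite IH// mulr_sumr.
rewrite exchange_big /=; apply: eq_bigr => j _.
rewrite exprSr -mulrA [X in _ * X]mulrA -eig// mulr_suml mulr_sumr.
by apply: eq_bigr => k _; ring.
Qed.

(** The bound is uniform in M. Each application of the operator costs one power of the weight,
    because of D, and |0> has all powers to spend. *)
Lemma iter_trunc_bound i p : exists X : R,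
  forall M h, normc (iter i (trunc_op M) e0 h) * (1 + h%:R) ^+ p <= X.
Proof.
elim: i p => [|i IH] p; first by have [X hX] := @e0_decay R p; exists X.
have [X hX] := IH p; have [Y hY] := IH p.+1.
have X0 : 0 <= X.
  by apply: le_trans (hX 0%N 0%N); rewrite mulr_ge0 ?normc_ge0 ?exprn_ge0 ?addr_ge0.
have Y0 : 0 <= Y.
  by apply: le_trans (hY 0%N 0%N); rewrite mulr_ge0 ?normc_ge0 ?exprn_ge0 ?addr_ge0.
exists (Bw p * X + eps * Y) => M h; rewrite iterS {1}/trunc_op.
set x := iter i (trunc_op M) e0.
have h0 : 0 <= (1 + h%:R) ^+ p :> R by rewrite exprn_ge0// addr_ge0.
have wb : normc (\sum_(k < M) W h k * x k) * (1 + h%:R) ^+ p <= Bw p * X.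
  by apply: (W_weight W_bnd) => // k _; exact: hX.
have [hM|Mh] := ltnP h M.
  rewrite lax_mx_sum//; apply: le_trans (ler_wpM2r h0 (normcD _ _)) _.
  rewrite mulrDl lerD// normcNE normcM normcR ger0_norm; last by rewrite mulr_ge0// ltW.
  rewrite -!mulrA (ler_wpM2l (ltW eps_gt0))//; apply: le_trans (hY M h).
  rewrite -/x exprS mulrA mulrCA mulrA ler_wpM2r//.
  by rewrite ler_wpM2r ?normc_ge0// lerDr.
(* In the rows h >= M the diagonal entry lies outside the sum, so only the Toeplitz part remains. *)
have -> : \sum_(k < M) lax_mx W eps h k * x k = \sum_(k < M) W h k * x k.
  apply: eq_bigr => k _; rewrite /lax_mx gtn_eqF ?mulr0 ?subr0//.
  exact: leq_trans (ltn_ord k) Mh.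
by apply: le_trans wb _; rewrite lerDl mulr_ge0// ltW.
Qed.

Lemma iter_trunc_cbounded i h : cbounded (fun M => iter i (trunc_op M) e0 h).
Proof.
have [X hX] := iter_trunc_bound i 0; exists X; apply: (near_ultra (N := 0)) => M _.
by have := hX M h; rewrite expr0 mulr1.
Qed.

Lemma iter_trunc_lim i h :
  culim (fun M => iter i (trunc_op M) e0 h) = iter i (lax_op W eps) e0 h.
Proof.
elim: i h => [|i IH] h; first by rewrite /= culim_cst.
have [X hX] := iter_trunc_bound i 0.
have X0 : 0 <= X.
  by apply: le_trans (hX 0%N 0%N); rewrite mulr_ge0 ?normc_ge0 ?exprn_ge0 ?addr_ge0.
have bX : \forall M \near U, forall k, (k < M)%N -> normc (iter i (trunc_op M) e0 k) <= X.
  by apply: (near_ultra (N := 0)) => M _ k _; have := hX M k; rewrite expr0 mulr1.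
have WX M : normc (\sum_(k < M) W h k * iter i (trunc_op M) e0 k) <= Bw 0 * X.
  have := W_weight W_bnd (p := 0) (x := iter i (trunc_op M) e0) h (N := M) X0.
  by rewrite expr0 mulr1; apply => k _.
rewrite iterS /lax_op -IH -(Wop_lim W_bnd h X0 bX (fun k => esym (IH k))).
rewrite -[X in _ - X * _]culim_cst -culimM; [|exact: cbounded_cst|exact: iter_trunc_cbounded].
rewrite -culimB.
- apply: near_eq_culim; apply: (near_ultra (N := h.+1)) => M hM.
  by rewrite iterS {1}/trunc_op lax_mx_sum.
- by exists (Bw 0 * X); apply: (near_ultra (N := 0)) => M _.
- by apply: cboundedM; [exact: cbounded_cst|exact: iter_trunc_cbounded].
Qed.

Definition poly_trunc (p : {poly C}) M h : C :=
  \sum_(i < size p) p`_i * iter i (trunc_op M) e0 h.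

Lemma poly_trunc_eig p M h : (h < M)%N ->
  poly_trunc p M h = \sum_(j < M) p.[(S M j)%:C] * (phi M j h * (phi M j 0%N)^*).
Proof.
move=> hM; rewrite /poly_trunc.
under eq_bigr do rewrite iter_trunc_eig// mulr_sumr.
rewrite exchange_big /=; apply: eq_bigr => j _.
by rewrite horner_coef mulr_suml; apply: eq_bigr => i _; rewrite -mulrA.
Qed.

Lemma poly_trunc_parseval p M :
  \sum_(h < M) normc (poly_trunc p M h) ^+ 2 =
  \sum_(j < M) normc p.[(S M j)%:C] ^+ 2 * weight M j.
Proof.
have [on full _ _] := eigP M.
rewrite (eig_parseval full); apply: eq_bigr => i _.
rewrite /trunc_weight -exprMn -[normc (phi M i 0%N)]normcJE -normcM; congr (normc _ ^+ 2).
rewrite eigcoef_def.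
under eq_bigr => h _ do rewrite poly_trunc_eig// mulr_sumr.
rewrite exchange_big /= -(sum_kronecker (fun j => p.[(S M j)%:C] * (phi M j 0)^*) (ltn_ord i)).
apply: eq_bigr => j _; rewrite -on// mulr_sumr.
by apply: eq_bigr => h _; ring.
Qed.

(** Weight 1 on the entries bounds their squares by a multiple of (1 + h)^-2, which is summable. *)
Lemma poly_trunc_sqr_bound p : exists X : R,
  forall M, \sum_(h < M) normc (poly_trunc p M h) ^+ 2 <= X.
Proof.
have /choice[X hX] : forall i, exists X : R,
    forall M h, normc (iter i (trunc_op M) e0 h) * (1 + h%:R) ^+ 1 <= X.
  by move=> i; exact: iter_trunc_bound.
pose Y := \sum_(i < size p) normc p`_i * X i.
exists (Y ^+ 2 * 2) => M.
apply: (@le_trans _ _ (Y ^+ 2 * \sum_(h < M) ((1 + h%:R) ^+ 2)^-1)); last first.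
  by rewrite ler_wpM2l ?sqr_ge0// sum_inv_sq.
rewrite mulr_sumr; apply: ler_sum => h _.
have h0 : 0 < 1 + h%:R :> R by rewrite ltr_pwDl.
rewrite ler_pdivlMr ?exprn_gt0// -exprMn.
have le1 : normc (poly_trunc p M h) * (1 + h%:R) <= Y.
  apply: le_trans (ler_wpM2r (ltW h0) (normc_sum _ _ _)) _.
  rewrite mulr_suml; apply: ler_sum => i _; rewrite normcM -mulrA.
  by rewrite ler_wpM2l ?normc_ge0//; have := hX i M h; rewrite expr1.
by apply: lerXn2r; rewrite ?nnegrE ?mulr_ge0 ?normc_ge0 ?(ltW h0)//;
  apply: le_trans le1; rewrite mulr_ge0 ?normc_ge0 ?(ltW h0).
Qed.

Lemma ulim_prod (J : nat) (f : nat -> nat -> R) : (forall j, ubounded (f j)) ->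
  ulim (fun M => \prod_(j < J) f j M) = \prod_(j < J) ulim (f j) /\
  ubounded (fun M => \prod_(j < J) f j M).
Proof.
move=> bf; elim: J => [|J [IH1 IH2]].
  split; last by under [X in ubounded X]eq_fun do rewrite big_ord0; exact: ubounded_cst.
  by under [X in ulim X]eq_fun do rewrite big_ord0; rewrite ulim_cst big_ord0.
split.
  under [X in ulim X]eq_fun do rewrite big_ord_recr.
  by rewrite ulimM// IH1 big_ord_recr.
by under [X in ubounded X]eq_fun do rewrite big_ord_recr; exact: uboundedM.
Qed.

(* |q(L_M) e0|^2 = sum_j |q(S_j)|^2 weight_j: the terms below J0 tend to 0 with
   q(S_j), those between J0 and J with weight_j, and the tail is small because
   |L_M q(L_M) e0|^2 is bounded and |S_j| is large. *)
Lemma finite_support_relation J0 : (forall j, (J0 <= j)%N -> al j = 0) ->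
  let q : {poly C} := \prod_(j < J0) ('X - (Sl j)%:C%:P) in
  forall h, \sum_(i < size q) q`_i * iter i (lax_op W eps) e0 h = 0.
Proof.
move=> al0 q h.
pose g s : R := \prod_(l < J0) (s - Sl l) ^+ 2.
have qg s : normc q.[s%:C] ^+ 2 = g s.
  rewrite /q horner_prod normc_prod -prodrXl; apply: eq_bigr => l _.
  by rewrite hornerXsubC -rmorphB normcR real_normK ?num_real.
have bS j := ubounded_S eps_gt0 W_herm W_bnd eigP j.
have bw j := ubounded_weight eigP j.
have bl j l : ubounded (fun M => (S M j - Sl l) ^+ 2).
  have b : ubounded (fun M => S M j - Sl l).
    by apply: uboundedD => //; exact: ubounded_cst.
  by under [X in ubounded X]eq_fun do rewrite expr2; exact: uboundedM.
have head J : ulim (fun M => \sum_(j < J) g (S M j) * weight M j) = 0 /\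
    ubounded (fun M => \sum_(j < J) g (S M j) * weight M j).
  have bg j : ubounded (fun M => g (S M j)) by have [] := ulim_prod J0 (bl j).
  have [|-> b] := @ulim_sum R J (fun j M => g (S M j) * weight M j).
    by move=> j; exact: uboundedM.
  split => //; apply: big1 => j _; rewrite ulimM//.
  have [jJ|/al0] := ltnP j J0; last by rewrite /lim_weight => ->; rewrite mulr0.
  have [-> _] := ulim_prod J0 (bl j).
  rewrite (bigD1 (Ordinal jJ))//=.
  under [X in ulim X]eq_fun do rewrite expr2.
  have b2 : ubounded (fun M => S M j - Sl j) by apply: uboundedD => //; exact: ubounded_cst.
  rewrite ulimM// ulimD ?ulim_cst//; last exact: ubounded_cst.
  by rewrite subrr !mul0r.
have -> : \sum_(i < size q) q`_i * iter i (lax_op W eps) e0 h =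
    culim (fun M => poly_trunc q M h).
  rewrite /poly_trunc culim_sum => [|i].
    apply: eq_bigr => i _; rewrite culimM ?culim_cst ?iter_trunc_lim//.
      exact: cbounded_cst.
    exact: iter_trunc_cbounded.
  by apply: cboundedM; [exact: cbounded_cst|exact: iter_trunc_cbounded].
apply: culimP => e e_gt0.
have [X hX] := poly_trunc_sqr_bound (q * 'X).
have X0 : 0 <= X by apply: le_trans (hX 0%N); rewrite big_ord0.
have e2 : 0 < e ^+ 2 / 2 by rewrite divr_gt0 ?exprn_gt0.
(* For j >= J the choice of [J] below gives S_j <= - D, hence S_j^2 >= D^2 >= D; the tail is then at
   most X / D <= e^2 / 2. *)
pose D : R := 1 + X / (e ^+ 2 / 2).
have D1 : 1 <= D by rewrite lerDl divr_ge0 ?(ltW e2).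
have DX : X <= e ^+ 2 / 2 * D.
  by rewrite mulrDr mulr1 mulrCA divff ?(gt_eqF e2)// mulr1 lerDr ltW.
have [J hJ] : exists J : nat, B0 + D <= eps * J%:R.
  exists (Num.truncn ((B0 + D) / eps)).+1.
  by rewrite mulrC -ler_pdivrMr// ltW// truncnS_gt.
have [hd1 hd2] := head J.
have hMh : \forall M \near U, (maxn J h < M)%N by exact: (near_ultra (N := (maxn J h).+1)).
apply: filterS2 (ulim_near hd2 e2) hMh => M; rewrite hd1 !subr0 => hM.
rewrite gtn_max => /andP[JM hhM].
rewrite -(@ler_pXn2r _ 2)// ?nnegrE ?normc_ge0 ?(ltW e_gt0)//.
apply: (@le_trans _ _ (\sum_(j < M) g (S M j) * weight M j)).
  have := poly_trunc_parseval q M.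
  under [RHS]eq_bigr do rewrite qg.
  move=> <-; rewrite (bigD1 (Ordinal hhM))//= lerDl.
  by apply: sumr_ge0 => *; exact: sqr_ge0.
rewrite -(big_mkord xpredT (fun j => g (S M j) * weight M j)).
rewrite (big_cat_nat (leq0n J) (ltnW JM)) /= [e ^+ 2]splitr; apply: lerD.
  by rewrite big_mkord; apply: le_trans (ler_norm _) (ltW hM).
rewrite -(ler_pM2r (lt_le_trans ltr01 D1)); apply: le_trans DX.
apply: le_trans (hX M); rewrite poly_trunc_parseval.
rewrite -(big_mkord xpredT (fun j => normc (q * 'X).[(S M j)%:C] ^+ 2 * weight M j)).
rewrite (big_cat_nat (leq0n J) (ltnW JM)) /=; apply: ler_wpDl.
  by apply: sumr_ge0 => j _; rewrite mulr_ge0 ?sqr_ge0.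
rewrite mulr_suml !big_nat; apply: ler_sum => j /andP[Jj jM].
rewrite hornerM hornerX normcM exprMn qg normcR real_normK ?num_real//.
rewrite mulrAC ler_wpM2r ?sqr_ge0// ler_wpM2l//.
  by rewrite -qg sqr_ge0.
have := trunc_eig_upper eps_gt0 W_herm W_bnd eigP jM.
have : eps * J%:R <= eps * j%:R by rewrite (ler_wpM2l (ltW eps_gt0)) ?ler_nat.
nra.
Qed.

End FiniteSupport.

(** * Power series and the iterates of the Lax operator *)

Section Convolution.
Context {F : fieldType}.
Implicit Types (x y z : nat -> F) (p q r : {poly F}).

(** Sequences stand for formal power series in w: [conv] is their product, [pseq] embeds
    polynomials, [xderiv] is w d/dw, that is D, and [shift] is multiplication by w. *)
Definition conv x y (h : nat) : F := \sum_(j < h.+1) x j * y (h - j)%N.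

Definition pseq p : nat -> F := fun h => p`_h.

Definition xderiv x : nat -> F := fun h => h%:R * x h.

Definition shift x : nat -> F := fun h => if h is h'.+1 then x h' else 0.

(** The coefficient of index h of a product involves only coefficients up to h, so ring identities
    pass from polynomials to power series by truncation. *)
Lemma conv_coef x y p q h :
  (forall k, (k <= h)%N -> p`_k = x k) -> (forall k, (k <= h)%N -> q`_k = y k) ->
  conv x y h = (p * q)`_h.
Proof.
move=> px qy; rewrite coefM; apply: eq_bigr => j _.
by rewrite px ?qy ?leq_subr// -ltnS ltn_ord.
Qed.

Lemma trunc_coef x N k : (k < N)%N -> (\poly_(i < N) x i)`_k = x k.
Proof. by move=> kN; rewrite coef_poly kN. Qed.

Lemma convA x y z : conv (conv x y) z = conv x (conv y z).
Proof.
apply/funext => h.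
pose p := \poly_(i < h.+1) x i; pose q := \poly_(i < h.+1) y i.
pose r := \poly_(i < h.+1) z i.
have px k : (k <= h)%N -> p`_k = x k by move=> kh; rewrite trunc_coef.
have qy k : (k <= h)%N -> q`_k = y k by move=> kh; rewrite trunc_coef.
have rz k : (k <= h)%N -> r`_k = z k by move=> kh; rewrite trunc_coef.
rewrite (@conv_coef _ _ (p * q) r)//; last first.
  move=> k kh; rewrite (@conv_coef _ _ p q)// => l lk; first by rewrite px// (leq_trans lk).
  by rewrite qy// (leq_trans lk).
rewrite (@conv_coef _ _ p (q * r)) ?mulrA// => k kh.
rewrite (@conv_coef _ _ q r)// => l lk; first by rewrite qy// (leq_trans lk).
by rewrite rz// (leq_trans lk).
Qed.

Lemma conv_pseqM p q : pseq (p * q) = conv (pseq p) (pseq q).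
Proof. by apply/funext => h; rewrite (@conv_coef _ _ p q). Qed.

Lemma convC x y : conv x y = conv y x.
Proof.
apply/funext => h.
pose p := \poly_(i < h.+1) x i; pose q := \poly_(i < h.+1) y i.
rewrite (@conv_coef _ _ p q) => [|k kh|k kh]; rewrite ?trunc_coef//.
rewrite (@conv_coef _ _ q p) => [|k kh|k kh]; rewrite ?trunc_coef//.
by rewrite mulrC.
Qed.

Lemma convDr x y z h : conv x (fun k => y k + z k) h = conv x y h + conv x z h.
Proof. by rewrite /conv -big_split; apply: eq_bigr => j _; rewrite mulrDr. Qed.

Lemma convZr (c : F) x y h : conv x (fun k => c * y k) h = c * conv x y h.
Proof. by rewrite /conv mulr_sumr; apply: eq_bigr => j _; rewrite mulrCA. Qed.

Lemma conv_sumr n (c : nat -> F) x (y : nat -> nat -> F) h :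
  conv x (fun k => \sum_(i < n) c i * y i k) h = \sum_(i < n) c i * conv x (y i) h.
Proof.
rewrite /conv; under eq_bigr do rewrite mulr_sumr.
rewrite exchange_big /=; apply: eq_bigr => i _.
by rewrite mulr_sumr; apply: eq_bigr => j _; rewrite mulrCA.
Qed.

Lemma conv_xderiv x y h :
  conv x (xderiv y) h = xderiv (conv x y) h - conv (xderiv x) y h.
Proof.
rewrite /xderiv /conv mulr_sumr -sumrB; apply: eq_bigr => j _.
have -> : h%:R = (h - j)%:R + j%:R :> F by rewrite -natrD subnK// -ltnS ltn_ord.
ring.
Qed.

Lemma xderiv_pseq p : xderiv (pseq p) = pseq ('X * p^`()).
Proof.
apply/funext => -[|h]; rewrite /xderiv /pseq coefXM ?mul0r//=.
by rewrite coef_deriv mulr_natl.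
Qed.

Lemma conv_mulX_addC q (c : F) y h :
  conv (pseq (q * 'X + c%:P)) y h = shift (conv (pseq q) y) h + c * y h.
Proof.
rewrite [LHS]/conv big_ord_recl /= subn0.
rewrite {1}/pseq coefD coefMX coefC add0r.
rewrite addrC; congr (_ + _).
case: h => [|h]; first by rewrite big_ord0.
rewrite /= /conv; apply: eq_bigr => j _.
by rewrite /pseq /= coefD coefMX coefC /= addr0 /bump /= add1n subSS.
Qed.

Lemma pseqD p q h : pseq (p + q) h = pseq p h + pseq q h.
Proof. by rewrite /pseq coefD. Qed.

Lemma pseq_inj p q : pseq p = pseq q -> p = q.
Proof. by move=> e; apply/polyP => i; rewrite -/(pseq p i) e. Qed.

Lemma conv1 y : conv (pseq 1) y = y.
Proof.
apply/funext => h; rewrite /conv big_ord_recl /= subn0 big1 ?addr0.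
  by rewrite /pseq coef1 mul1r.
by move=> j _; rewrite /pseq coef1 mul0r.
Qed.

End Convolution.

(** * Linear independence of the iterates through their pole orders *)

Section KrylovIndependence.
Context {R : realType}.
Local Notation C := R[i].
Context (W : nat -> nat -> C) (Bw : nat -> R) (eps : R) (v : nat -> C).
Hypotheses (eps_gt0 : 0 < eps)
  (W_bnd : forall p h N,
     \sum_(k < N) normc (W h k) * (1 + (ndist h k)%:R) ^+ p <= Bw p)
  (W_toep : forall h k, W h.+1 k.+1 = W h k)
  (W_v : forall h, W h 0%N = v h).

Definition bounded_seq (x : nat -> C) := exists X : R, forall h, normc (x h) <= X.

Lemma Wop_cbounded x h : bounded_seq x -> cbounded (fun N => \sum_(k < N) W h k * x k).
Proof.
move=> [X hX]; have X0 : 0 <= X by exact: le_trans (normc_ge0 _) (hX 0%N).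
exists (Bw 0 * X); apply: (near_ultra (N := 0)) => N _.
have := W_weight W_bnd (p := 0) (x := x) h (N := N) X0.
by rewrite expr0 mulr1; apply => k _; rewrite expr0 mulr1.
Qed.

Lemma WopD x y h : bounded_seq x -> bounded_seq y ->
  Wop W (fun k => x k + y k) h = Wop W x h + Wop W y h.
Proof.
move=> bx by_; rewrite /Wop -culimD; [|exact: Wop_cbounded..].
by congr culim; apply/funext => N; rewrite -big_split; apply: eq_bigr => k _; rewrite mulrDr.
Qed.

Lemma WopZ (c : C) x h : bounded_seq x -> Wop W (fun k => c * x k) h = c * Wop W x h.
Proof.
move=> bx; rewrite /Wop -[X in X * _]culim_cst -culimM;
  [|exact: cbounded_cst|exact: Wop_cbounded].
by congr culim; apply/funext => N; rewrite mulr_sumr; apply: eq_bigr => k _; rewrite mulrCA.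
Qed.

(** Translation invariance along the diagonal. The output coefficient 0 escapes it, and this is the
    only source of error terms in [conv_Wop]. *)
Lemma Wop_shift x h : bounded_seq x -> Wop W (shift x) h.+1 = Wop W x h.
Proof.
move=> [X hX]; have X0 : 0 <= X by exact: le_trans (normc_ge0 _) (hX 0%N).
apply: culimP => e e0'.
have [K hK] := @W_sum_tail _ W Bw W_bnd h (e / 2) X (divr_gt0 e0' (ltr0n _ 2)) X0.
have tail N : (K <= N)%N ->
    normc (\sum_(k < N) W h k * x k - \sum_(k < K) W h k * x k) <= e / 2.
  by move=> KN; exact: hK.
have wt : normc (Wop W x h - \sum_(k < K) W h k * x k) <= e / 2.
  by apply: normc_culimB; apply: (near_ultra (N := K)) => N; exact: tail.
apply: (near_ultra (N := K.+1)) => -[//|N] KN.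
rewrite big_ord_recl /= mulr0 add0r.
under eq_bigr do rewrite W_toep.
rewrite -(subrKA (\sum_(k < K) W h k * x k)) [e]splitr.
apply: le_trans (normcD _ _) _; apply: lerD; first exact: tail.
by rewrite normcBC.
Qed.

Lemma conv_bounded p x : bounded_seq x -> bounded_seq (conv (pseq p) x).
Proof.
move=> [X hX]; elim/poly_ind: p => [|p c [Y hY]].
  by exists 0 => h; rewrite /conv big1 ?normc0// => j _; rewrite /pseq coef0 mul0r.
have Y0 : 0 <= Y by exact: le_trans (normc_ge0 _) (hY 0%N).
exists (Y + normc c * X) => h; rewrite conv_mulX_addC.
apply: le_trans (normcD _ _) _; apply: lerD; first by case: h => [|h]; rewrite [shift _ _]/= ?normc0.
by rewrite normcM ler_wpM2l ?normc_ge0.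
Qed.

Lemma shift_bounded x : bounded_seq x -> bounded_seq (shift x).
Proof.
move=> [X hX]; have X0 : 0 <= X by exact: le_trans (normc_ge0 _) (hX 0%N).
by exists X => -[|h]; rewrite [shift _ _]/= ?normc0.
Qed.

Lemma scale_bounded (c : C) x : bounded_seq x -> bounded_seq (fun h => c * x h).
Proof.
move=> [X hX]; exists (normc c * X) => h.
by rewrite normcM ler_wpM2l ?normc_ge0.
Qed.

(** Horner induction on p: commuting one multiplication by w past the Toeplitz operator creates an
    error at coefficient 0 only. The total error is a polynomial, hence has no pole and does not
    influence leading coefficients at b. *)
Lemma conv_Wop p x : bounded_seq x -> exists r : {poly C},
  forall h, conv (pseq p) (Wop W x) h = Wop W (conv (pseq p) x) h + pseq r h.
Proof.
move=> bx; elim/poly_ind: p => [|p c [r hr]].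
  have c0 y : conv (pseq (0 : {poly C})) y = fun=> 0.
    by apply/funext => h; rewrite /conv big1// => j _; rewrite /pseq coef0 mul0r.
  exists 0 => h; rewrite !c0 /Wop /pseq coef0 addr0.
  rewrite (_ : (fun N => _) = fun=> 0) ?culim_cst//.
  by apply/funext => N; rewrite big1// => k _; rewrite mulr0.
set y := conv (pseq p) x in hr *.
have by_ : bounded_seq y by exact: conv_bounded.
exists (r * 'X - (Wop W (shift y) 0%N)%:P) => h.
rewrite conv_mulX_addC.
have -> : conv (pseq (p * 'X + c%:P)) x = fun k => shift y k + c * x k.
  by apply/funext => k; rewrite conv_mulX_addC.
rewrite WopD; [|exact: shift_bounded|exact: scale_bounded].
rewrite WopZ// addrAC; congr (_ + _).
rewrite /pseq coefB coefMX coefC; case: h => [|h] /=.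
  by rewrite sub0r subrr.
by rewrite subr0 Wop_shift// hr.
Qed.

(** The entries on and below the diagonal multiply by the series v; those above the diagonal lower
    degrees, so on a polynomial they produce a polynomial. *)
Lemma Wop_pseq (p : {poly C}) : exists r : {poly C},
  forall h, Wop W (pseq p) h = conv v (pseq p) h + pseq r h.
Proof.
pose f h : C := \sum_(k < size p) (if (k <= h)%N then 0 else W h k * p`_k).
have W_diff h k : (k <= h)%N -> W h k = v (h - k)%N.
  elim: k h => [|k IH] h; first by rewrite W_v subn0.
  by case: h => // h kh; rewrite W_toep IH// subSS.
exists (\poly_(h < size p) f h) => h.
have -> : pseq (\poly_(i < size p) f i) h = f h.
  rewrite /pseq coef_poly; case: ltnP => // ph; rewrite /f big1// => k _.
  by rewrite (leq_trans _ ph)// ltnW.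
have -> : Wop W (pseq p) h = \sum_(k < size p + h.+1) W h k * p`_k.
  rewrite /Wop (near_eq_culim (G := fun=> \sum_(k < size p + h.+1) W h k * p`_k)) ?culim_cst//.
  apply: (near_ultra (N := (size p + h.+1)%N)) => N hN.
  rewrite -!(big_mkord xpredT (fun k => W h k * p`_k)).
  rewrite (big_cat_nat (leq0n _) hN) /= [X in _ + X]big_nat [X in _ + X]big1 ?addr0//.
  move=> k /andP[hk _]; rewrite nth_default ?mulr0//.
  by apply: leq_trans hk; rewrite leq_addr.
have -> : f h = \sum_(k < size p + h.+1) (if (k <= h)%N then 0 else W h k * p`_k).
  rewrite /f -!(big_mkord xpredT (fun k => if (k <= h)%N then 0 else W h k * p`_k)).
  rewrite [RHS](big_cat_nat (leq0n (size p)) (leq_addr _ _)) /= [X in _ + X]big_nat.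
  rewrite [X in _ + X]big1 ?addr0// => k /andP[hk _].
  by case: ifP => // _; rewrite nth_default ?mulr0.
have -> : conv v (pseq p) h = \sum_(k < size p + h.+1) (if (k <= h)%N then W h k * p`_k else 0).
  rewrite convC /conv -(big_mkord xpredT (fun j => pseq p j * v (h - j)%N)).
  rewrite -(big_mkord xpredT (fun k => if (k <= h)%N then W h k * p`_k else 0)).
  rewrite [RHS](big_cat_nat (leq0n h.+1) (leq_addl _ _)) /= [X in _ = _ + X]big_nat.
  rewrite [X in _ = _ + X]big1 ?addr0; last by move=> k /andP[hk _]; rewrite leqNgt hk.
  rewrite !big_nat; apply: eq_bigr => k /andP[_ kh].
  by rewrite -ltnS kh W_diff// mulrC.
rewrite -big_split; apply: eq_bigr => k _ /=.
by case: ifP; rewrite ?addr0 ?add0r.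
Qed.

Lemma lax_iter_decay i p : exists X : R,
  forall h, normc (iter i (lax_op W eps) e0 h) * (1 + h%:R) ^+ p <= X.
Proof.
elim: i p => [|i IH] p; first exact: e0_decay.
have [X hX] := IH p; have [Y hY] := IH p.+1.
exists (Bw p * X + eps * Y) => h; rewrite iterS {1}/lax_op.
set x := iter i (lax_op W eps) e0.
have h0 : 0 <= (1 + h%:R) ^+ p :> R by rewrite exprn_ge0// addr_ge0.
apply: le_trans (ler_wpM2r h0 (normcD _ _)) _.
rewrite mulrDl lerD//; first by apply: (Wop_weight W_bnd).
rewrite normcNE normcM normcR ger0_norm; last by rewrite mulr_ge0// ltW.
rewrite -!mulrA (ler_wpM2l (ltW eps_gt0))//; apply: le_trans (hY h).
rewrite -/x exprS mulrA mulrCA mulrA ler_wpM2r//.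
by rewrite ler_wpM2r ?normc_ge0// lerDr.
Qed.

Context (Q E : {poly C}) (b : C).
Hypotheses (QE : forall h, conv (pseq Q) v h = pseq E h) (Qb : Q.[b] = 0)
  (indicial : forall j : nat, eps%:C * j%:R * b * Q^`().[b] + E.[b] != 0).

(* L^i e0 = P / Q^i as power series, with P(b) <> 0 = Q(b). *)
Lemma iter_lax_pole i : exists2 P : {poly C},
  conv (pseq (Q ^+ i)) (iter i (lax_op W eps) e0) = pseq P & P.[b] != 0.
Proof.
elim: i => [|i [P hP Pb]].
  exists 1; last by rewrite hornerC oner_eq0.
  rewrite expr0 conv1 /=; apply/funext => h.
  by rewrite /e0 /pseq coef1.
set x := iter i (lax_op W eps) e0 in hP.
have bx : bounded_seq x.
  by have [X hX] := lax_iter_decay i 0; exists X => h; have := hX h; rewrite expr0 mulr1.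
have [r hr] := conv_Wop (Q ^+ i) bx.
have [r2 hr2] := Wop_pseq P.
(* This is Q^(i+1) L x for x = P / Q^i. The bracket is the quotient rule: Q^(i+1) times w x' equals
   w (Q P)' - (i+1) w Q' P. At b, where Q vanishes, what survives is P(b) times the number in
   [indicial] with j = i. *)
pose P' := E * P + Q * (r2 + r)
   - eps%:C%:P * ('X * (Q * P)^`() - i.+1%:R%:P * ('X * Q^`() * P)).
exists P'; last first.
  have -> : P'.[b] = (eps%:C * i%:R * b * Q^`().[b] + E.[b]) * P.[b].
    rewrite /P' derivM !(hornerD, hornerN, hornerM, hornerC, hornerX) Qb -natr1; ring.
  by rewrite mulf_neq0.
rewrite iterS -/x.
have WE : conv (pseq (Q ^+ i.+1)) (Wop W x) = pseq (E * P + Q * (r2 + r)).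
  rewrite exprS conv_pseqM convA.
  have -> : conv (pseq (Q ^+ i)) (Wop W x) = fun h => conv v (pseq P) h + pseq (r2 + r) h.
    by apply/funext => h; rewrite hr hP hr2 pseqD addrA.
  apply/funext => h; rewrite convDr -convA -conv_pseqM pseqD; congr (_ + _).
  rewrite conv_pseqM; congr (conv _ _ h); by apply/funext => k; exact: QE.
have DE : conv (pseq (Q ^+ i.+1)) (xderiv x) =
    pseq ('X * (Q * P)^`() - i.+1%:R%:P * ('X * Q^`() * P)).
  apply/funext => h; rewrite conv_xderiv.
  have -> : conv (pseq (Q ^+ i.+1)) x = pseq (Q * P).
    by rewrite exprS conv_pseqM convA hP -conv_pseqM.
  rewrite !xderiv_pseq deriv_exp /=.
  have -> : 'X * (Q^`() * Q ^+ i *+ i.+1) = i.+1%:R%:P * ('X * Q^`()) * Q ^+ i.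
    by rewrite -mulr_natl polyC_natr; ring.
  rewrite (conv_pseqM _ (Q ^+ i)) convA hP -conv_pseqM.
  by rewrite /pseq coefB; congr (_ - _`_h); rewrite !mulrA.
apply/funext => h.
have -> : lax_op W eps x = fun k => Wop W x k + (- eps%:C) * xderiv x k.
  apply/funext => k; rewrite /lax_op /xderiv mulNr mulrA; congr (_ - _ * _).
  by rewrite rmorphM rmorph_nat.
rewrite convDr convZr WE DE /P' /pseq [in RHS]coefB coefCM mulNr; congr (_ - _).
Qed.

(* Multiply by Q^(deg q) and evaluate at b: only the leading term survives. *)
Lemma krylov_independent (q : {poly C}) : q != 0 ->
  ~ forall h, \sum_(i < size q) q`_i * iter i (lax_op W eps) e0 h = 0.
Proof.
move=> q0 rel.
have /choice[P hP] : forall i, exists P : {poly C},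
    conv (pseq (Q ^+ i)) (iter i (lax_op W eps) e0) = pseq P /\ P.[b] != 0.
  by move=> i; have [P h1 h2] := iter_lax_pole i; exists P.
have sq : (0 < size q)%N by rewrite lt0n size_poly_eq0.
pose J := (size q).-1.
have szJ : size q = J.+1 by rewrite prednK.
have key : \sum_(i < J.+1) (q`_i)%:P * (Q ^+ (J - i) * P i) = 0.
  apply: pseq_inj; apply/funext => h; rewrite {2}/pseq coef0.
  transitivity (conv (pseq (Q ^+ J))
    (fun k => \sum_(i < J.+1) q`_i * iter i (lax_op W eps) e0 k) h); last first.
    by rewrite /conv big1// => j _; rewrite -szJ rel mulr0.
  rewrite (conv_sumr J.+1 (fun i => q`_i) _ (fun i => iter i (lax_op W eps) e0)).
  transitivity (\sum_(i < J.+1) q`_i * pseq (Q ^+ (J - i) * P i) h).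
    by rewrite [LHS]coef_sum; apply: eq_bigr => i _; rewrite coefCM.
  apply: eq_bigr => i _.
  have iJ : (i <= J)%N by rewrite -ltnS.
  have -> : Q ^+ J = Q ^+ (J - i) * Q ^+ i by rewrite -exprD subnK.
  have [hPi _] := hP i.
  by rewrite (conv_pseqM (Q ^+ (J - i)) (Q ^+ i)) convA hPi -conv_pseqM.
have := congr1 (horner^~ b) key; rewrite horner_sum horner0 big_ord_recr /= big1 ?add0r.
  rewrite subnn expr0 mul1r hornerM hornerC => /eqP; rewrite mulf_eq0.
  have [_ /negbTE ->] := hP J; rewrite orbF => /eqP qJ.
  by move: q0; rewrite -lead_coef_eq0 /lead_coef -/J qJ eqxx.
move=> i _; rewrite !hornerM horner_exp Qb expr0n subn_eq0 leqNgt ltn_ord /=.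
by rewrite mul0r mulr0.
Qed.

End KrylovIndependence.

(** * Poles, zeroes and gaps of a series of simple fractions *)

Lemma near_dnbhs_complex {R : realType} (s : R[i]) (d : R) : 0 < d ->
  \forall u \near (s : R[i]^o)^', u != s /\ normc (u - s) < d.
Proof.
move=> d0.
have dC : 0 < (d%:C : R[i]) by rewrite ltcR.
have hb : \forall u \near (s : R[i]^o)^', ball (s : R[i]^o) d%:C u.
  by apply: cvg_within; exact: nbhsx_ballx.
have hn : \forall u \near (s : R[i]^o)^', u != s by exact: nbhs_dnbhs_neq.
apply: filterS2 hb hn => u; rewrite /ball /= => hu us; split => //.
by rewrite normcBC -ltcR; exact: hu.
Qed.

Lemma normc_dist {R : realType} (x y : R[i]) : `|normc x - normc y| <= normc (x - y).
Proof. by rewrite ler_norml lerNl opprB normcB_ge andbT normcBC normcB_ge. Qed.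

Section PoleSeries.
Context {R : realType}.
Local Notation C := R[i].
Context (Sl al : nat -> R) (B eps : R) (G : C -> C).
Hypotheses (eps_gt0 : 0 < eps)
  (Sl_upper : forall j, Sl j <= B - eps * j%:R)
  (al_ge0 : forall j, 0 <= al j)
  (al_sum : forall J, \sum_(j < J) al j <= 1)
  (al_inf : forall J, exists2 j, (J <= j)%N & 0 < al j)
  (G_series : forall u J, (forall j, u != (Sl j)%:C) -> B + normc u < eps * J%:R ->
     normc (G u - \sum_(j < J) (al j)%:C / (u - (Sl j)%:C)) <=
     (eps * J%:R - B - normc u)^-1).

Definition pole_sum (u : C) (J : nat) : C := \sum_(j < J) (al j)%:C / (u - (Sl j)%:C).

(** [G_series] says nothing at a limit eigenvalue of mass 0. There the corresponding term is 0, so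
    this series extends G through the removable singularities; [away] accordingly ignores indices of
    mass 0. *)
Definition pole_series (u : C) : C := culim (pole_sum u).

Definition away (u : C) (d : R) := forall j, 0 < al j -> d <= normc (u - (Sl j)%:C).

Lemma archi_eps (X : R) : exists J : nat, X < eps * J%:R.
Proof.
exists (Num.truncn (X / eps)).+1.
by rewrite mulrC -ltr_pdivrMr// truncnS_gt.
Qed.

Lemma al_eq0 j : ~~ (0 < al j) -> al j = 0.
Proof. by rewrite lt_def al_ge0 andbT negbK => /eqP. Qed.

Lemma sum_al_bound J (c : nat -> C) (X : R) : 0 <= X ->
  (forall j, 0 < al j -> normc (c j) <= X) -> normc (\sum_(j < J) (al j)%:C * c j) <= X.
Proof.
move=> X0 hc; apply: le_trans (normc_sum _ _ _) _.
apply: (@le_trans _ _ ((\sum_(j < J) al j) * X)); last by rewrite ler_piMl.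
rewrite mulr_suml; apply: ler_sum => j _.
rewrite normcM normcR ger0_norm//.
have [aj|/al_eq0 ->] := boolP (0 < al j); last by rewrite !mul0r.
by rewrite ler_wpM2l ?hc.
Qed.

Lemma pole_sum_bound u (d : R) J : 0 < d -> away u d -> normc (pole_sum u J) <= d^-1.
Proof.
move=> d0 ud; apply: (@sum_al_bound J (fun j => (u - (Sl j)%:C)^-1)).
  by rewrite invr_ge0 ltW.
by move=> j aj; rewrite normcV lef_pV2 ?posrE ?ud ?(lt_le_trans d0 (ud j aj)).
Qed.

Lemma pole_sum_cbounded u (d : R) : 0 < d -> away u d -> cbounded (pole_sum u).
Proof.
move=> d0 ud; exists d^-1; apply: (near_ultra (N := 0)) => J _; exact: pole_sum_bound.
Qed.

(** The S_j tend to -oo, so all but finitely many lie at distance at least 1 from s. *)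
Lemma isolated (s : R) : exists2 d : R, 0 < d &
  forall j, Sl j != s -> d <= `|s - Sl j|.
Proof.
have [J hJ] := archi_eps (B - s + 1).
have far j : (J <= j)%N -> 1 <= `|s - Sl j|.
  move=> Jj; apply: le_trans (ler_norm _); have := Sl_upper j.
  have : eps * J%:R <= eps * j%:R by rewrite (ler_wpM2l (ltW eps_gt0)) ?ler_nat.
  lra.
have : exists2 d : R, 0 < d & forall j, (j < J)%N -> Sl j != s -> d <= `|s - Sl j|.
  elim: J {hJ far} => [|J [d d0 hd]]; first by exists 1.
  exists (if Sl J == s then d else Num.min d `|s - Sl J|).
    by case: eqVneq => // ne; rewrite lt_min d0 normr_gt0 subr_eq0 eq_sym.
  move=> j; rewrite ltnS leq_eqVlt => /predU1P[->|jJ] ne.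
    by rewrite (negbTE ne) ge_min lexx orbT.
  by case: ifP => _; rewrite ?ge_min hd.
move=> [d d0 hd]; exists (Num.min d 1); first by rewrite lt_min d0 ltr01.
move=> j ne; rewrite ge_min; have [jJ|Jj] := ltnP j J; first by rewrite hd.
by rewrite far// orbT.
Qed.

Lemma G_pole_series u (d : R) : 0 < d -> away u d -> (forall j, u != (Sl j)%:C) ->
  G u = pole_series u.
Proof.
move=> d0 ud uS; apply/esym/culimP => e e0'.
have [J hJ] := archi_eps (B + normc u + e^-1).
apply: (near_ultra (N := J)) => K JK.
have hK : eps * J%:R <= eps * K%:R by rewrite (ler_wpM2l (ltW eps_gt0)) ?ler_nat.
have ei : 0 < e^-1 by rewrite invr_gt0.
have h1 : B + normc u < eps * K%:R by lra.
rewrite normcBC; apply: le_trans (G_series uS h1) _.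
rewrite -[leRHS]invrK lef_pV2 ?posrE//; first lra.
lra.
Qed.

Lemma pole_series_lip u v (d : R) : 0 < d -> away u d -> away v d ->
  normc (pole_series u - pole_series v) <= normc (u - v) / d ^+ 2.
Proof.
move=> d0 ud vd; rewrite -culimB; [|exact: pole_sum_cbounded d0 _..].
apply: normc_culim; apply: (near_ultra (N := 0)) => J _.
have -> : pole_sum u J - pole_sum v J = \sum_(j < J) (al j)%:C *
    (if 0 < al j then (v - u) / ((u - (Sl j)%:C) * (v - (Sl j)%:C)) else 0).
  rewrite -sumrB; apply: eq_bigr => j _.
  have [aj|/al_eq0 ->] := boolP (0 < al j); last by rewrite !mul0r subrr.
  have nz w : away w d -> w - (Sl j)%:C != 0.
    by move=> /(_ j aj) h; rewrite -normc_gt0 (lt_le_trans d0).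
  by field; rewrite !nz.
apply: (@sum_al_bound J (fun j => if 0 < al j then
  (v - u) / ((u - (Sl j)%:C) * (v - (Sl j)%:C)) else 0)).
  by rewrite divr_ge0 ?normc_ge0 ?exprn_ge0 ?ltW.
move=> j aj; rewrite aj normcM normcV normcBC ler_wpM2l ?normc_ge0//.
have p1 := lt_le_trans d0 (ud j aj); have p2 := lt_le_trans d0 (vd j aj).
rewrite normcM lef_pV2 ?posrE ?mulr_gt0 ?exprn_gt0// expr2.
by apply: ler_pM; rewrite ?(ltW d0) ?ud ?vd.
Qed.

Definition is_pole (s : R) := exists2 j, Sl j = s & 0 < al j.

Lemma away_near (s d : R) (u : C) : (forall j, Sl j != s -> d <= `|s - Sl j|) ->
  normc (u - s%:C) <= d / 2 -> forall j, Sl j != s -> d / 2 <= normc (u - (Sl j)%:C).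
Proof.
move=> hd hu j ne; have := hd j ne.
have := normcD (s%:C - u) (u - (Sl j)%:C); rewrite addrA subrK -rmorphB normcR.
by rewrite normcBC; lra.
Qed.

(** All indices with S_j = s merge into one fraction, whose residue A is their total mass. The other
    terms stay at distance at least d / 2 from u, and the masses sum to at most 1. *)
Lemma near_pole_lower (s d : R) j0 (u : C) : 0 < d ->
  (forall j, Sl j != s -> d <= `|s - Sl j|) -> Sl j0 = s -> 0 < al j0 ->
  0 < normc (u - s%:C) <= d / 2 ->
  exists2 A : R, al j0 <= A & normc (pole_series u - A%:C / (u - s%:C)) <= 2 / d.
Proof.
move=> d0 hd S0 a0 /andP[u0 ud].
pose m J := \sum_(j < J | Sl j == s) al j.
have bm : ubounded m.
  exists 1; apply: (near_ultra (N := 0)) => J _; rewrite ger0_norm ?sumr_ge0//.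
  apply: le_trans (al_sum J); rewrite [leRHS](bigID (fun j : 'I_J => Sl j == s)) /= lerDl.
  by rewrite sumr_ge0.
exists (ulim m).
  rewrite -(ulim_cst (al j0)); apply: ulim_le => //; first exact: ubounded_cst.
  apply: (near_ultra (N := j0.+1)) => J jJ; rewrite /m (bigD1 (Ordinal jJ)) ?S0//= lerDl.
  by rewrite sumr_ge0.
have unz : u - s%:C != 0 by rewrite -normc_gt0.
have d2 : 0 < d / 2 by rewrite divr_gt0.
have aw : away u (Num.min (d / 2) (normc (u - s%:C))).
  move=> j aj; have [->|ne] := eqVneq (Sl j) s; first by rewrite ge_min lexx orbT.
  by rewrite ge_min (away_near hd ud).
have mind : 0 < Num.min (d / 2) (normc (u - s%:C)) by rewrite lt_min d2.
rewrite -culimR -[X in _ * X]culim_cst -culimM; [|exact: cboundedR|exact: cbounded_cst].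
rewrite -culimB; [|exact: pole_sum_cbounded aw|].
  apply: normc_culim; apply: (near_ultra (N := 0)) => J _.
  have -> : pole_sum u J - (m J)%:C / (u - s%:C) = \sum_(j < J) (al j)%:C *
     (if Sl j == s then 0 else (u - (Sl j)%:C)^-1).
    rewrite /m big_mkcond rmorph_sum mulr_suml -sumrB; apply: eq_bigr => j _.
    by case: eqVneq => [->|_]; rewrite /= ?subrr ?mulr0// mul0r subr0.
  apply: (@sum_al_bound J (fun j => if Sl j == s then 0 else (u - (Sl j)%:C)^-1)).
    by rewrite divr_ge0 ?ltW.
  move=> j aj; case: eqVneq => [_|ne]; first by rewrite normc0 divr_ge0 ?ltW.
  have := away_near hd ud ne => h.
  rewrite normcV -[2 / d]invf_div lef_pV2 ?posrE//.
  exact: lt_le_trans h.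
by apply: cboundedM; [exact: cboundedR|exact: cbounded_cst].
Qed.

Definition pole_fun (x : R) : R := Re (pole_series x%:C).

Lemma pole_series_real (x : R) : pole_series x%:C = (pole_fun x)%:C.
Proof.
apply: complex_eqP => //=; rewrite -[RHS]ulim_cst; congr ulim; apply/funext => J.
rewrite /pole_sum Im_sum big1// => j _.
by rewrite -rmorphB -fmorphV -rmorphM.
Qed.

(** Without a pole in [x, y] the product (x - S)(y - S) is positive for every pole S, so all terms
    of the difference are nonnegative and the one of a positive mass is positive. *)
Lemma pole_fun_decr (x y : R) (d : R) : 0 < d -> x < y ->
  (forall s, is_pole s -> x <= s <= y -> False) ->
  away x%:C d -> away y%:C d -> pole_fun y < pole_fun x.
Proof.
move=> d0 xy np xd yd.
have [j0 _ aj0] := al_inf 0.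
have bx := pole_sum_cbounded d0 xd; have by_ := pole_sum_cbounded d0 yd.
pose t j : R := al j * (y - x) / ((x - Sl j) * (y - Sl j)).
have posj j : 0 < al j -> 0 < (x - Sl j) * (y - Sl j).
  move=> aj; have [xS|Sx] := ltP x (Sl j).
    have [Sy|yS] := leP (Sl j) y; first by case: (np (Sl j)); [exists j|rewrite ltW].
    by rewrite nmulr_rgt0 ?subr_lt0.
  have ne : Sl j != x.
    by apply: contraTneq (xd j aj) => ->; rewrite subrr normc0 -ltNge.
  have Sx' : Sl j < x by rewrite lt_def eq_sym ne.
  by rewrite mulr_gt0 ?subr_gt0// (lt_trans Sx').
have t0 j : 0 <= t j.
  rewrite /t; have [aj|/al_eq0 ->] := boolP (0 < al j); last by rewrite !mul0r.
  by apply: divr_ge0; [rewrite mulr_ge0 ?subr_ge0 ?(ltW xy)|exact: ltW (posj _ aj)].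
have tj0 : 0 < t j0.
  by apply: divr_gt0; [rewrite mulr_gt0 ?subr_gt0|exact: posj].
have e1 J : Re (pole_sum x%:C J) - Re (pole_sum y%:C J) = \sum_(j < J) t j.
  rewrite /pole_sum !Re_sum -sumrB; apply: eq_bigr => j _.
  rewrite -!rmorphB -!fmorphV -!rmorphM /= /t.
  have [aj|/al_eq0 ->] := boolP (0 < al j); last by rewrite !mul0r subrr.
  have := gt_eqF (posj j aj); rewrite mulf_eq0 => /negbT /norP[n1 n2].
  by field; rewrite n1 n2.
rewrite -subr_gt0; apply: lt_le_trans tj0 _.
have -> : pole_fun x - pole_fun y = ulim (fun J => Re (pole_sum x%:C J) - Re (pole_sum y%:C J)).
  rewrite ulimD ?ulimN//; [exact: cbounded_Re|exact: cbounded_Re|].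
  by apply: uboundedN; exact: cbounded_Re.
rewrite -[t j0]ulim_cst; apply: ulim_le; first exact: ubounded_cst.
  apply: uboundedD; first exact: cbounded_Re.
  by apply: uboundedN; exact: cbounded_Re.
apply: (near_ultra (N := j0.+1)) => J jJ; rewrite e1 (bigD1 (Ordinal jJ))//= lerDl.
by rewrite sumr_ge0.
Qed.

Lemma near_good (s d : R) (u : C) : 0 < d ->
  (forall j, Sl j != s -> d <= `|s - Sl j|) -> 0 < normc (u - s%:C) <= d / 2 ->
  G u = pole_series u.
Proof.
move=> d0 hd /andP[u0 ud]; have d2 : 0 < d / 2 by rewrite divr_gt0.
have aw j : Num.min (d / 2) (normc (u - s%:C)) <= normc (u - (Sl j)%:C).
  have [->|ne] := eqVneq (Sl j) s; first by rewrite ge_min lexx orbT.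
  by rewrite ge_min (away_near hd ud).
have m0 : 0 < Num.min (d / 2) (normc (u - s%:C)) by rewrite lt_min d2.
apply: (G_pole_series m0) => j; first by move=> _; exact: aw.
by rewrite -subr_eq0 -normc_gt0 (lt_le_trans m0).
Qed.

Lemma pole_limit (s : R) : is_pole s ->
  normc (G u) @[u --> (s%:C : R[i]^o)^'] --> +oo.
Proof.
move=> [j0 Sj0 aj0]; have [d d0 hd] := isolated s.
apply/cvgryPge => A.
(* Within distance [r] of s the polar part exceeds |A| + 1 + 2 / d, and the remaining terms take
   away at most 2 / d. *)
pose r := al j0 / (`|A| + 1 + 2 / d).
have den : 0 < `|A| + 1 + 2 / d by rewrite addr_gt0 ?divr_gt0 ?ltr_wpDl.
have r0 : 0 < r by rewrite divr_gt0.
have d2 : 0 < d / 2 by rewrite divr_gt0.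
have m0 : 0 < Num.min r (d / 2) by rewrite lt_min r0.
apply: filterS (near_dnbhs_complex s%:C m0) => u [us].
rewrite lt_min => /andP[ur ud].
have u0 : 0 < normc (u - s%:C) by rewrite normc_gt0 subr_eq0.
have hu : 0 < normc (u - s%:C) <= d / 2 by rewrite u0 ltW.
have [A0 hA0 hl] := near_pole_lower d0 hd Sj0 aj0 hu.
rewrite (near_good d0 hd hu).
have := normcB_ge (A0%:C / (u - s%:C)) (pole_series u).
rewrite normcBC in hl; rewrite normcM normcV normcR ger0_norm ?(le_trans (ltW aj0))// => h3.
have : `|A| + 1 + 2 / d <= A0 / normc (u - s%:C).
  rewrite ler_pdivlMr//; apply: le_trans hA0; rewrite mulrC -ler_pdivlMr//.
  exact: ltW.
by have := ler_norm A; lra.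
Qed.

Lemma nonpole_away (s d : R) : (forall j, Sl j != s -> d <= `|s - Sl j|) ->
  ~ is_pole s -> away s%:C d.
Proof.
move=> hd np j aj; rewrite -rmorphB normcR; apply: hd.
by apply/eqP => e; apply: np; exists j.
Qed.

Lemma nonpole_limit (s : R) : ~ is_pole s ->
  normc (G u) @[u --> (s%:C : R[i]^o)^'] --> `|pole_fun s|.
Proof.
move=> np; have [d d0 hd] := isolated s.
have d2 : 0 < d / 2 by rewrite divr_gt0.
apply/cvgrPdist_le => e e0'.
have m0 : 0 < Num.min (e * (d / 2) ^+ 2) (d / 2).
  by rewrite lt_min d2 mulr_gt0 ?exprn_gt0.
apply: filterS (near_dnbhs_complex s%:C m0) => u [us].
rewrite lt_min => /andP[ur ud].
have u0 : 0 < normc (u - s%:C) by rewrite normc_gt0 subr_eq0.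
have hu : 0 < normc (u - s%:C) <= d / 2 by rewrite u0 ltW.
rewrite (near_good d0 hd hu) -normcR -pole_series_real.
apply: le_trans (normc_dist _ _) _; rewrite normcBC.
have as_ : away s%:C (d / 2).
  by move=> j aj; have := nonpole_away hd np aj; lra.
have au : away u (d / 2).
  move=> j aj; apply: (away_near hd (ltW ud)).
  by apply/eqP => e'; apply: np; exists j.
apply: le_trans (pole_series_lip d2 au as_) _.
by rewrite ler_pdivrMr ?exprn_gt0// ltW.
Qed.

Lemma pole_fun_cont (s : R) : ~ is_pole s -> {for s, continuous pole_fun}.
Proof.
move=> np; have [d d0 hd] := isolated s.
have d2 : 0 < d / 2 by rewrite divr_gt0.
apply/cvgrPdist_le => e e0'.
have m0 : 0 < Num.min (e * (d / 2) ^+ 2) (d / 2).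
  by rewrite lt_min d2 mulr_gt0 ?exprn_gt0.
near=> x.
have : `|s - x| < Num.min (e * (d / 2) ^+ 2) (d / 2).
  by near: x; apply: cvgr_dist_lt.
rewrite lt_min -normcR rmorphB => /andP[xr xd].
have as_ : away s%:C (d / 2).
  by move=> j aj; have := nonpole_away hd np aj; lra.
have ax : away x%:C (d / 2).
  move=> j aj; apply: (away_near hd); first by rewrite normcBC ltW.
  by apply/eqP => e'; apply: np; exists j.
have -> : `|pole_fun s - pole_fun x| = normc (pole_series s%:C - pole_series x%:C).
  by rewrite !pole_series_real -rmorphB normcR.
apply: le_trans (pole_series_lip d2 as_ ax) _.
by rewrite ler_pdivrMr ?exprn_gt0// ltW.
Unshelve. all: end_near. Qed.

(** Poles above s have bounded index, so there is a least one. *)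
Lemma next_pole (s s1 : R) : is_pole s1 -> s < s1 ->
  exists2 s', is_pole s' & s < s' /\ forall x, is_pole x -> ~ (s < x < s').
Proof.
move=> [j1 Sj1 aj1] ss1.
have [J hJ] := archi_eps (B - s).
have small j : s < Sl j -> (j < J)%N.
  move=> sS; rewrite ltnNge; apply/negP => Jj; have := Sl_upper j.
  have : eps * J%:R <= eps * j%:R by rewrite (ler_wpM2l (ltW eps_gt0)) ?ler_nat.
  lra.
have jJ : (j1 < J)%N by apply: small; rewrite Sj1.
pose P (i : 'I_J) := (s < Sl i) && (0 < al i).
have P1 : P (Ordinal jJ) by rewrite /P /= Sj1 ss1.
have [i /andP[i1 i2] imin] := @Order.TotalTheory.arg_minP _ _ _ (Ordinal jJ) P (fun i => Sl i) P1.
exists (Sl i); first by exists i.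
split => // x [k Sk ak] /andP[sx xi].
have kJ : (k < J)%N by apply: small; rewrite Sk.
have := imin (Ordinal kJ); rewrite /P /= Sk sx ak => /(_ isT).
by rewrite leNgt xi.
Qed.

(** The condition that defines [gaps], for a function known only through its expansion. *)
Definition series_gap (g : R * R) : Prop :=
  [/\ normc (G u) @[u --> (g.1%:C : R[i]^o)^'] --> +oo,
      normc (G u) @[u --> (g.2%:C : R[i]^o)^'] --> (0 : R), g.1 < g.2 &
      forall s, g.1 < s < g.2 ->
        ~ (normc (G u) @[u --> (s%:C : R[i]^o)^'] --> +oo) /\
        ~ (normc (G u) @[u --> (s%:C : R[i]^o)^'] --> (0 : R))].

(** The product c f(s + c) differs from the residue by less than al_j0, which is at most the
    residue. A single statement with c of either sign serves both ends of the interval between two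
    poles. *)
Lemma pole_fun_sign (s d c : R) (j0 : nat) : 0 < d ->
  (forall j, Sl j != s -> d <= `|s - Sl j|) -> Sl j0 = s -> 0 < al j0 ->
  0 < `|c| -> `|c| <= d / 2 -> `|c| * (2 / d) < al j0 ->
  0 < c * pole_fun (s + c).
Proof.
move=> d0 hd Sj0 aj0 c0 cd ca.
have e1 : (s + c)%:C - s%:C = c%:C :> C by rewrite -rmorphB addrC addKr.
have hu : 0 < normc ((s + c)%:C - s%:C) <= d / 2 by rewrite e1 normcR c0.
have [A0 hA0] := near_pole_lower d0 hd Sj0 aj0 hu.
rewrite e1 pole_series_real -fmorphV -rmorphM -rmorphB normcR => h.
have cn : c != 0 by rewrite -normr_gt0.
have : `|c * pole_fun (s + c) - A0| <= `|c| * (2 / d).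
  rewrite (_ : _ - A0 = c * (pole_fun (s + c) - A0 / c)); last by field.
  by rewrite normrM ler_wpM2l.
rewrite ler_norml => /andP[h1 _]; lra.
Qed.

Lemma exists_gap (s s1 : R) : is_pole s -> is_pole s1 -> s < s1 ->
  exists z, series_gap (s, z).
Proof.
move=> ps ps1 ss1; have [s' ps' [ss' nop]] := next_pole ps1 ss1.
have [j Sj aj] := ps; have [j' Sj' aj'] := ps'.
have [d d0 hd] := isolated s; have [d' d0' hd'] := isolated s'.
have half : 0 < (s' - s) / 2 by rewrite divr_gt0 ?subr_gt0.
(* The first two bounds are those of [pole_fun_sign]; the third keeps s + c to the left of s' -
   c'. *)
have pick (D a : R) : 0 < D -> 0 < a -> exists2 c : R, 0 < c &
    [/\ c <= D / 2, c * (2 / D) < a & c < (s' - s) / 2].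
  move=> D0 a0; exists (Num.min (D / 2) (Num.min (a / 2 * (D / 2)) ((s' - s) / 4))).
    by rewrite !lt_min !divr_gt0 ?mulr_gt0 ?divr_gt0 ?subr_gt0.
  split; first by rewrite ge_min lexx.
    rewrite -ltr_pdivlMr ?divr_gt0// invf_div !gt_min; apply/orP; right; apply/orP; left.
    by rewrite ltr_pM2r ?divr_gt0//; lra.
  by rewrite !gt_min; apply/orP; right; apply/orP; right; lra.
have [c c0 [cd ca ch]] := pick d (al j) d0 aj.
have [c' c0' [cd' ca' ch']] := pick d' (al j') d0' aj'.
have f1 : 0 < pole_fun (s + c).
  rewrite -(pmulr_rgt0 _ c0).
  by apply: (pole_fun_sign d0 hd Sj aj); rewrite ?gtr0_norm.
have f2 : pole_fun (s' - c') < 0.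
  have : 0 < - c' * pole_fun (s' + - c').
    by apply: (pole_fun_sign d0' hd' Sj' aj'); rewrite normrN gtr0_norm.
  by rewrite mulNr oppr_gt0 pmulr_rlt0.
have np x : s < x < s' -> ~ is_pole x by move=> h hx; exact: nop hx h.
have ab : s + c <= s' - c' by lra.
have [||z] := @IVT R pole_fun (s + c) (s' - c') 0 ab.
- apply: continuous_in_subspaceT => x; rewrite inE /= in_itv /= => /andP[x1 x2].
  by apply: pole_fun_cont; apply: np; lra.
- by rewrite ge_min le_max (ltW f1) (ltW f2) orbT.
rewrite in_itv /= => /andP[z1 z2] fz.
have sz : s < z < s' by lra.
exists z; split => /=.
- exact: pole_limit.
- by have := nonpole_limit (np _ sz); rewrite fz normr0.
- by lra.
move=> x /andP[sx xz].
have sx' : s < x < s' by lra.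
(* Strict decrease makes f positive from s to its zero z, so |G| has a finite nonzero limit there:
   neither a pole nor a zero lies inside the gap. *)
have fx : 0 < pole_fun x.
  rewrite -fz.
  have [dx dx0 hdx] := isolated x; have [dz dz0 hdz] := isolated z.
  apply: (@pole_fun_decr x z (Num.min dx dz)) => //.
  - by rewrite lt_min dx0.
  - by move=> y py yxz; apply: (np y) => //; lra.
  - by move=> k ak; rewrite ge_min (nonpole_away hdx (np _ sx')).
  - by move=> k ak; rewrite ge_min (nonpole_away hdz (np _ sz)) ?orbT.
have lx := nonpole_limit (np _ sx'); rewrite gtr0_norm// in lx.
split => lim2.
  move/cvgryPge/(_ (pole_fun x + 2)) : lim2.
  move/cvgrPdist_le/(_ 1 ltr01) : lx => l1 l2.
  have [u [/= h1 h2]] := filter_ex (filterI l1 l2).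
  by move: h1; rewrite ler_norml; lra.
have := cvg_unique _ lx lim2 => /(_ (@Rhausdorff R)) e.
by move: fx; rewrite e ltxx.
Qed.

(** Left endpoints are unbounded below: a finite list of gaps leaves a pole below all of them, and
    that pole opens a further gap because another pole lies above it. *)
Lemma infinite_series_gaps : infinite_set [set g | series_gap g].
Proof.
move=> /finite_seqP[l hl].
have [j0 _ aj0] := al_inf 0.
have [X [hX XS]] : exists X : R, (forall g, g \in l -> X <= g.1) /\ X <= Sl j0.
  exists (foldr (fun g m => Num.min g.1 m) (Sl j0) l); split.
    elim: l {hl} => //= g l IH h; rewrite inE => /predU1P[->|/IH]; first by rewrite ge_min lexx.
    by rewrite ge_min => ->; rewrite orbT.
  by elim: l {hl} => //= g l IH; rewrite ge_min IH orbT.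
have [J hJ] := archi_eps (B - X).
have [j Jj aj] := al_inf J.
have SX : Sl j < X.
  have := Sl_upper j.
  have : eps * J%:R <= eps * j%:R by rewrite (ler_wpM2l (ltW eps_gt0)) ?ler_nat.
  lra.
have [z gz] : exists z, series_gap (Sl j, z).
  by apply: (@exists_gap _ (Sl j0)); [exists j|exists j0|exact: lt_le_trans XS].
have : [set g | series_gap g] (Sl j, z) by [].
rewrite hl => /= /hX /=; lra.
Qed.

End PoleSeries.

(** * Functions on the circle *)

Section CircleIntegral.
Context {R : realType}.
Local Notation C := R[i].
Local Notation mu := (@lebesgue_measure R).
Implicit Types (f g : R -> C) (h : R -> R).

Lemma pi2_gt0 : 0 < 2 * pi :> R. Proof. by rewrite mulr_gt0 ?pi_gt0. Qed.

Lemma circle_measurable : measurable (circle : set (measurableTypeR R)).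
Proof. exact: measurable_itv. Qed.

Lemma mu_circle : mu circle = (2 * pi)%:E.
Proof. by rewrite /circle lebesgue_measure_itv /= lte_fin pi2_gt0 oppr0 adde0. Qed.

Definition rint1 h := mu.-integrable circle (fun x => (h x)%:E).

Definition rmean h : R := (2 * pi)^-1 * \int[mu]_(x in circle) h x.

Definition cmeas f := measurable_fun circle (fun x => Re (f x)) /\
  measurable_fun circle (fun x => Im (f x)).

Definition cint1 f := cmeas f /\
  exists2 h, rint1 h & forall x, circle x -> normc (f x) <= h x.

Lemma rint1_cst (a : R) : rint1 (fun=> a).
Proof.
have : mu.-integrable circle (cst a%:E).
  apply/integrableP; split; first exact: measurable_cst.
  rewrite (_ : (fun x => _) = cst `|a|%:E)//.
  by rewrite (integral_cst _ circle_measurable) [X in (_ * X)%E]mu_circle -EFinM ltry.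
by [].
Qed.

Lemma rint1D h1 h2 : rint1 h1 -> rint1 h2 -> rint1 (fun x => h1 x + h2 x).
Proof.
move=> i1 i2; rewrite /rint1; under eq_fun do rewrite EFinD.
by apply: integrableD => //; exact: circle_measurable.
Qed.

Lemma rint1Z (a : R) h : rint1 h -> rint1 (fun x => a * h x).
Proof.
move=> i; rewrite /rint1; under eq_fun do rewrite EFinM.
by apply: integrableZl => //; exact: circle_measurable.
Qed.

Lemma rint1_dom h1 h2 : measurable_fun circle h1 -> rint1 h2 ->
  (forall x, circle x -> `|h1 x| <= h2 x) -> rint1 h1.
Proof.
move=> m1 i2 le12.
apply: (le_integrable circle_measurable) i2; first exact/measurable_EFinP.
move=> x cx; rewrite /= lee_fin; apply: le_trans (le12 x cx) (ler_norm _).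
Qed.

Lemma rmeanD h1 h2 : rint1 h1 -> rint1 h2 ->
  rmean (fun x => h1 x + h2 x) = rmean h1 + rmean h2.
Proof.
by move=> i1 i2; rewrite /rmean (RintegralD circle_measurable i1 i2) mulrDr.
Qed.

Lemma rmeanZ (a : R) h : rint1 h -> rmean (fun x => a * h x) = a * rmean h.
Proof.
by move=> i1; rewrite /rmean (RintegralZl _ circle_measurable i1) mulrCA.
Qed.

Lemma rmean_le h1 h2 : rint1 h1 -> rint1 h2 ->
  (forall x, circle x -> h1 x <= h2 x) -> rmean h1 <= rmean h2.
Proof.
move=> i1 i2 le12; rewrite /rmean ler_pM2l ?invr_gt0 ?pi2_gt0//.
by apply: le_Rintegral => //; exact: circle_measurable.
Qed.

Lemma rmean_cst (a : R) : rmean (fun=> a) = a.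
Proof.
rewrite /rmean (Rintegral_cst _ circle_measurable) [X in fine X]mu_circle /=.
by rewrite mulrCA mulVf ?mulr1// gt_eqF// pi2_gt0.
Qed.

Lemma rmean_ge0 h : (forall x, circle x -> 0 <= h x) -> 0 <= rmean h.
Proof.
by move=> h0; rewrite /rmean mulr_ge0 ?invr_ge0 ?(ltW pi2_gt0)//; apply: Rintegral_ge0.
Qed.

Lemma rmean_norm h1 h2 : measurable_fun circle h1 -> rint1 h2 ->
  (forall x, circle x -> `|h1 x| <= h2 x) -> `|rmean h1| <= rmean h2.
Proof.
move=> m1 i2 le12; have i1 := rint1_dom m1 i2 le12.
rewrite /rmean normrM ger0_norm ?invr_ge0 ?(ltW pi2_gt0)//.
rewrite ler_pM2l ?invr_gt0 ?pi2_gt0//.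
apply: le_trans (le_normr_Rintegral circle_measurable i1) _.
apply: le_Rintegral => //; first exact: circle_measurable.
apply: rint1_dom i2 _; last by move=> x cx; rewrite normr_id le12.
by apply: measurableT_comp.
Qed.

Lemma cmeanE f : cmean f = rmean (fun x => Re (f x)) +i* rmean (fun x => Im (f x)).
Proof.
rewrite /cmean; apply: complex_eqP => /=; rewrite ?mul0r ?subr0 ?addr0//.
Qed.

Lemma cint1_Re f : cint1 f -> rint1 (fun x => Re (f x)).
Proof.
move=> [[m1 _] [h ih fh]]; apply: rint1_dom m1 ih _ => x cx.
exact: le_trans (normc_Re _) (fh x cx).
Qed.

Lemma cint1_Im f : cint1 f -> rint1 (fun x => Im (f x)).
Proof.
move=> [[_ m1] [h ih fh]]; apply: rint1_dom m1 ih _ => x cx.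
exact: le_trans (normc_Im _) (fh x cx).
Qed.

Hint Resolve cint1_Re cint1_Im : core.

Lemma cmeasD f g : cmeas f -> cmeas g -> cmeas (fun x => f x + g x).
Proof.
move=> [f1 f2] [g1 g2]; split.
  by under eq_fun do rewrite ReD; exact: measurable_funD.
by under eq_fun do rewrite ImD; exact: measurable_funD.
Qed.

Lemma cmeasM f g : cmeas f -> cmeas g -> cmeas (fun x => f x * g x).
Proof.
move=> [f1 f2] [g1 g2]; split.
  under eq_fun do rewrite ReM; apply: measurable_funB; exact: measurable_funM.
under eq_fun do rewrite ImM; apply: measurable_funD; exact: measurable_funM.
Qed.

Lemma cmeasJ f : cmeas f -> cmeas (fun x => (f x)^*).
Proof.
move=> [f1 f2]; split; first by under eq_fun do rewrite ReJ.
by under eq_fun do rewrite ImJ; exact: measurableT_comp.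
Qed.

Lemma cmeas_cst (a : C) : cmeas (fun=> a).
Proof. by split; exact: measurable_cst. Qed.

Lemma cmeas_sum n (F : nat -> R -> C) : (forall i, cmeas (F i)) ->
  cmeas (fun x => \sum_(i < n) F i x).
Proof.
move=> mF; elim: n => [|n IH].
  by under eq_fun do rewrite big_ord0; exact: cmeas_cst.
by under eq_fun do rewrite big_ord_recr; exact: cmeasD.
Qed.

Lemma cmeas_lim (F : nat -> R -> C) f (e : nat -> R) : (forall n, cmeas (F n)) ->
  (forall n x, normc (f x - F n x) <= e n) -> e @ \oo --> (0 : R) -> cmeas f.
Proof.
move=> mF fe e0.
have key (p : C -> R) : (forall z, `|p z| <= normc z) -> (forall z w, p (z - w) = p z - p w) ->
    (forall n, measurable_fun circle (fun x => p (F n x))) ->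
    measurable_fun circle (fun x => p (f x)).
  move=> pn pB mp; apply: (measurable_fun_cvg (h := fun n x => p (F n x))) => // x _.
  apply/cvgrPdist_le => d d0; move/cvgrPdist_le : e0 => /(_ d d0); apply: filterS => n.
  rewrite sub0r normrN => en; rewrite -pB; apply: le_trans (pn _) _.
  exact: le_trans (fe n x) (le_trans (ler_norm _) en).
split.
  apply: key => [z|z w|n]; [exact: normc_Re|by rewrite ReD ReN|by have [] := mF n].
apply: key => [z|z w|n]; [exact: normc_Im|by rewrite ImD ImN|by have [] := mF n].
Qed.

Lemma cint1D f g : cint1 f -> cint1 g -> cint1 (fun x => f x + g x).
Proof.
move=> [mf [h1 i1 l1]] [mg [h2 i2 l2]]; split; first exact: cmeasD.
exists (fun x => h1 x + h2 x); first exact: rint1D.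
by move=> x cx; apply: le_trans (normcD _ _) (lerD (l1 x cx) (l2 x cx)).
Qed.

Lemma cint1Z (a : C) f : cint1 f -> cint1 (fun x => a * f x).
Proof.
move=> [mf [h ih lh]]; split; first by apply: cmeasM => //; exact: cmeas_cst.
exists (fun x => normc a * h x); first exact: rint1Z.
by move=> x cx; rewrite normcM ler_wpM2l ?normc_ge0 ?lh.
Qed.

Lemma cint1N f : cint1 f -> cint1 (fun x => - f x).
Proof.
by move=> i; under eq_fun do rewrite -mulN1r; exact: cint1Z.
Qed.

Lemma cint1_sum n (F : nat -> R -> C) : (forall i, cint1 (F i)) ->
  cint1 (fun x => \sum_(i < n) F i x).
Proof.
move=> iF; elim: n => [|n IH].
  under eq_fun do rewrite big_ord0; split; first exact: cmeas_cst.
  by exists (fun=> 0) => [|x _]; [exact: rint1_cst|rewrite normc0].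
by under eq_fun do rewrite big_ord_recr; exact: cint1D.
Qed.

Lemma cmeanD f g : cint1 f -> cint1 g -> cmean (fun x => f x + g x) = cmean f + cmean g.
Proof.
move=> i1 i2; rewrite !cmeanE; apply: complex_eqP => /=.
  by rewrite -rmeanD; auto; congr rmean; apply/funext => x; rewrite ReD.
by rewrite -rmeanD; auto; congr rmean; apply/funext => x; rewrite ImD.
Qed.

Lemma cmeanZ (a : C) f : cint1 f -> cmean (fun x => a * f x) = a * cmean f.
Proof.
move=> i1; rewrite !cmeanE; apply: complex_eqP; rewrite ?ReM ?ImM /=.
  rewrite -!rmeanZ; auto; rewrite -mulN1r -rmeanZ; last by apply: rint1Z; auto.
  rewrite -rmeanD; [|by apply: rint1Z; auto|by do 2 apply: rint1Z; auto].
  by congr rmean; apply/funext => x; rewrite ReM mulN1r.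
rewrite -!rmeanZ; auto.
rewrite -rmeanD; [|by apply: rint1Z; auto|by apply: rint1Z; auto].
by congr rmean; apply/funext => x; rewrite ImM.
Qed.

Lemma cmeanN f : cint1 f -> cmean (fun x => - f x) = - cmean f.
Proof.
by move=> i; rewrite -mulN1r -cmeanZ//; congr cmean; apply/funext => x; rewrite mulN1r.
Qed.

Lemma cmeanB f g : cint1 f -> cint1 g -> cmean (fun x => f x - g x) = cmean f - cmean g.
Proof. by move=> i1 i2; rewrite cmeanD ?cmeanN//; exact: cint1N. Qed.

Lemma cmean_sum n (F : nat -> R -> C) : (forall i, cint1 (F i)) ->
  cmean (fun x => \sum_(i < n) F i x) = \sum_(i < n) cmean (F i).
Proof.
move=> iF; elim: n => [|n IH].
  under eq_fun do rewrite big_ord0; rewrite big_ord0 cmeanE.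
  by rewrite !rmean_cst.
under eq_fun do rewrite big_ord_recr.
by rewrite cmeanD ?big_ord_recr ?IH//; exact: cint1_sum.
Qed.

Lemma cmeanJ f : cint1 f -> cmean (fun x => (f x)^*) = (cmean f)^*.
Proof.
move=> fi; rewrite !cmeanE; apply: complex_eqP => /=.
  by congr rmean; apply/funext => x; rewrite ReJ.
rewrite -mulN1r -rmeanZ; auto.
by congr rmean; apply/funext => x; rewrite ImJ mulN1r.
Qed.

(** The factor 2 comes from bounding real and imaginary parts separately. It is harmless, as the
    estimate serves for boundedness and for convergence to 0. *)
Lemma cmean_le f h : cmeas f -> rint1 h ->
  (forall x, circle x -> normc (f x) <= h x) -> normc (cmean f) <= 2 * rmean h.
Proof.
move=> [m1 m2] ih fh; rewrite cmeanE; apply: le_trans (normc_leD _) _ => /=.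
rewrite mulr_natl mulr2n; apply: lerD; apply: rmean_norm => // x cx.
  exact: le_trans (normc_Re _) (fh x cx).
exact: le_trans (normc_Im _) (fh x cx).
Qed.

Lemma ae_eq_cmean f g : cmeas f -> cmeas g ->
  {ae mu, forall x, circle x -> f x = g x} -> cmean f = cmean g.
Proof.
move=> [f1 f2] [g1 g2] fg; rewrite !cmeanE /rmean /Rintegral.
congr (_ * fine _ +i* (_ * fine _)).
  apply: ae_eq_integral; [exact: circle_measurable|exact/measurable_EFinP..|].
  exact: (ae_eq_comp (fun z => (Re z)%:E) fg).
apply: ae_eq_integral; [exact: circle_measurable|exact/measurable_EFinP..|].
exact: (ae_eq_comp (fun z => (Im z)%:E) fg).
Qed.

End CircleIntegral.

(** * Square-integrable functions and the Hardy space *)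

Section HardyFunctions.
Context {R : realType}.
Local Notation C := R[i].
Local Notation mu := (@lebesgue_measure R).
Implicit Types (f g q : R -> C).

Lemma is_derive_cosM (l x : R) : is_derive x 1 (fun y => cos (l * y)) (- (l * sin (l * x))).
Proof.
have h1 : is_derive x 1 (fun y : R => l * y) l.
  by apply: is_derive_eq; rewrite scaler1.
have := @is_derive1_comp R cos (fun y => l * y) x _ _ (is_derive_cos _) h1.
by rewrite mulNr mulrC.
Qed.

Lemma is_derive_sinM (l x : R) : is_derive x 1 (fun y => sin (l * y)) (l * cos (l * x)).
Proof.
have h1 : is_derive x 1 (fun y : R => l * y) l.
  by apply: is_derive_eq; rewrite scaler1.
have := @is_derive1_comp R sin (fun y => l * y) x _ _ (is_derive_sin _) h1.
by rewrite mulrC.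
Qed.

Lemma Rintegral_primitive (F f : R -> R) (a b : R) : a < b ->
  (forall x : R, is_derive x (1 : R) F (f x)) -> continuous f ->
  \int[mu]_(x in `[a, b]) f x = F b - F a.
Proof.
move=> ab dF cf.
have cF : continuous F.
  move=> x; apply: differentiable_continuous; apply/derivable1_diffP.
  by have [] := dF x.
rewrite /Rintegral (@continuous_FTC2 _ f F)//.
- exact: continuous_subspaceT.
- split; first by move=> x _; have [] := dF x.
  + by apply: cvg_at_right_filter; exact: cF.
  + by apply: cvg_at_left_filter; exact: cF.
- by move=> x _; rewrite derive1E; have [_] := dF x.
Qed.

Lemma continuous_cosM (l : R) : continuous (fun x : R => cos (l * x)).
Proof.
move=> x; apply: differentiable_continuous; apply/derivable1_diffP.
by have [] := is_derive_cosM l x.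
Qed.

Lemma continuous_sinM (l : R) : continuous (fun x : R => sin (l * x)).
Proof.
move=> x; apply: differentiable_continuous; apply/derivable1_diffP.
by have [] := is_derive_sinM l x.
Qed.

Lemma ketE h (x : R) : ket h x = expi (h%:R * x).
Proof. by rewrite /ket -expiMn mulr_natl. Qed.

Lemma cmeas_ket h : cmeas (ket h : R -> C).
Proof.
split.
  have -> : (fun x => Re (ket h x)) = fun x : R => cos (h%:R * x).
    by apply/funext => x; rewrite ketE.
  by apply: measurable_funTS; apply: continuous_measurable_fun; exact: continuous_cosM.
have -> : (fun x => Im (ket h x)) = fun x : R => sin (h%:R * x).
  by apply/funext => x; rewrite ketE.
by apply: measurable_funTS; apply: continuous_measurable_fun; exact: continuous_sinM.
Qed.

Lemma normc_ket h (x : R) : normc (ket h x) = 1.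
Proof. by rewrite ketE normc_expi. Qed.

Lemma ketD h k (x : R) : ket (h + k) x = ket h x * ket k x.
Proof. by rewrite /ket exprD. Qed.

Lemma ketJ h (x : R) : (ket h x)^* * ket h x = 1.
Proof. by rewrite mulJc normc_ket expr1n. Qed.

Lemma cmean_ket m : cmean (ket m : R -> C) = (m == 0%N)%:R.
Proof.
case: m => [|m].
  have -> : ket 0 = fun _ : R => 1 : C by apply/funext => x; rewrite /ket expr0.
  by rewrite cmeanE !rmean_cst.
have m0 : m.+1%:R != 0 :> R by rewrite pnatr_eq0.
have ep : expi (m.+1%:R * (2 * pi) : R) = 1.
  by rewrite mulr_natl expiMn -[2 * pi]add0r expi_period expi0 expr1n.
have e0' : expi (m.+1%:R * 0 : R) = 1 by rewrite mulr0 expi0.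
have [c1 s1] : cos (m.+1%:R * (2 * pi) : R) = 1 /\ sin (m.+1%:R * (2 * pi) : R) = 0.
  by split; [have := congr1 (@Re R) ep|have := congr1 (@Im R) ep].
have iC : \int[mu]_(x in circle) cos (m.+1%:R * x) = 0.
  have dF (x : R) : is_derive x (1 : R) (fun x => m.+1%:R^-1 * sin (m.+1%:R * x))
      (cos (m.+1%:R * x)).
    have h := is_derive_sinM m.+1%:R x.
    by apply: is_derive_eq; rewrite /GRing.scale /= mulrA mulVf ?mul1r.
  rewrite (Rintegral_primitive pi2_gt0 dF); last exact: continuous_cosM.
  by rewrite s1 mulr0 mulr0 sin0 mulr0 subrr.
have iS : \int[mu]_(x in circle) sin (m.+1%:R * x) = 0.
  have dF (x : R) : is_derive x (1 : R) (fun x => - m.+1%:R^-1 * cos (m.+1%:R * x))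
      (sin (m.+1%:R * x)).
    have h := is_derive_cosM m.+1%:R x.
    by apply: is_derive_eq; rewrite /GRing.scale /= mulrNN mulrA mulVf ?mul1r.
  rewrite (Rintegral_primitive pi2_gt0 dF); last exact: continuous_sinM.
  by rewrite c1 mulr0 cos0 subrr.
rewrite /= cmeanE /rmean.
under eq_Rintegral do rewrite ketE; rewrite [X in _ * X +i* _]iC.
under eq_Rintegral do rewrite ketE; rewrite [X in _ +i* (_ * X)]iS.
by rewrite mulr0.
Qed.

Lemma rint1_sqr f : L2circle f -> rint1 (fun x => normc (f x) ^+ 2).
Proof. by case. Qed.

Lemma L2_cmeas f : L2circle f -> cmeas f.
Proof. by case. Qed.

Lemma measurable_sqr_normc f : cmeas f -> measurable_fun circle (fun x => normc (f x) ^+ 2).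
Proof.
move=> [m1 m2]; under eq_fun do rewrite sqr_normcE.
by apply: measurable_funD; exact: measurable_funX.
Qed.

Lemma L2_dom f (h : R -> R) : cmeas f -> rint1 h ->
  (forall x, circle x -> normc (f x) ^+ 2 <= h x) -> L2circle f.
Proof.
move=> mf ih fh; have [m1 m2] := mf; split => //.
apply: rint1_dom (measurable_sqr_normc mf) ih _ => x cx.
by rewrite ger0_norm ?sqr_ge0// fh.
Qed.

Lemma L2_bounded f (X : R) : cmeas f -> (forall x, circle x -> normc (f x) <= X) -> L2circle f.
Proof.
move=> mf fX; apply: (L2_dom (h := fun=> X ^+ 2)) => //; first exact: rint1_cst.
move=> x cx; apply: lerXn2r; rewrite ?nnegrE ?normc_ge0 ?fX//.
by apply: le_trans (fX x cx); rewrite normc_ge0.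
Qed.

Lemma L2D f g : L2circle f -> L2circle g -> L2circle (fun x => f x + g x).
Proof.
move=> Lf Lg.
apply: (L2_dom (h := fun x => 2 * normc (f x) ^+ 2 + 2 * normc (g x) ^+ 2)).
- by apply: cmeasD; exact: L2_cmeas.
- by apply: rint1D; apply: rint1Z; exact: rint1_sqr.
move=> x _; have := normcD (f x) (g x).
have := normc_ge0 (f x + g x); have := sqr_ge0 (normc (f x) - normc (g x)).
nra.
Qed.

Lemma L2_bmul f g (X : R) : cmeas f -> (forall x, circle x -> normc (f x) <= X) ->
  L2circle g -> L2circle (fun x => f x * g x).
Proof.
move=> mf fX Lg; apply: (L2_dom (h := fun x => X ^+ 2 * normc (g x) ^+ 2)).
- by apply: cmeasM => //; exact: L2_cmeas.
- by apply: rint1Z; exact: rint1_sqr.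
move=> x cx; rewrite normcM exprMn ler_wpM2r ?sqr_ge0//.
by apply: lerXn2r; rewrite ?nnegrE ?normc_ge0 ?fX// (le_trans _ (fX x cx))// normc_ge0.
Qed.

Lemma L2Z (a : C) f : L2circle f -> L2circle (fun x => a * f x).
Proof. by apply: (@L2_bmul (fun=> a) f (normc a)) => //; exact: cmeas_cst. Qed.

Lemma L2B f g : L2circle f -> L2circle g -> L2circle (fun x => f x - g x).
Proof.
move=> Lf Lg; apply: L2D => //; under eq_fun do rewrite -mulN1r; exact: L2Z.
Qed.

Lemma L2_ket h : L2circle (ket h : R -> C).
Proof. by apply: (L2_bounded (X := 1)) => [|x _]; [exact: cmeas_ket|rewrite normc_ket]. Qed.

(** Young's inequality with a free parameter. Through [inner_le] it takes the place of
    Cauchy-Schwarz, [eta] being matched to the size of the approximation error. *)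
Lemma normcM_le (x y : C) (eta : R) : 0 < eta ->
  normc (x * y) <= eta * normc x ^+ 2 + eta^-1 * normc y ^+ 2.
Proof.
move=> e0'; rewrite normcM -(ler_pM2l e0') mulrDr mulrA mulVKf ?gt_eqF//.
have := sqr_ge0 (eta * normc x - normc y).
have := sqr_ge0 (eta * normc x); have := sqr_ge0 (normc y).
lra.
Qed.

Lemma cint1_inner f g : L2circle f -> L2circle g -> cint1 (fun x => (f x)^* * g x).
Proof.
move=> Lf Lg; split; first by apply: cmeasM; [apply: cmeasJ|]; exact: L2_cmeas.
exists (fun x => 1 * normc (f x) ^+ 2 + 1^-1 * normc (g x) ^+ 2).
  by apply: rint1D; apply: rint1Z; exact: rint1_sqr.
by move=> x _; have := normcM_le (f x)^* (g x) ltr01; rewrite normcJE.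
Qed.

Lemma sqnormE f : sqnorm f = rmean (fun x => normc (f x) ^+ 2).
Proof.
by rewrite /sqnorm /inner cmeanE /=; congr rmean; apply/funext => x; rewrite mulJc.
Qed.

Lemma inner_le f g (eta : R) : 0 < eta -> L2circle f -> L2circle g ->
  normc (inner f g) <= 2 * (eta * sqnorm f + eta^-1 * sqnorm g).
Proof.
move=> e0' Lf Lg; rewrite !sqnormE.
rewrite -rmeanZ; last exact: rint1_sqr. rewrite -rmeanZ; last exact: rint1_sqr.
rewrite -rmeanD; [|by apply: rint1Z; exact: rint1_sqr..].
apply: cmean_le.
- by apply: cmeasM; [apply: cmeasJ|]; exact: L2_cmeas.
- by apply: rint1D; apply: rint1Z; exact: rint1_sqr.
- by move=> x _; have := normcM_le (f x)^* (g x) e0'; rewrite normcJE.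
Qed.

Lemma innerDr f g q : L2circle f -> L2circle g -> L2circle q ->
  inner f (fun x => g x + q x) = inner f g + inner f q.
Proof.
move=> Lf Lg Lq; rewrite /inner -cmeanD; [|exact: cint1_inner..].
by congr cmean; apply/funext => x; rewrite mulrDr.
Qed.

Lemma innerZr (a : C) f g : L2circle f -> L2circle g ->
  inner f (fun x => a * g x) = a * inner f g.
Proof.
move=> Lf Lg; rewrite /inner -cmeanZ; last exact: cint1_inner.
by congr cmean; apply/funext => x; rewrite mulrCA.
Qed.

Lemma innerBr f g q : L2circle f -> L2circle g -> L2circle q ->
  inner f (fun x => g x - q x) = inner f g - inner f q.
Proof.
move=> Lf Lg Lq; rewrite /inner -cmeanB; [|exact: cint1_inner..].
by congr cmean; apply/funext => x; rewrite mulrBr.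
Qed.

Lemma inner_conj f g : L2circle f -> L2circle g -> (inner f g)^* = inner g f.
Proof.
move=> Lf Lg; rewrite /inner -cmeanJ; last exact: cint1_inner.
by congr cmean; apply/funext => x; rewrite conjcM conjCK mulrC.
Qed.

Lemma inner_ket h k : inner (ket h) (ket k : R -> C) = (h == k)%:R.
Proof.
have le1 a b : inner (ket a) (ket (a + b) : R -> C) = (b == 0%N)%:R.
  rewrite /inner -cmean_ket; congr cmean; apply/funext => x.
  by rewrite ketD mulrA ketJ mul1r.
have [hk|kh] := leqP h k.
  rewrite -{1}(subnKC hk) le1; congr (nat_of_bool _)%:R.
  by apply/eqP/eqP; lia.
rewrite -inner_conj; [|exact: L2_ket..].
rewrite -{1}(subnKC (ltnW kh)) le1 rmorph_nat; congr (nat_of_bool _)%:R.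
by apply/eqP/eqP; lia.
Qed.

Lemma poly_ket (p : {poly C}) (x : R) : p.[expi x] = \sum_(i < size p) p`_i * ket i x.
Proof. by rewrite horner_coef. Qed.

Lemma L2_sum n (F : nat -> R -> C) : (forall i, L2circle (F i)) ->
  L2circle (fun x => \sum_(i < n) F i x).
Proof.
move=> LF; elim: n => [|n IH].
  under eq_fun do rewrite big_ord0.
  by apply: (L2_bounded (X := 0)) => [|x _]; [exact: cmeas_cst|rewrite normc0].
by under eq_fun do rewrite big_ord_recr; exact: L2D.
Qed.

Lemma inner_sumr n f (F : nat -> R -> C) : L2circle f -> (forall i, L2circle (F i)) ->
  inner f (fun x => \sum_(i < n) F i x) = \sum_(i < n) inner f (F i).
Proof.
move=> Lf LF; elim: n => [|n IH].
  under eq_fun do rewrite big_ord0; rewrite big_ord0 /inner.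
  by under eq_fun do rewrite mulr0; rewrite cmeanE !rmean_cst.
under eq_fun do rewrite big_ord_recr.
by rewrite innerDr ?big_ord_recr ?IH//; exact: L2_sum.
Qed.

Lemma L2_poly (p : {poly C}) : L2circle (fun x : R => p.[expi x]).
Proof.
under eq_fun do rewrite poly_ket.
by apply: (L2_sum _ (F := fun i x => p`_i * ket i x)) => i; apply: L2Z; exact: L2_ket.
Qed.

Lemma small_eq0 (z : C) (A : R) : (forall e : R, 0 < e -> normc z <= e * A) -> z = 0.
Proof.
move=> h; apply/eqP; rewrite -normc_eq0 eq_le normc_ge0 andbT.
apply/ler_addgt0Pr => e e0'; rewrite add0r.
have A0 : 0 <= A by apply: le_trans (normc_ge0 z) _; have := h 1 ltr01; rewrite mul1r.
apply: le_trans (h (e / (A + 1)) _) _; first by rewrite divr_gt0// ltr_wpDl.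
by rewrite mulrAC ler_pdivrMr ?ltr_wpDl// ler_wpM2l ?lerDl// ltW.
Qed.

Lemma sqnorm_ge0 f : 0 <= sqnorm f.
Proof. by rewrite sqnormE; apply: rmean_ge0 => x _; exact: sqr_ge0. Qed.

(** By linearity r is orthogonal to all polynomials in w, hence to their closure. *)
Lemma hardy_orth f r : hardy f -> L2circle r ->
  (forall h, inner (ket h) r = 0) -> inner f r = 0.
Proof.
move=> [Lf hf] Lr r0.
have pr (p : {poly C}) : inner r (fun x => p.[expi x]) = 0.
  under [X in inner _ X]eq_fun do rewrite poly_ket.
  rewrite (inner_sumr _ (F := fun i x => p`_i * ket i x))//.
    apply: big1 => i _; rewrite innerZr//; last exact: L2_ket.
    by rewrite -inner_conj ?r0 ?rmorph0 ?mulr0//; exact: L2_ket.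
  by move=> i; apply: L2Z; exact: L2_ket.
apply: (small_eq0 (A := 2 * (1 + sqnorm r))) => e e0'.
(* A squared distance below e^2, divided by the parameter [eta] = e of [inner_le], leaves e. *)
have [p hp] := hf (e ^+ 2) (exprn_gt0 2 e0').
rewrite -inner_conj// normcJE.
have -> : inner r f = inner r (fun x => f x - p.[expi x]).
  by rewrite innerBr// ?pr ?subr0//; exact: L2_poly.
have Lp : L2circle (fun x => f x - p.[expi x]) by apply: L2B => //; exact: L2_poly.
apply: le_trans (inner_le e0' Lr Lp) _.
have : e^-1 * sqnorm (fun x => f x - p.[expi x]) <= e.
  by rewrite mulrC ler_pdivrMr// -expr2 ltW.
have := sqnorm_ge0 r; nra.
Qed.

Lemma hardy_neg f m : hardy f -> inner (fun x => (ket m.+1 x)^*) f = 0.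
Proof.
move=> [Lf hf].
have Lk : L2circle (fun x : R => (ket m.+1 x)^* : C).
  apply: (L2_bounded (X := 1)) => [|x _]; first by apply: cmeasJ; exact: cmeas_ket.
  by rewrite normcJE normc_ket.
have pr (p : {poly C}) : inner (fun x : R => (ket m.+1 x)^*) (fun x => p.[expi x]) = 0.
  under [X in inner _ X]eq_fun do rewrite poly_ket.
  rewrite (inner_sumr _ (F := fun i x => p`_i * ket i x))//.
    apply: big1 => i _; rewrite innerZr//; last exact: L2_ket.
    rewrite /inner (_ : (fun x => _) = ket (m.+1 + i)) ?cmean_ket ?mulr0//.
    by apply/funext => x; rewrite conjCK ketD.
  by move=> i; apply: L2Z; exact: L2_ket.
apply: (small_eq0 (A := 2 * (1 + sqnorm (fun x : R => (ket m.+1 x)^* : C)))) => e e0'.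
have [p hp] := hf (e ^+ 2) (exprn_gt0 2 e0').
have -> : inner (fun x => (ket m.+1 x)^*) f =
    inner (fun x => (ket m.+1 x)^*) (fun x => f x - p.[expi x]).
  by rewrite innerBr// ?pr ?subr0//; exact: L2_poly.
have Lp : L2circle (fun x => f x - p.[expi x]) by apply: L2B => //; exact: L2_poly.
apply: le_trans (inner_le e0' Lk Lp) _.
have : e^-1 * sqnorm (fun x => f x - p.[expi x]) <= e.
  by rewrite mulrC ler_pdivrMr// -expr2 ltW.
have := sqnorm_ge0 (fun x : R => (ket m.+1 x)^* : C); nra.
Qed.

End HardyFunctions.

(** * Fourier series with quadratically decaying coefficients *)

Section FourierSeries.
Context {R : realType}.
Local Notation C := R[i].
Local Notation mu := (@lebesgue_measure R).
Implicit Types (f g q : R -> C) (x : nat -> C).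

Definition fpart x N (t : R) : C := \sum_(h < N.+1) x h * ket h t.

Definition fser x (t : R) : C := culim (fun N => fpart x N t).

(** Quadratic decay gives uniform convergence of the Fourier series with error X / (N + 1);
    measurability, membership in the Hardy space and the values of the coefficients all follow from
    this rate. *)
Definition square_decay x (X : R) := forall h, normc (x h) * (1 + h%:R) ^+ 2 <= X.

Lemma tail_inv_sq (N K : nat) :
  \sum_(N.+1 <= h < N.+1 + K) ((1 + h%:R) ^+ 2)^-1 <= (N.+1%:R)^-1 :> R.
Proof.
apply: (@le_trans _ _ ((N.+1%:R)^-1 - ((N.+1 + K)%:R)^-1)); last by rewrite gerBl invr_ge0.
elim: K => [|K IH]; first by rewrite addn0 big_geq// subrr.
rewrite addnS big_nat_recr ?leq_addr//=; apply: le_trans (lerD IH (lexx _)) _.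
set a : R := (N.+1 + K)%:R; have a0 : 0 < a by rewrite ltr0n.
have -> : (N.+1 + K).+1%:R = a + 1 :> R by rewrite /a -natr1.
rewrite [1 + a]addrC -subr_ge0; move: (N.+1%:R^-1 : R) => b.
have -> : b - (a + 1)^-1 - (b - a^-1 + ((a + 1) ^+ 2)^-1) = (a * (a + 1) ^+ 2)^-1.
  by field; apply/andP; split; apply: lt0r_neq0; lra.
by rewrite invr_ge0 mulr_ge0 ?sqr_ge0 ?ltW.
Qed.

Lemma square_decay_ge0 x X : square_decay x X -> 0 <= X.
Proof.
by move=> h; apply: le_trans (h 0%N); rewrite mulr_ge0 ?normc_ge0 ?exprn_ge0 ?addr_ge0.
Qed.

Lemma fpart_tail x X N M t : square_decay x X -> (N <= M)%N ->
  normc (fpart x M t - fpart x N t) <= X / N.+1%:R.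
Proof.
move=> xX NM; have X0 := square_decay_ge0 xX.
rewrite /fpart -!(big_mkord xpredT (fun h => x h * ket h t)).
have NM' : (N.+1 <= M.+1)%N by [].
rewrite (big_cat_nat (leq0n N.+1) NM') /= addrAC subrr add0r.
apply: le_trans (normc_sum _ _ _) _.
apply: (@le_trans _ _ (X * \sum_(N.+1 <= h < N.+1 + (M - N)) ((1 + h%:R) ^+ 2)^-1)).
  rewrite addSn subnKC// mulr_sumr; apply: ler_sum => h _.
  rewrite normcM normc_ket mulr1 ler_pdivlMr; first exact: xX.
  by rewrite exprn_gt0// ltr_pwDl.
by rewrite ler_wpM2l// tail_inv_sq.
Qed.

Lemma fpart_cbounded x X t : square_decay x X -> cbounded (fun N => fpart x N t).
Proof.
move=> xX; exists (X / 1%:R + normc (fpart x 0 t)).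
apply: (near_ultra (N := 0%N)) => N _; rewrite -{1}(subrK (fpart x 0 t) (fpart x N t)).
by apply: le_trans (normcD _ _) _; rewrite lerD2r fpart_tail.
Qed.

Lemma fser_fpart x X N t : square_decay x X ->
  normc (fser x t - fpart x N t) <= X / N.+1%:R.
Proof.
move=> xX; apply: normc_culimB; apply: (near_ultra (N := N)) => M NM.
exact: fpart_tail.
Qed.

Lemma fserD x y X Y t : square_decay x X -> square_decay y Y ->
  fser (fun h => x h + y h) t = fser x t + fser y t.
Proof.
move=> xX yY; rewrite /fser -culimD; [|exact: fpart_cbounded xX|exact: fpart_cbounded yY].
by congr culim; apply/funext => N; rewrite /fpart -big_split; apply: eq_bigr => h _; rewrite mulrDl.
Qed.

Lemma fserZ (a : C) x X t : square_decay x X ->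
  fser (fun h => a * x h) t = a * fser x t.
Proof.
move=> xX; rewrite /fser -[in RHS](culim_cst a) -culimM;
  [|exact: cbounded_cst|exact: fpart_cbounded xX].
by congr culim; apply/funext => N; rewrite /fpart mulr_sumr; apply: eq_bigr => h _; rewrite mulrA.
Qed.

Lemma fser_e0 (t : R) : fser e0 t = ket 0 t.
Proof.
rewrite /fser (_ : (fun N => _) = fun=> ket 0 t) ?culim_cst//.
apply/funext => N; rewrite /fpart big_ord_recl /= big1 ?addr0.
  by rewrite /e0 eqxx mul1r.
by move=> h _; rewrite /e0 mul0r.
Qed.

Lemma cmeas_fpart x N : cmeas (fpart x N).
Proof.
apply: (cmeas_sum _ (F := fun h t => x h * ket h t)) => h.
by apply: cmeasM; [exact: cmeas_cst|exact: cmeas_ket].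
Qed.

Lemma cvg_harmonic_scale (X : R) : (fun n => X / n.+1%:R) @ \oo --> (0 : R).
Proof. by rewrite -(mulr0 X); apply: cvgM; [exact: cvg_cst|exact: cvg_harmonic]. Qed.

Lemma cmeas_fser x X : square_decay x X -> cmeas (fser x).
Proof.
move=> xX; apply: (cmeas_lim (F := fpart x) (e := fun N => X / N.+1%:R)).
- exact: cmeas_fpart.
- by move=> N t; exact: fser_fpart.
- exact: cvg_harmonic_scale.
Qed.

Lemma L2_fpart x N : L2circle (fpart x N).
Proof.
by apply: (L2_sum _ (F := fun h t => x h * ket h t)) => h; apply: L2Z; exact: L2_ket.
Qed.

Lemma L2_diff_fser x X N : square_decay x X -> L2circle (fun t => fser x t - fpart x N t).
Proof.
move=> xX; apply: (L2_bounded (X := X / N.+1%:R)) => [|t _]; last exact: fser_fpart.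
rewrite (_ : (fun t => _) = fun t => fser x t + (-1) * fpart x N t).
  apply: cmeasD; first exact: cmeas_fser xX.
  by apply: cmeasM; [exact: cmeas_cst|exact: cmeas_fpart].
by apply/funext => t; rewrite mulN1r.
Qed.

Lemma L2_fser x X : square_decay x X -> L2circle (fser x).
Proof.
move=> xX; have -> : fser x = fun t => (fser x t - fpart x 0 t) + fpart x 0 t.
  by apply/funext => t; rewrite subrK.
by apply: L2D; [exact: L2_diff_fser xX|exact: L2_fpart].
Qed.

Lemma sqnorm_le f (X : R) : cmeas f -> (forall t, circle t -> normc (f t) <= X) ->
  sqnorm f <= X ^+ 2.
Proof.
move=> mf fX; rewrite sqnormE -[leRHS]rmean_cst; apply: rmean_le.
- exact: rint1_sqr (L2_bounded mf fX).
- exact: rint1_cst.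
move=> t ct; apply: lerXn2r; rewrite ?nnegrE ?normc_ge0 ?fX//.
by apply: le_trans (fX t ct); rewrite normc_ge0.
Qed.

Lemma hardy_ket h : hardy (ket h : R -> C).
Proof.
split; first exact: L2_ket.
move=> e e0'; exists 'X^h; rewrite sqnormE.
have -> : (fun t : R => normc (ket h t - ('X^h : {poly C}).[expi t]) ^+ 2) = fun=> 0.
  by apply/funext => t; rewrite hornerXn subrr normc0 expr0n.
by rewrite rmean_cst.
Qed.

Lemma archi_div (X e : R) : 0 <= X -> 0 < e -> exists N : nat, X / N.+1%:R < e.
Proof.
move=> X0 e0'; exists (Num.truncn (X / e)).
by rewrite ltr_pdivrMr// mulrC -ltr_pdivrMr// truncnS_gt.
Qed.

Lemma hardy_fser x X : square_decay x X -> hardy (fser x).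
Proof.
move=> xX; have X0 := square_decay_ge0 xX; split; first exact: L2_fser xX.
move=> e e0'.
have [|N hN] := @archi_div X (Num.min e 1) X0; first by rewrite lt_min e0' ltr01.
exists (\poly_(h < N.+1) x h).
have -> : (fun t : R => fser x t - (\poly_(h < N.+1) x h).[expi t]) =
   fun t => fser x t - fpart x N t.
  apply/funext => t; congr (_ - _).
  by rewrite horner_poly.
have mf : cmeas (fun t => fser x t - fpart x N t) := L2_cmeas (L2_diff_fser N xX).
apply: le_lt_trans (sqnorm_le mf (fun t _ => fser_fpart N t xX)) _.
move: hN; rewrite lt_min => /andP[h1 h2]; apply: le_lt_trans h1.
by rewrite expr2 ler_piMl ?divr_ge0// ltW.
Qed.

Lemma inner_ket_fpart x N h : (h <= N)%N -> inner (ket h) (fpart x N) = x h.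
Proof.
move=> hN; rewrite /fpart (inner_sumr _ (F := fun k t => x k * ket k t)); [|exact: L2_ket|].
  rewrite -(sum_kronecker x (_ : (h < N.+1)%N))//; apply: eq_bigr => k _.
  by rewrite innerZr ?inner_ket//; exact: L2_ket.
by move=> k; apply: L2Z; exact: L2_ket.
Qed.

Lemma inner_ket_bound h f (X : R) : cmeas f -> (forall t, circle t -> normc (f t) <= X) ->
  normc (inner (ket h) f) <= 2 * X.
Proof.
move=> mf fX; rewrite -[X in _ <= _ * X](rmean_cst X); apply: cmean_le.
- by apply: cmeasM => //; apply: cmeasJ; exact: cmeas_ket.
- exact: rint1_cst.
- by move=> t ct; rewrite normcM normcJE normc_ket mul1r fX.
Qed.

Lemma inner_ket_fser x X h : square_decay x X -> inner (ket h) (fser x) = x h.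
Proof.
move=> xX; have X0 := square_decay_ge0 xX.
apply/eqP; rewrite -subr_eq0; apply/eqP; apply: (small_eq0 (A := 2)) => e e0'.
have [N0 hN0] := archi_div X0 e0'.
pose N := maxn N0 h.
have hN : X / N.+1%:R <= e.
  apply: le_trans (ltW hN0); rewrite ler_wpM2l// lef_pV2 ?posrE ?ltr0n// ler_nat ltnS.
  exact: leq_maxl.
rewrite -(@inner_ket_fpart x N h) ?leq_maxr//.
rewrite -innerBr; [|exact: L2_ket|exact: L2_fser xX|exact: L2_fpart].
rewrite mulrC; apply: le_trans (inner_ket_bound (X := X / N.+1%:R) h _ _) _.
- exact: L2_cmeas (L2_diff_fser N xX).
- by move=> t _; exact: fser_fpart.
- by rewrite ler_pM2l.
Qed.

End FourierSeries.

(** * Toeplitz matrices with geometrically decaying entries *)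

Section ToeplitzWeights.
Context {R : realType}.
Local Notation C := R[i].

Lemma geo_sum_le (s : R) N : 0 <= s < 1 -> \sum_(k < N) s ^+ k <= (1 - s)^-1.
Proof.
move=> /andP[s0 s1]; have s1' : 0 < 1 - s by rewrite subr_gt0.
rewrite -[leRHS]mul1r ler_pdivlMr//.
suff -> : (\sum_(k < N) s ^+ k) * (1 - s) = 1 - s ^+ N by rewrite gerBl exprn_ge0.
elim: N => [|N IH]; first by rewrite big_ord0 mul0r expr0 subrr.
rewrite big_ord_recr /= mulrDl IH exprSr; ring.
Qed.

Lemma geo_dist_le (s : R) h N : 0 <= s < 1 ->
  \sum_(k < N) s ^+ (ndist h k) <= 2 / (1 - s).
Proof.
move=> s01; have /andP[s0 s1] := s01.
have sn k : 0 <= s ^+ k by exact: exprn_ge0.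
apply: (@le_trans _ _ (\sum_(k < h + N) s ^+ (ndist h k))).
  rewrite -!(big_mkord xpredT (fun k => s ^+ (ndist h k))).
  by rewrite (big_cat_nat (leq0n N) (leq_addl h N)) /= lerDl sumr_ge0.
rewrite big_split_ord /= mulr_natl mulr2n; apply: lerD.
  apply: le_trans (geo_sum_le h s01); rewrite (reindex_inj rev_ord_inj) /=.
  apply: ler_sum => k _; rewrite /ndist.
  have -> : (h - (h - k.+1) + (h - k.+1 - h))%N = k.+1 by have := ltn_ord k; lia.
  by rewrite exprS ler_piMl// ltW.
apply: le_trans (geo_sum_le N s01); apply: ler_sum => k _; rewrite /ndist.
by have -> : (h - (h + k) + (h + k - h))%N = k by lia.
Qed.

(** Each factor 1 + m is paid for by replacing the ratio s by its square root t: (1 + m) t^m <= 1 +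
    t + ... + t^m <= 1 / (1 - t), and s^m = t^m t^m. *)
Lemma poly_geo (p : nat) (r : R) : 0 <= r < 1 -> exists K s : R,
  [/\ 0 <= K, 0 <= s < 1 & forall m : nat, (1 + m%:R) ^+ p * r ^+ m <= K * s ^+ m].
Proof.
move=> r01; elim: p => [|p [K [s [K0 /andP[s0 s1] hs]]]].
  by exists 1, r; split => // m; rewrite expr0.
pose t := Num.sqrt s.
have t0 : 0 <= t by exact: sqrtr_ge0.
have t1 : t < 1 by rewrite -sqrtr1 ltr_sqrt.
have st : s = t ^+ 2 by rewrite sqr_sqrtr.
exists (K / (1 - t)), t; split; rewrite ?t0 ?divr_ge0 ?subr_ge0 ?(ltW t1)// => m.
rewrite exprS -mulrA; apply: (@le_trans _ _ ((1 + m%:R) * (K * s ^+ m))).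
  by rewrite ler_wpM2l ?addr_ge0.
have tm : (1 + m%:R) * t ^+ m <= (1 - t)^-1.
  apply: le_trans (geo_sum_le m.+1 _); last by rewrite t0.
  apply: (@le_trans _ _ (\sum_(k < m.+1) t ^+ m)).
    by rewrite sumr_const card_ord -[X in _ <= X]mulr_natl -natr1 addrC.
  apply: ler_sum => k _; apply: ler_wiXn2l => //; first exact: ltW.
  by rewrite -ltnS.
have -> : (1 + m%:R) * (K * s ^+ m) = K * ((1 + m%:R) * t ^+ m) * t ^+ m.
  by rewrite st -exprM mulnC exprM expr2; ring.
by rewrite ler_wpM2r ?exprn_ge0// ler_wpM2l.
Qed.

(** The symbol is real, so its Fourier coefficients of negative index are the conjugates of those of
    positive index, and only the latter are recorded in v. *)
Definition toep (v : nat -> C) (h k : nat) : C :=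
  if (k <= h)%N then v (h - k)%N else (v (k - h)%N)^*.

Lemma toep_herm v : (v 0%N)^* = v 0%N -> forall h k, toep v h k = (toep v k h)^*.
Proof.
move=> v0 h k; rewrite /toep.
have [kh|hk|->] := ltngtP k h; rewrite ?conjCK//.
by rewrite subnn v0.
Qed.

Lemma toep_weights v (B r : R) : 0 <= r < 1 -> (forall m, normc (v m) <= B * r ^+ m) ->
  exists Bw : nat -> R, forall p h N,
    \sum_(k < N) normc (toep v h k) * (1 + (ndist h k)%:R) ^+ p <= Bw p.
Proof.
move=> r01 hv.
have B0 : 0 <= B by apply: le_trans (normc_ge0 (v 0%N)) _; have := hv 0%N; rewrite expr0 mulr1.
have /choice[Bw hBw] : forall p, exists X : R, forall h N,
    \sum_(k < N) normc (toep v h k) * (1 + (ndist h k)%:R) ^+ p <= X; last by exists Bw.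
move=> p; have [K [s [K0 s01 hs]]] := poly_geo p r01.
exists (B * K * (2 / (1 - s))) => h N.
apply: (@le_trans _ _ (\sum_(k < N) B * K * s ^+ (ndist h k))); last first.
  by rewrite -mulr_sumr ler_wpM2l ?mulr_ge0// geo_dist_le.
apply: ler_sum => k _.
have tv : normc (toep v h k) <= B * r ^+ (ndist h k).
  rewrite /toep /ndist; case: leqP => kh.
    by apply: le_trans (hv _) _; have -> : (h - k + (k - h))%N = (h - k)%N by lia.
  by rewrite normcJE; apply: le_trans (hv _) _; have -> : (h - k + (k - h))%N = (k - h)%N by lia.
apply: le_trans (ler_wpM2r _ tv) _; first by rewrite exprn_ge0 ?addr_ge0.
by rewrite -!mulrA ler_wpM2l// mulrC.
Qed.

End ToeplitzWeights.

(** * Multiplication by the potential in Fourier coefficients *)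

Section LaxOperator.
Context {R : realType}.
Local Notation C := R[i].
Local Notation mu := (@lebesgue_measure R).
Context (v : nat -> C) (V : R -> R) (E : nat -> R).

Definition trig_part N (t : R) : C :=
  v 0%N + \sum_(m < N) (v m.+1 * ket m.+1 t + (v m.+1 * ket m.+1 t)^*).

Hypotheses (V_approx : forall N t, normc ((V t)%:C - trig_part N t) <= E N)
  (E_lim : E @ \oo --> (0 : R)).

Lemma E_ge0 N : 0 <= E N.
Proof. exact: le_trans (normc_ge0 _) (V_approx N 0). Qed.

Lemma cmeas_trig_part N : cmeas (trig_part N).
Proof.
apply: cmeasD; first exact: cmeas_cst.
apply: (cmeas_sum _ (F := fun m t => v m.+1 * ket m.+1 t + (v m.+1 * ket m.+1 t)^*)) => m.
have h : cmeas (fun t : R => v m.+1 * ket m.+1 t).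
  by apply: cmeasM; [exact: cmeas_cst|exact: cmeas_ket].
by apply: cmeasD => //; exact: cmeasJ.
Qed.

Lemma cmeas_V : cmeas (fun t => (V t)%:C).
Proof.
by apply: (cmeas_lim (F := trig_part) (e := E)) => //; exact: cmeas_trig_part.
Qed.

Lemma V_bounded t : normc ((V t)%:C : C) <= E 0%N + normc (v 0%N).
Proof.
have -> : (V t)%:C = ((V t)%:C - trig_part 0 t) + v 0%N.
  by rewrite /trig_part big_ord0 addr0 subrK.
by apply: le_trans (normcD _ _) _; rewrite lerD2r.
Qed.

Lemma L2_Vmul f : L2circle f -> L2circle (fun t => (V t)%:C * f t).
Proof.
by apply: L2_bmul; [exact: cmeas_V|move=> t _; exact: V_bounded].
Qed.

Section Coefficients.
Context (f : R -> C) (hf : hardy f).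
Local Notation fh := (fun k => inner (ket k) f).

Lemma L2_hardy : L2circle f. Proof. by case: hf. Qed.

Lemma cint1_ket_mul (g : R -> C) : L2circle g -> cint1 (fun t => g t * f t).
Proof.
move=> Lg; have L2J : L2circle (fun t => (g t)^*).
  apply: (L2_dom (h := fun t => normc (g t) ^+ 2)).
  - by apply: cmeasJ; exact: L2_cmeas.
  - exact: rint1_sqr.
  - by move=> t _; rewrite normcJE.
have := cint1_inner L2J L2_hardy.
by under eq_fun do rewrite conjCK.
Qed.

Lemma cmean_shift_down h m : cmean (fun t => (ket h t)^* * ket m.+1 t * f t) =
  if (m < h)%N then inner (ket (h - m.+1)%N) f else 0.
Proof.
case: ltnP => mh.
  congr cmean; apply/funext => t; congr (_ * _).
  by rewrite -{1}(subnK mh) ketD conjcM -mulrA ketJ mulr1.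
have [d ->] : exists d, m.+1 = (h + d.+1)%N by exists (m - h)%N; lia.
rewrite -(hardy_neg d hf); congr cmean; apply/funext => t; congr (_ * _).
by rewrite conjCK ketD mulrA ketJ mul1r.
Qed.

Lemma cmean_shift_up h m : cmean (fun t => (ket h t)^* * (ket m t)^* * f t) =
  inner (ket (h + m)) f.
Proof. by congr cmean; apply/funext => t; rewrite -conjcM ketD. Qed.

Lemma L2_ketJM h m : L2circle (fun t : R => (ket h t)^* * (ket m t) : C).
Proof.
apply: (L2_bounded (X := 1)) => [|t _].
  by apply: cmeasM; [apply: cmeasJ|]; exact: cmeas_ket.
by rewrite normcM normcJE !normc_ket mulr1.
Qed.

Lemma L2_ketJJ h m : L2circle (fun t : R => (ket h t)^* * (ket m t)^* : C).
Proof.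
apply: (L2_bounded (X := 1)) => [|t _].
  by apply: cmeasM; apply: cmeasJ; exact: cmeas_ket.
by rewrite normcM !normcJE !normc_ket mulr1.
Qed.

(** This is the band |h - k| <= N of the Toeplitz row. Truncated subtraction cuts it at k = 0, in
    agreement with [hardy_neg]: f has no modes of negative index. *)
Lemma inner_trig_part h N :
  inner (ket h) (fun t => trig_part N t * f t) =
  \sum_(h - N <= k < h + N.+1) toep v h k * fh k.
Proof.
have -> : inner (ket h) (fun t => trig_part N t * f t) = v 0%N * fh h +
   \sum_(m < N) (v m.+1 * (if (m < h)%N then fh (h - m.+1)%N else 0) +
      (v m.+1)^* * fh (h + m.+1)%N).
  transitivity (cmean (fun t => v 0%N * ((ket h t)^* * f t) + \sum_(m < N)
     (v m.+1 * ((ket h t)^* * ket m.+1 t * f t) +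
      (v m.+1)^* * ((ket h t)^* * (ket m.+1 t)^* * f t)))).
    congr cmean; apply/funext => t; rewrite /trig_part mulrDl mulrDr; congr (_ + _).
      by rewrite mulrCA.
    rewrite mulr_suml mulr_sumr; apply: eq_bigr => m _; rewrite conjcM; ring.
  have i1 m : cint1 (fun t => v m.+1 * ((ket h t)^* * ket m.+1 t * f t)).
    by apply: cint1Z; apply: cint1_ket_mul; exact: L2_ketJM.
  have i2 m : cint1 (fun t => (v m.+1)^* * ((ket h t)^* * (ket m.+1 t)^* * f t)).
    by apply: cint1Z; apply: cint1_ket_mul; exact: L2_ketJJ.
  rewrite cmeanD; first last.
  - by apply: (cint1_sum _ (F := fun m t => v m.+1 * ((ket h t)^* * ket m.+1 t * f t) +
      (v m.+1)^* * ((ket h t)^* * (ket m.+1 t)^* * f t))) => m; exact: cint1D.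
  - by apply: cint1Z; apply: cint1_inner; [exact: L2_ket|exact: L2_hardy].
  congr (_ + _).
    by rewrite cmeanZ//; apply: cint1_inner; [exact: L2_ket|exact: L2_hardy].
  rewrite (cmean_sum _ (F := fun m t => v m.+1 * ((ket h t)^* * ket m.+1 t * f t) +
      (v m.+1)^* * ((ket h t)^* * (ket m.+1 t)^* * f t))); last by move=> m; exact: cint1D.
  apply: eq_bigr => m _; rewrite cmeanD// !cmeanZ.
  - by rewrite cmean_shift_down cmean_shift_up.
  - by apply: cint1_ket_mul; exact: L2_ketJJ.
  - by apply: cint1_ket_mul; exact: L2_ketJM.
elim: N => [|N IH].
  by rewrite big_ord0 addr0 subn0 addn1 big_nat1 /toep leqnn subnn.
rewrite big_ord_recr /= addrA IH [(h + N.+2)%N]addnS big_nat_recr /=; last by lia.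
have tu : toep v h (h + N.+1) = (v N.+1)^*.
  by rewrite /toep leqNgt -addn1 leq_add2l /= addKn.
rewrite tu addrA; congr (_ + _).
case: ltnP => Nh; last first.
  by rewrite mulr0 addr0; have -> : (h - N = h - N.+1)%N by lia.
have e : (h - N = (h - N.+1).+1)%N by lia.
rewrite [RHS]big_ltn; last by lia.
by rewrite e addrC /toep leq_subr subKn.
Qed.

(** For M = h + N + 1 with N >= h, the first M terms of the Toeplitz row give exactly the
    coefficient of [trig_part N] times f; uniform approximation of V by [trig_part N] then suffices,
    with 1 + |f|^2 as majorant of |f|. *)
Lemma inner_toep h : inner (ket h) (fun t => (V t)%:C * f t) = Wop (toep v) fh h.
Proof.
apply/esym/culimP => e e0'.
pose A := rmean (fun t => 1 + normc (f t) ^+ 2).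
have iA : rint1 (fun t => 1 + normc (f t) ^+ 2).
  by apply: rint1D; [exact: rint1_cst|apply: rint1_sqr; exact: L2_hardy].
have A0 : 0 <= A by apply: rmean_ge0 => t _; rewrite addr_ge0 ?sqr_ge0.
have e1 : 0 < e / (2 * (A + 1)) by rewrite divr_gt0// mulr_gt0// ltr_wpDl.
move/cvgrPdist_le : E_lim => /(_ _ e1)[N0 _ hN0].
apply: (near_ultra (N := (N0 + h + h).+1)) => M hM.
have [N NE] : exists N, M = (h + N.+1)%N by exists (M - h).-1; lia.
have N0N : (N0 <= N)%N by lia.
have -> : \sum_(k < M) toep v h k * fh k = inner (ket h) (fun t => trig_part N t * f t).
  rewrite inner_trig_part -NE; have -> : (h - N)%N = 0%N by lia.
  by rewrite big_mkord.
have bt : forall t, circle t -> normc (trig_part N t) <= E 0%N + normc (v 0%N) + E N.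
  move=> t _; rewrite -[trig_part N t](subKr (V t)%:C); apply: le_trans (normcD _ _) _.
  by rewrite normcNE; apply: lerD => //; exact: V_bounded.
rewrite -innerBr; [|exact: L2_ket|exact: L2_bmul (cmeas_trig_part N) bt L2_hardy|
  exact: L2_Vmul L2_hardy].
apply: le_trans (cmean_le (h := fun t => E N * (1 + normc (f t) ^+ 2)) _ _ _) _.
- apply: cmeasM; first by apply: cmeasJ; exact: cmeas_ket.
  apply: L2_cmeas; apply: L2B; first exact: L2_bmul (cmeas_trig_part N) bt L2_hardy.
  exact: L2_Vmul L2_hardy.
- exact: rint1Z.
- move=> t ct; rewrite -mulrBl !normcM normcJE normc_ket mul1r normcBC.
  apply: ler_pM; rewrite ?normc_ge0//.
  have := sqr_ge0 (normc (f t) - 1); have := sqr_ge0 (normc (f t)); lra.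
rewrite rmeanZ// -/A.
have := hN0 N N0N; rewrite /= sub0r normrN ger0_norm ?E_ge0// ler_pdivlMr; last first.
  by rewrite mulr_gt0// ltr_wpDl.
have := E_ge0 N; nra.
Qed.

Lemma fh_bounded : exists X : R, forall h, normc (fh h) <= X.
Proof.
exists (2 * (1 * sqnorm (fun _ : R => 1 : C) + 1^-1 * sqnorm f)) => h.
have -> : sqnorm (fun _ : R => 1 : C) = sqnorm (ket h : R -> C).
  by rewrite !sqnormE; congr rmean; apply/funext => t; rewrite normc_ket normc1.
by apply: inner_le; [exact: ltr01|exact: L2_ket|exact: L2_hardy].
Qed.

End Coefficients.

End LaxOperator.

(** * The resolvent function *)

Section PhiResolvent.
Context {R : realType}.
Local Notation C := R[i].
Local Notation mu := (@lebesgue_measure R).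
Context (eps : R) (v : nat -> C) (V : R -> R) (E : nat -> R) (Bw : nat -> R).
Hypotheses (eps_gt0 : 0 < eps)
  (V_approx : forall N t, normc ((V t)%:C - trig_part v N t) <= E N)
  (E_lim : E @ \oo --> (0 : R))
  (v0_real : (v 0%N)^* = v 0%N)
  (W_bnd : forall p h N,
     \sum_(k < N) normc (toep v h k) * (1 + (ndist h k)%:R) ^+ p <= Bw p).
Context (S : nat -> nat -> R) (phi : nat -> nat -> nat -> C).
Hypothesis eigP : forall M,
  [/\ forall j k, (j < M)%N -> (k < M)%N ->
        \sum_(h < M) (phi M j h)^* * phi M k h = (j == k)%:R,
      forall h k, (h < M)%N -> (k < M)%N ->
        \sum_(j < M) phi M j h * (phi M j k)^* = (h == k)%:R,
      forall j h, (j < M)%N -> (h < M)%N ->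
        \sum_(k < M) lax_mx (toep v) eps h k * phi M j k = (S M j)%:C * phi M j h &
      forall j k, (j <= k)%N -> (k < M)%N -> S M k <= S M j].

Let W_herm := toep_herm v0_real.
Local Notation res := (res S phi).

Lemma lax_coefficients f Lf h : Lax eps V f Lf -> L2circle Lf /\
  inner (ket h) Lf = lax_op (toep v) eps (fun k => inner (ket k) f) h.
Proof.
move=> [Df [Tf [[hf hD DE] [hT TE] ->]]].
have Lf' : L2circle f by case: hf.
have LD : L2circle Df by case: hD.
have LT : L2circle Tf by case: hT.
have LeD : L2circle (fun x => - eps%:C * Df x) by exact: L2Z.
split; first exact: L2D.
rewrite innerDr//; last exact: L2_ket.
rewrite innerZr//; last exact: L2_ket.
rewrite DE /lax_op addrC; congr (_ + _); last first.
  by rewrite mulNr mulrA rmorphM rmorph_nat.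
have := TE _ (hardy_ket h); rewrite innerBr//; [|exact: L2_ket|].
  by move/eqP; rewrite subr_eq0 => /eqP <-; exact: (inner_toep V_approx E_lim hf).
exact: (L2_Vmul V_approx E_lim).
Qed.

Lemma Phi_unique u (c : C) f Lf : (forall j, u != (lim_eig S j)%:C) -> Lax eps V f Lf ->
  {ae mu, forall x, circle x -> u * f x - Lf x = ket 0 x} -> c = inner (ket 0) f ->
  c = res u 0%N.
Proof.
move=> uS fL ae ->.
have hf : hardy f by case: fL => [? [? [[]]]].
have Lf' : L2circle f by case: hf.
have [X hX] := fh_bounded hf.
apply: (resolvent_unique eps_gt0 W_herm W_bnd eigP uS hX) => h.
have [LL <-] := lax_coefficients h fL.
rewrite -innerZr//; last exact: L2_ket.
have Lu : L2circle (fun x => u * f x) by exact: L2Z.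
rewrite -innerBr//; last exact: L2_ket.
transitivity (inner (ket h) (ket 0 : R -> C)); last by rewrite inner_ket.
have m1 : cmeas (fun x : R => (ket h x)^* : C) by apply: cmeasJ; exact: cmeas_ket.
apply: ae_eq_cmean.
- by apply: cmeasM => //; apply: L2_cmeas; exact: L2B.
- by apply: cmeasM => //; exact: cmeas_ket.
have FF := ae_filter_ringOfSetsType mu.
by apply: (@filterS _ _ FF _ _ _ ae) => x hx cx; rewrite hx.
Qed.

Lemma Phi_exists u : (forall j, u != (lim_eig S j)%:C) -> exists f Lf,
  [/\ Lax eps V f Lf, {ae mu, forall x, circle x -> u * f x - Lf x = ket 0 x} &
      res u 0%N = inner (ket 0) f].
Proof.
move=> uS.
(* Weight 3 for x leaves D x the weight 2 that [square_decay] demands. *)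
have [X hX] := res_decay eps_gt0 W_herm W_bnd eigP uS 3.
set x := res u in hX *.
pose y h : C := h%:R * x h.
pose z := Wop (toep v) x.
have h1 h : 1 <= 1 + h%:R :> R by rewrite lerDl.
have h0 h : 0 <= 1 + h%:R :> R by rewrite addr_ge0.
have xX : square_decay x X.
  move=> h; apply: le_trans (hX h); rewrite ler_wpM2l ?normc_ge0// [leRHS]exprSr.
  by rewrite ler_peMr ?exprn_ge0.
have yX : square_decay y X.
  move=> h; apply: le_trans (hX h); rewrite normcM normc_nat -mulrA mulrCA.
  rewrite ler_wpM2l ?normc_ge0// [leRHS]exprS ler_wpM2r ?exprn_ge0//.
  by rewrite lerDr.
have zX : square_decay z (Bw 2 * X) by move=> h; exact: (Wop_weight W_bnd).
exists (fser x), (fun t => - eps%:C * fser y t + fser z t); split.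
- exists (fser y), (fser z); split => //.
    split; [exact: hardy_fser xX|exact: hardy_fser yX|] => h.
    by rewrite (inner_ket_fser h xX) (inner_ket_fser h yX).
  split; first exact: hardy_fser zX.
  have LV := L2_Vmul V_approx E_lim (L2_fser xX).
  move=> q hq; apply: hardy_orth hq _ _; first by apply: L2B => //; exact: L2_fser zX.
  move=> h; rewrite innerBr//; [|exact: L2_ket|exact: L2_fser zX].
  rewrite (inner_toep V_approx E_lim (hardy_fser xX)) (inner_ket_fser h zX).
  rewrite (_ : (fun k => _) = x) ?subrr//.
  by apply/funext => k; rewrite (inner_ket_fser k xX).
- apply: aeW => t _; rewrite -fser_e0.
  have -> : e0 = fun h => u * x h + (eps%:C * y h + (-1) * z h).
    apply/funext => h; rewrite -(res_eq eps_gt0 W_herm W_bnd eigP uS h) -/x /lax_op -/(z h).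
    rewrite /y rmorphM rmorph_nat; ring.
  have ux : square_decay (fun h => u * x h) (normc u * X).
    by move=> h; rewrite normcM -mulrA ler_wpM2l ?normc_ge0.
  have ey : square_decay (fun h => eps%:C * y h) (normc eps%:C * X).
    by move=> h; rewrite normcM -mulrA ler_wpM2l ?normc_ge0.
  have nz : square_decay (fun h => (-1) * z h) (1 * (Bw 2 * X)).
    by move=> h; rewrite normcM normcNE normc1 -mulrA ler_wpM2l.
  have eyz : square_decay (fun h => eps%:C * y h + (-1) * z h) (normc eps%:C * X + 1 * (Bw 2 * X)).
    move=> h; apply: le_trans (ler_wpM2r _ (normcD _ _)) _; first exact: sqr_ge0.
    by rewrite mulrDl lerD.
  rewrite (fserD t ux eyz) (fserD t ey nz) (fserZ u t xX) (fserZ _ t yX) (fserZ _ t zX).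
  ring.
- by rewrite (inner_ket_fser 0 xX).
Qed.

Lemma Phi_res u : (forall j, u != (lim_eig S j)%:C) -> Phi eps V u = res u 0%N.
Proof.
move=> uS; rewrite /Phi.
set P := [set c | _].
have PP c : P c -> c = res u 0%N by move=> [f [Lf [h1 h2 h3]]]; exact: (Phi_unique uS h1 h2 h3).
apply: PP; apply: xgetPex; have [f [Lf [h1 h2 h3]]] := Phi_exists uS.
by exists (res u 0%N), f, Lf; split.
Qed.

End PhiResolvent.

(** * Infinitely many gaps for a rational symbol with a pole *)

Section InfinitelyManyGaps.
Context {R : realType}.
Local Notation C := R[i].

Lemma infinite_gaps (eps : R) (v : nat -> C) (V : R -> R) (E : nat -> R) (B r : R)
    (Q F : {poly C}) (b : C) : 0 < eps ->
  (forall N t, normc ((V t)%:C - trig_part v N t) <= E N) ->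
  E @ \oo --> (0 : R) -> (v 0%N)^* = v 0%N ->
  0 <= r < 1 -> (forall m, normc (v m) <= B * r ^+ m) ->
  (forall h, conv (pseq Q) v h = pseq F h) -> Q.[b] = 0 ->
  (forall j : nat, eps%:C * j%:R * b * Q^`().[b] + F.[b] != 0) ->
  infinite_set (gaps eps V).
Proof.
move=> eps_gt0 V_approx E_lim v0_real r01 hv QF Qb ind.
have [Bw W_bnd] := toep_weights r01 hv.
have W_herm := toep_herm v0_real.
have /choice[S hS] : forall M, exists (S : nat -> R)
    (phi : nat -> nat -> C), [/\ forall j k, (j < M)%N -> (k < M)%N ->
        \sum_(h < M) (phi j h)^* * phi k h = (j == k)%:R,
      forall h k, (h < M)%N -> (k < M)%N ->
        \sum_(j < M) phi j h * (phi j k)^* = (h == k)%:R,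
      forall j h, (j < M)%N -> (h < M)%N ->
        \sum_(k < M) lax_mx (toep v) eps h k * phi j k = (S j)%:C * phi j h &
      forall j k, (j <= k)%N -> (k < M)%N -> S k <= S j].
  by move=> M; apply: hermitian_eigenbasis; exact: lax_mx_herm.
have /choice[phi eigP] := hS.
have PR := Phi_res eps_gt0 V_approx E_lim v0_real W_bnd eigP.
have inf J : exists2 j, (J <= j)%N & 0 < lim_weight phi j.
  apply: contrapT => none.
  have al0 j : (J <= j)%N -> lim_weight phi j = 0.
    move=> Jj; apply/eqP; rewrite eq_le (al_ge0 eigP) andbT leNgt; apply/negP => aj.
    by apply: none; exists j.
  have rel := finite_support_relation eps_gt0 W_herm W_bnd eigP al0.
  apply: (krylov_independent eps_gt0 W_bnd _ _ QF Qb ind _ rel).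
  - by move=> h k; rewrite /toep ltnS !subSS.
  - by move=> h; rewrite /toep leq0n subn0.
  - by apply/prodf_neq0 => j _; rewrite polyXsubC_eq0.
have GS u J : (forall j, u != (lim_eig S j)%:C) -> Bw 0 + normc u < eps * J%:R ->
    normc (Phi eps V u - \sum_(j < J) (lim_weight phi j)%:C / (u - (lim_eig S j)%:C)) <=
    (eps * J%:R - Bw 0 - normc u)^-1.
  by move=> uS hJ; rewrite PR//; exact: (res_series eps_gt0 W_herm W_bnd eigP).
exact: (infinite_series_gaps eps_gt0 (Sl_upper eps_gt0 W_herm W_bnd eigP)
  (al_ge0 eigP) (sum_al_le1 eps_gt0 eigP) inf GS).
Qed.

End InfinitelyManyGaps.

(** * Exponential sums *)

Section ExponentialSums.
Context {R : realType}.
Local Notation C := R[i].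
Implicit Types (L f g : seq (C * R)).

(* The list of the pairs (c, l) encodes the function sum c e^{i l z} of
   z = x - i y. *)
Definition xsum L (x y : R) : C :=
  \sum_(p <- L) p.1 * (expR (p.2 * y))%:C * expi (p.2 * x).

(** A frequency may occur several times in the list; the function determines these coefficients, not
    the list. *)
Definition xcoef L (mu : R) : C := \sum_(p <- L | p.2 == mu) p.1.

Definition xmul f g := [seq (p.1 * q.1, p.2 + q.2) | p <- f, q <- g].

Definition xscale (phi : R -> C) L : seq (C * R) := [seq (p.1 * phi p.2, p.2) | p <- L].

Definition xder := xscale (fun l => 'i * l%:C).

Definition xtrans (h : R) := xscale (fun l => expi (l * h)).

Definition freq_in (P : pred R) L := all (fun p => P p.2) L.

Lemma xsum_cons p L x y :
  xsum (p :: L) x y = p.1 * (expR (p.2 * y))%:C * expi (p.2 * x) + xsum L x y.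
Proof. by rewrite /xsum big_cons. Qed.

Lemma xsum_cat f g x y : xsum (f ++ g) x y = xsum f x y + xsum g x y.
Proof. by rewrite /xsum big_cat. Qed.

Lemma xsum_mul f g x y : xsum (xmul f g) x y = xsum f x y * xsum g x y.
Proof.
rewrite /xsum /xmul big_allpairs_dep /= mulr_suml; apply: eq_bigr => p _.
rewrite mulr_sumr; apply: eq_bigr => q _ /=.
rewrite !mulrDl expRD rmorphM expiD; ring.
Qed.

Lemma xsum_trans h L x y : xsum (xtrans h L) x y = xsum L (x + h) y.
Proof.
rewrite /xsum /xtrans /xscale big_map; apply: eq_bigr => p _ /=.
rewrite mulrDr expiD; ring.
Qed.

Lemma xcoef_cat f g mu : xcoef (f ++ g) mu = xcoef f mu + xcoef g mu.
Proof. by rewrite /xcoef big_cat. Qed.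

Lemma xcoef_cons p L mu : xcoef (p :: L) mu = (if p.2 == mu then p.1 else 0) + xcoef L mu.
Proof. by rewrite /xcoef big_cons; case: ifP; rewrite ?add0r. Qed.

Lemma xcoef_mul f g mu : xcoef (xmul f g) mu = \sum_(p <- f) p.1 * xcoef g (mu - p.2).
Proof.
rewrite /xcoef /xmul big_mkcond big_allpairs_dep /=; apply: eq_bigr => p _.
rewrite mulr_sumr [RHS]big_mkcond; apply: eq_bigr => q _ /=.
by rewrite [_ == mu - _]eq_sym subr_eq eq_sym addrC.
Qed.

Lemma xcoef_term k l L mu : xcoef (xmul [:: (k, l)] L) mu = k * xcoef L (mu - l).
Proof. by rewrite xcoef_mul big_seq1. Qed.

Lemma xcoef_scale phi L mu : xcoef (xscale phi L) mu = xcoef L mu * phi mu.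
Proof.
rewrite /xcoef /xscale big_map /= mulr_suml; apply: eq_bigr => p /eqP <-.
by [].
Qed.

Lemma freq_in_xscale (P : pred R) phi L :
  freq_in P (xscale phi L) = freq_in P L.
Proof. by rewrite /freq_in all_map. Qed.

Lemma xcoef_out (P : pred R) L mu : freq_in P L -> ~~ P mu -> xcoef L mu = 0.
Proof.
move=> aL nP; elim: L aL => [|p L IH] /=; first by rewrite /xcoef big_nil.
move=> /andP[Pp aL]; rewrite xcoef_cons IH// addr0.
by case: eqP => // e; move: nP; rewrite -e Pp.
Qed.

Lemma freq_in_cat (P : pred R) f g : freq_in P (f ++ g) = freq_in P f && freq_in P g.
Proof. exact: all_cat. Qed.

Lemma freq_in_xmul (P Q S : pred R) f g : (forall a b, P a -> Q b -> S (a + b)) ->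
  freq_in P f -> freq_in Q g -> freq_in S (xmul f g).
Proof.
move=> PQ af ag; apply/allP => /= _ /allpairsP[[p q] [pf qg ->]] /=.
by apply: PQ; [exact: (allP af _ pf)|exact: (allP ag _ qg)].
Qed.

Lemma expi_pi : expi (pi : R) = -1.
Proof. by rewrite /expi cospi sinpi; apply: complex_eqP => //=; rewrite oppr0. Qed.

(* Averaging x and x + pi / l kills the frequency l. *)
Lemma xcoef0_ge L (eta : R) :
  (forall x, eta <= Re (xsum L x 0)) -> eta <= Re (xcoef L 0).
Proof.
move: {2}(size L) (leqnn (size L)) => n.
elim: n L eta => [|n IH] L eta.
  rewrite leqn0 => /nilP -> /(_ 0); by rewrite /xsum /xcoef !big_nil.
case: L => [|[c l] L] /=; first by move=> _ /(_ 0); rewrite /xsum /xcoef !big_nil.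
rewrite ltnS => sL h; rewrite xcoef_cons /=; case: eqP => [l0|/eqP l0].
  rewrite ReD -lerBlDl; apply: IH => // x; have := h x.
  rewrite xsum_cons /= l0 !mul0r expR0 expi0 !mulr1 ReD.
  by rewrite lerBlDl.
rewrite add0r.
pose h2 := pi / l.
pose L' := xscale (fun m => 2^-1%:C * (1 + expi (m * h2))) L.
have coef' : xcoef L' 0 = xcoef L 0.
  rewrite xcoef_scale mul0r expi0 -[1 + 1]/(2%:R : C).
  by rewrite -(rmorph_nat (real_complex R)) -rmorphM mulVf ?mulr1.
rewrite -coef'; apply: IH => [|x]; first by rewrite size_map.
have -> : xsum L' x 0 =
    2^-1%:C * (xsum ((c, l) :: L) x 0 + xsum ((c, l) :: L) (x + h2) 0).
  have eh : expi (l * (x + h2)) = - expi (l * x).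
    by rewrite mulrDr expiD mulrCA divff// mulr1 expi_pi mulrN1.
  rewrite !xsum_cons /= eh mulrN addrACA subrr add0r /xsum big_map -big_split mulr_sumr.
  apply: eq_bigr => p _ /=; rewrite [p.2 * (x + _)]mulrDr expiD; ring.
rewrite ReZ ReD; have := h x; have := h (x + h2); lra.
Qed.

(** Multiplying by - conj a e^{- i mu x} moves the coefficient a to the mean. The product is still
    the zero function, and its lower bound 0 becomes 0 <= - |a|^2. *)
Lemma xcoef_eq0 L : (forall x, xsum L x 0 = 0) -> forall mu, xcoef L mu = 0.
Proof.
move=> L0 mu; pose a := xcoef L mu.
have /xcoef0_ge : forall x, 0 <= Re (xsum (xmul [:: (- a^*, - mu)] L) x 0).
  by move=> x; rewrite xsum_mul L0 mulr0.
rewrite xcoef_term opprK add0r -/a mulNr mulJc ReN oppr_ge0 => /= h.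
by apply/eqP; rewrite -normc_eq0 -sqrf_eq0 eq_le h sqr_ge0.
Qed.

Lemma xsum_eq0 L : (forall mu, xcoef L mu = 0) -> forall x y, xsum L x y = 0.
Proof.
move=> L0 x y; rewrite /xsum.
transitivity (\sum_(mu <- undup (map snd L)) \sum_(p <- L | p.2 == mu)
    p.1 * (expR (p.2 * y))%:C * expi (p.2 * x)).
  under [RHS]eq_bigr => mu _ do rewrite big_mkcond.
  rewrite exchange_big /= big_seq [RHS]big_seq; apply: eq_bigr => p pL.
  rewrite -big_mkcond (big_rem p.2) /=; last by rewrite mem_undup; apply: map_f.
  rewrite eqxx big_seq_cond big1 ?addr0// => mu /andP[h /eqP e].
  by move: h; rewrite -e mem_rem_uniq ?undup_uniq// !inE eqxx.
apply: big1_seq => mu _.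
transitivity (xcoef L mu * (expR (mu * y))%:C * expi (mu * x)); last by rewrite L0 !mul0r.
by rewrite /xcoef !mulr_suml; apply: eq_bigr => p /eqP ->.
Qed.

Lemma xsum_eq f g : (forall mu, xcoef f mu = xcoef g mu) ->
  forall x y, xsum f x y = xsum g x y.
Proof.
move=> fg x y; apply/eqP; rewrite -subr_eq0.
have H : xsum (f ++ xmul [:: (-1, 0)] g) x y = 0.
  by apply: xsum_eq0 => mu; rewrite xcoef_cat xcoef_term fg subr0 mulN1r subrr.
rewrite -H xsum_cat xsum_mul xsum_cons /(xsum [::]) big_nil /= !mul0r expR0 expi0 !mulr1 addr0.
by rewrite mulN1r.
Qed.

(* Take means: Re A has mean 0 and dominates |f|^2; conclude by Bessel's inequality. *)
Lemma xcoef_dominated f A (B : R) : 0 <= B -> xcoef A 0 = 0 ->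
  (forall x, normc (xsum f x 0) ^+ 2 <= B * Re (xsum A x 0)) ->
  forall mu, xcoef f mu = 0.
Proof.
move=> B0 A0 fA mu; pose a := xcoef f mu.
pose G := xmul [:: (B%:C, 0)] A ++ xmul [:: (- (2%:R * a^*), - mu)] f.
have /xcoef0_ge : forall x, - normc a ^+ 2 <= Re (xsum G x 0).
  move=> x; rewrite xsum_cat !xsum_mul !xsum_cons /xsum big_nil -/(xsum A x 0) -/(xsum f x 0) /=.
  rewrite !mul0r !mulr0 expR0 expi0 !mulr1 !addr0 ReD ReZ.
  apply: le_trans (lerD (fA x) (lexx _)).
  set F := xsum f x 0; set e := expi _.
  have e1 : normc e = 1 by exact: normc_expi.
  have : 0 <= normc F ^+ 2 - 2 * Re (a^* * (e * F)) + normc a ^+ 2.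
    have -> : normc F = normc (e * F) by rewrite normcM e1 mul1r.
    move: (e * F) => z; apply: le_trans (sqr_ge0 (normc (z - a))) _.
    rewrite !(sqr_normcE _) ReD ImD ReN ImN ReM ReJ ImJ; lra.
  rewrite !mulNr ReN -!mulrA -(rmorph_nat (real_complex R)) ReZ; lra.
rewrite xcoef_cat !xcoef_term subr0 A0 mulr0 add0r sub0r opprK -/a mulNr ReN -mulrA mulJc.
rewrite -(rmorph_nat (real_complex R)) ReZ /= => h.
by apply/eqP; rewrite -normc_eq0 -sqrf_eq0 eq_le sqr_ge0 andbT; move: h; lra.
Qed.

Lemma xsum_bound L : exists2 B : R, 0 <= B & forall x, normc (xsum L x 0) <= B.
Proof.
exists (\sum_(p <- L) normc p.1); first by apply: sumr_ge0 => p _; exact: normc_ge0.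
move=> x; apply: le_trans (normc_sum _ _ _) _; apply: ler_sum => p _.
by rewrite !normcM normc_expi mulr0 expR0 normc1 !mulr1.
Qed.

Lemma cderive1_xsum L x : cderive1 (fun y => xsum L y 0) x = xsum (xder L) x 0.
Proof.
have [h1 h2] : is_derive x (1 : R) (fun y => Re (xsum L y 0)) (Re (xsum (xder L) x 0)) /\
    is_derive x (1 : R) (fun y => Im (xsum L y 0)) (Im (xsum (xder L) x 0)).
  elim: L => [|[c l] L [IH1 IH2]].
    rewrite /xsum /xder /= big_nil /=.
    by split; under eq_fun do rewrite big_nil; exact: is_derive_cst.
  have dc := is_derive_cosM l x; have ds := is_derive_sinM l x.
  split.
    under eq_fun do rewrite xsum_cons /= mulr0 expR0 mulr1 ReD ReM /=.
    apply: is_derive_eq.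
    rewrite xsum_cons /= mulr0 expR0 mulr1 ReD -/(xscale _ L) -/(xder L).
    rewrite !ReM !ImM !ReM /= /GRing.scale /=; ring.
  under eq_fun do rewrite xsum_cons /= mulr0 expR0 mulr1 ImD ImM /=.
  apply: is_derive_eq.
  rewrite xsum_cons /= mulr0 expR0 mulr1 ImD -/(xscale _ L) -/(xder L).
  rewrite !ImM !ReM !ImM /= /GRing.scale /=; ring.
rewrite /cderive1 !derive1E !derive_val.
by case: (xsum _ _ _).
Qed.

Section Unital.
Context (P : pred R) (P_add : forall a b, P a -> P b -> P (a + b)).

(** The constant is tracked apart from the frequencies in P. As P is closed under addition, sums,
    products and determinants transform the constants by the same formula as the functions. *)
Definition cst_xsum (c : C) (f : R -> R -> C) :=
  exists2 L, freq_in P L & forall x y, f x y = c + xsum L x y.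

Lemma cst_xsum_ext (c : C) (f g : R -> R -> C) : (forall x y, g x y = f x y) ->
  cst_xsum c f -> cst_xsum c g.
Proof. by move=> gf [L aL fL]; exists L => // x y; rewrite gf fL. Qed.

Lemma cst_xsum_cst c : cst_xsum c (fun _ _ => c).
Proof. by exists [::] => // x y; rewrite /xsum big_nil addr0. Qed.

Lemma cst_xsum_term k l : P l ->
  cst_xsum 0 (fun x y => k * (expR (l * y))%:C * expi (l * x)).
Proof.
by move=> Pl; exists [:: (k, l)] => [|x y]; rewrite /= ?Pl// xsum_cons /xsum big_nil addr0 add0r.
Qed.

Lemma cst_xsumD (a b : C) (f g : R -> R -> C) : cst_xsum a f -> cst_xsum b g ->
  cst_xsum (a + b) (fun x y => f x y + g x y).
Proof.
move=> [L aL fL] [K aK gK]; exists (L ++ K) => [|x y]; first by rewrite freq_in_cat aL.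
by rewrite fL gK xsum_cat addrACA.
Qed.

Lemma cst_xsumM (a b : C) (f g : R -> R -> C) : cst_xsum a f -> cst_xsum b g ->
  cst_xsum (a * b) (fun x y => f x y * g x y).
Proof.
move=> [L aL fL] [K aK gK].
exists (xscale (fun=> a) K ++ xscale (fun=> b) L ++ xmul L K) => [|x y].
  by rewrite !freq_in_cat !freq_in_xscale aL aK (freq_in_xmul P_add).
rewrite fL gK !xsum_cat xsum_mul mulrDl !mulrDr -!addrA.
have sc k M : xsum (xscale (fun=> k) M) x y = k * xsum M x y.
  by rewrite /xsum /xscale big_map mulr_sumr; apply: eq_bigr => p _ /=; ring.
by rewrite !sc [b * _]mulrC.
Qed.

Lemma cst_xsum_sum (I : Type) (r : seq I) (Q : pred I) (c : I -> C) (f : I -> R -> R -> C) :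
  (forall i, cst_xsum (c i) (f i)) ->
  cst_xsum (\sum_(i <- r | Q i) c i) (fun x y => \sum_(i <- r | Q i) f i x y).
Proof.
move=> h; elim: r => [|i r IH].
  by rewrite big_nil; apply: cst_xsum_ext (cst_xsum_cst _) => x y; rewrite big_nil.
rewrite big_cons; case Qi: (Q i); last first.
  by apply: cst_xsum_ext IH => x y; rewrite big_cons Qi.
by apply: cst_xsum_ext (cst_xsumD (h i) IH) => x y; rewrite big_cons Qi.
Qed.

Lemma cst_xsum_prod (I : Type) (r : seq I) (Q : pred I) (c : I -> C) (f : I -> R -> R -> C) :
  (forall i, cst_xsum (c i) (f i)) ->
  cst_xsum (\prod_(i <- r | Q i) c i) (fun x y => \prod_(i <- r | Q i) f i x y).
Proof.
move=> h; elim: r => [|i r IH].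
  by rewrite big_nil; apply: cst_xsum_ext (cst_xsum_cst _) => x y; rewrite big_nil.
rewrite big_cons; case Qi: (Q i); last first.
  by apply: cst_xsum_ext IH => x y; rewrite big_cons Qi.
by apply: cst_xsum_ext (cst_xsumM (h i) IH) => x y; rewrite big_cons Qi.
Qed.

Lemma cst_xsum_det n (c : 'M[C]_n) (A : R -> R -> 'M[C]_n) :
  (forall i j, cst_xsum (c i j) (fun x y => A x y i j)) ->
  cst_xsum (\det c) (fun x y => \det (A x y)).
Proof.
move=> h; apply: cst_xsum_sum => s; apply: cst_xsumM; first exact: cst_xsum_cst.
by apply: cst_xsum_prod => i.
Qed.

End Unital.

End ExponentialSums.

(** * Cauchy matrices *)

Lemma lagrange_interpolation (F : fieldType) n (a : 'I_n -> F) (p : {poly F}) (x : F) :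
  injective a -> (size p <= n)%N ->
  p.[x] = \sum_i p.[a i] * \prod_(m | m != i) ((x - a m) / (a i - a m)).
Proof.
move=> a_inj sp.
pose q := \sum_i (p.[a i])%:P * \prod_(m | m != i) (((a i - a m)^-1)%:P * ('X - (a m)%:P)).
have qx y : q.[y] = \sum_i p.[a i] * \prod_(m | m != i) ((y - a m) / (a i - a m)).
  rewrite horner_sum; apply: eq_bigr => i _; rewrite hornerM hornerC horner_prod.
  by congr (_ * _); apply: eq_bigr => m _; rewrite hornerM hornerC hornerXsubC mulrC.
rewrite -qx; suff /eqP : p - q = 0 by rewrite subr_eq0 => /eqP <-.
apply: (@roots_geq_poly_eq0 _ _ (codom a)).
- apply/allP => _ /codomP[j ->]; apply/rootP; rewrite hornerD hornerN qx.
  rewrite (bigD1 j)//= big1 ?mulr1; last first.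
    by move=> m mj; rewrite divff// subr_eq0 (inj_eq a_inj) eq_sym.
  rewrite big1 ?addr0 ?subrr// => i ij; rewrite (bigD1 j) 1?eq_sym//=.
  by rewrite subrr mul0r mul0r mulr0.
- by rewrite /codom map_inj_uniq// enum_uniq.
- rewrite size_codom card_ord (leq_trans (size_polyD _ _))// geq_max sp size_polyN.
  apply: (leq_trans (size_sum _ _ _)); apply/bigmax_leqP => i _.
  rewrite big_split /= -rmorph_prod /= mulrA -polyCM mul_polyC.
  apply: leq_trans (size_scale_leq _ _) _.
  rewrite size_prod; last by move=> m _; rewrite polyXsubC_eq0.
  rewrite (eq_bigr (fun=> 2)); last by move=> m _; rewrite size_XsubC.
  rewrite sum_nat_const cardC1 card_ord; have := ltn_ord i; lia.
Qed.

Section CauchyMatrix.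
Context {R : realType}.
Local Notation C := R[i].
Context (n : nat) (a d : 'I_n -> R).
Hypotheses (d_lt : forall i, d i < a i) (a_lt : forall i j : 'I_n, (i < j)%N -> a j < d i).

Lemma interl_aa (i j : 'I_n) : (i < j)%N -> a j < a i.
Proof. by move=> ij; exact: lt_trans (a_lt ij) (d_lt i). Qed.

Lemma interl_dd (i j : 'I_n) : (i < j)%N -> d j < d i.
Proof. by move=> ij; exact: lt_trans (d_lt j) (a_lt ij). Qed.

Lemma interl_neq (i j : 'I_n) : j != i -> (i < j)%N \/ (j < i)%N.
Proof. by rewrite neq_ltn => /orP[]; [right|left]. Qed.

Lemma interl_inj : injective a.
Proof.
move=> i j e; apply/eqP; apply: contraT => /interl_neq[] /interl_aa; by rewrite e ltxx.
Qed.

Lemma interl_ad i j : a i - d j != 0.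
Proof.
rewrite subr_eq0; case: (eqVneq j i) => [->|/interl_neq[ij|ij]].
- by rewrite gt_eqF.
- by rewrite gt_eqF// (lt_trans (interl_dd ij)).
- by rewrite lt_eqF// a_lt.
Qed.

(** With f(x) = prod_m (x - d_m) / (x - a_m), [cauchy_num i] is the residue of f at a_i and
    [cauchy_den j] is - f'(d_j). Interlacing makes both positive, and they are the weights for which
    the Cauchy matrix is an isometry. *)
Definition cauchy_num (i : 'I_n) : R :=
  (a i - d i) * \prod_(j | j != i) ((a i - d j) / (a i - a j)).

Definition cauchy_den (j : 'I_n) : R :=
  (a j - d j)^-1 * \prod_(m | m != j) ((d j - d m) / (d j - a m)).

Lemma cauchy_num_gt0 i : 0 < cauchy_num i.
Proof.
rewrite mulr_gt0 ?subr_gt0//; apply: prodr_gt0 => j /interl_neq[ij|ij].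
  by rewrite divr_gt0 ?subr_gt0 ?interl_aa// (lt_trans (interl_dd ij)).
by rewrite -[_ / _]opprK -mulrN -mulNr -invrN !opprB divr_gt0 ?subr_gt0 ?interl_aa// a_lt.
Qed.

Lemma cauchy_den_gt0 i : 0 < cauchy_den i.
Proof.
rewrite mulr_gt0 ?invr_gt0 ?subr_gt0//; apply: prodr_gt0 => j /interl_neq[ij|ij].
  by rewrite divr_gt0 ?subr_gt0 ?interl_dd ?a_lt.
rewrite -[_ / _]opprK -mulrN -mulNr -invrN !opprB divr_gt0 ?subr_gt0 ?interl_dd//.
exact: lt_trans (interl_aa ij).
Qed.

(** Lagrange interpolation at the nodes a_i of the polynomial prod_{m != j} (X - d_m), of degree n -
    1, evaluated at d_l, where it vanishes unless l = j. *)
Lemma cauchy_gram j l :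
  \sum_i cauchy_num i * ((a i - d j)^-1 * (a i - d l)^-1) = (j == l)%:R * cauchy_den j.
Proof.
have da i : d l - a i != 0 by rewrite -oppr_eq0 opprB interl_ad.
have aa i m : m != i -> a i - a m != 0.
  by move=> mi; rewrite subr_eq0 (inj_eq interl_inj) eq_sym.
pose A := \prod_m (d l - a m).
have A0 : A != 0 by apply/prodf_neq0 => m _.
have := @lagrange_interpolation _ _ a (\prod_(m | m != j) ('X - (d m)%:P)) (d l) interl_inj.
rewrite size_prod; last by move=> m _; rewrite polyXsubC_eq0.
rewrite (eq_bigr (fun=> 2)); last by move=> m _; rewrite size_XsubC.
rewrite sum_nat_const cardC1 card_ord => /(_ _)/wrap[|L]; first by have := ltn_ord j; lia.
have {L}: \prod_(m | m != j) (d l - d m) =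
    - A * \sum_i cauchy_num i * ((a i - d j)^-1 * (a i - d l)^-1).
  move: L; rewrite horner_prod; under eq_bigr do rewrite hornerXsubC.
  move=> ->; rewrite mulr_sumr; apply: eq_bigr => i _.
  rewrite horner_prod; under eq_bigr do rewrite hornerXsubC.
  rewrite /cauchy_num !prodf_div.
  have DD : (a i - d i) * \prod_(m | m != i) (a i - d m) =
            (a i - d j) * \prod_(m | m != j) (a i - d m).
    by transitivity (\prod_m (a i - d m)); [rewrite [RHS](bigD1 i)|rewrite (bigD1 j)].
  have AA : A = (d l - a i) * \prod_(m | m != i) (d l - a m) by rewrite /A (bigD1 i).
  have g0 : \prod_(m | m != i) (a i - a m) != 0 by apply/prodf_neq0 => m /aa.
  rewrite [(a i - d i) * _]mulrA DD AA.
  have := interl_ad i j; have := interl_ad i l => h1 h2.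
  field.
  by rewrite g0 h1 h2.
case: (eqVneq j l) => [->|jl]; last first.
  rewrite (bigD1 l) 1?eq_sym//= subrr mul0r mul0r => /esym/eqP.
  by rewrite mulf_eq0 oppr_eq0 (negbTE A0) => /eqP.
rewrite mul1r /cauchy_den prodf_div => ->.
have AA : A = (d l - a l) * \prod_(m | m != l) (d l - a m) by rewrite /A (bigD1 l).
have := A0; rewrite AA mulf_eq0 negb_or => /andP[_ g0].
have := interl_ad l l => h1; have := da l => h2.
by field; rewrite g0 h1.
Qed.

Lemma cauchy_norm (y : 'I_n -> C) :
  \sum_i cauchy_num i * normc (\sum_j ((a i - d j)^-1)%:C * y j) ^+ 2 =
  \sum_j cauchy_den j * normc (y j) ^+ 2.
Proof.
pose c i j : C := ((a i - d j)^-1)%:C.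
have inj (u v : R) : u%:C = v%:C :> C -> u = v by move=> [].
have RM (u v : R) : (u * v)%:C = u%:C * v%:C :> C by exact: rmorphM.
apply: inj; rewrite !rmorph_sum /=.
transitivity (\sum_j \sum_l (y j * (y l)^* *
    \sum_i (cauchy_num i * ((a i - d j)^-1 * (a i - d l)^-1))%:C)).
  under [RHS]eq_bigr => j _ do under eq_bigr => l _ do rewrite mulr_sumr.
  under [RHS]eq_bigr => j _ do rewrite exchange_big.
  rewrite exchange_big; apply: eq_bigr => i _ /=.
  rewrite RM -mulcJ conjc_sum mulr_suml mulr_sumr; apply: eq_bigr => j _.
  rewrite mulr_sumr mulr_sumr; apply: eq_bigr => l _.
  rewrite conjcM conjcR !RM; ring.
have E j l : \sum_i (cauchy_num i * ((a i - d j)^-1 * (a i - d l)^-1))%:C =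
    ((j == l)%:R * cauchy_den j)%:C :> C by rewrite -cauchy_gram rmorph_sum.
apply: eq_bigr => j _.
rewrite (eq_bigr (fun l => y j * (y l)^* * ((j == l)%:R * cauchy_den j)%:C)); last first.
  by move=> l _; rewrite E.
rewrite (bigD1 j)//= eqxx mul1r big1 => [|l lj].
  by rewrite addr0 mulcJ mulrC [RHS]RM.
by rewrite eq_sym (negbTE lj) mul0r mulr0.
Qed.

Definition den_norm (y : 'cV[C]_n) : R := \sum_i cauchy_den i * normc (y i 0) ^+ 2.

Lemma den_norm_ge i (y : 'cV[C]_n) : cauchy_den i * normc (y i 0) ^+ 2 <= den_norm y.
Proof.
rewrite /den_norm (bigD1 i)//= lerDl; apply: sumr_ge0 => j _.
by rewrite mulr_ge0 ?sqr_ge0// ltW// cauchy_den_gt0.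
Qed.

Lemma den_norm_eq0 (y : 'cV[C]_n) : den_norm y <= 0 -> y = 0.
Proof.
move=> y0; apply/colP => i; rewrite mxE; apply/eqP; rewrite -normc_eq0 -sqrf_eq0.
have := le_trans (den_norm_ge i y) y0.
by rewrite pmulr_rle0 ?cauchy_den_gt0// => h; rewrite eq_le h sqr_ge0.
Qed.

(** A kernel vector has weighted norm 0, by the isometry [cauchy_norm]. *)
Lemma det_cauchy : \det (\matrix_(i, j) ((a i - d j)^-1)%:C : 'M[C]_n) != 0.
Proof.
apply/negP; rewrite -det_tr => /det0P[v v0 /(congr1 trmx)].
rewrite trmx_mul trmxK trmx0 => e.
have vT : v^T = 0.
  apply: den_norm_eq0; rewrite /den_norm -(cauchy_norm (fun j => v^T j 0)).
  rewrite big1 // => i _.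
  rewrite (_ : \sum_j _ = 0) ?normc0 ?expr0n ?mulr0//.
  by move/matrixP/(_ i 0): e; rewrite !mxE => e; rewrite -[RHS]e; apply: eq_bigr => j _; rewrite !mxE.
by move: v0; rewrite -[v]trmxK vT trmx0 eqxx.
Qed.

Section Contraction.
Context (g : 'I_n -> C) (theta : R).
Hypothesis g_le : forall i, cauchy_den i * normc (g i) ^+ 2 <= theta * cauchy_num i.

Definition scaled_cauchy : 'M[C]_n := \matrix_(i, j) (g i * ((a i - d j)^-1)%:C).

Lemma scaled_cauchy_contr (y : 'cV[C]_n) :
  den_norm (scaled_cauchy *m y) <= theta * den_norm y.
Proof.
rewrite /den_norm -(cauchy_norm (fun j => y j 0)) mulr_sumr; apply: ler_sum => i _.
rewrite mxE (eq_bigr (fun j => g i * (((a i - d j)^-1)%:C * y j 0))); last first.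
  by move=> j _; rewrite mxE mulrA.
by rewrite -mulr_sumr normcM exprMn [leLHS]mulrA [leRHS]mulrA ler_wpM2r ?sqr_ge0 ?g_le.
Qed.

Hypotheses (theta_ge0 : 0 <= theta) (theta_lt1 : theta < 1).

(** A kernel vector would be a fixed point of a strict contraction. *)
Lemma det_scaled_cauchy : \det (1 - scaled_cauchy) != 0.
Proof.
apply/negP; rewrite -det_tr => /det0P[v v0 /(congr1 trmx)].
rewrite trmx_mul trmxK trmx0 mulmxBl mul1mx => /eqP; rewrite subr_eq0 => /eqP e.
have := scaled_cauchy_contr v^T; rewrite -e -subr_ge0 -{2}[den_norm _]mul1r -mulrBl.
rewrite nmulr_rge0 ?subr_lt0// => /den_norm_eq0 vT.
by move: v0; rewrite -[v]trmxK vT trmx0 eqxx.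
Qed.

Lemma scaled_cauchyX_contr Q (y : 'cV[C]_n) :
  den_norm (scaled_cauchy ^+ Q *m y) <= theta ^+ Q * den_norm y.
Proof.
elim: Q y => [|Q IH] y; first by rewrite !expr0 mul1mx mul1r.
rewrite exprS -mulmxE -mulmxA exprS -mulrA.
by apply: le_trans (scaled_cauchy_contr _) _; rewrite ler_wpM2l.
Qed.

Lemma scaled_cauchyX_entry Q i j :
  normc ((scaled_cauchy ^+ Q) i j) ^+ 2 <= theta ^+ Q * (cauchy_den j / cauchy_den i).
Proof.
have := le_trans (den_norm_ge i _) (scaled_cauchyX_contr Q (delta_mx j 0)).
rewrite -colE mxE => h.
rewrite mulrA ler_pdivlMr ?cauchy_den_gt0// mulrC; apply: le_trans h _.
rewrite ler_wpM2l ?exprn_ge0// /den_norm (bigD1 j)//= mxE !eqxx normc1 expr1n mulr1.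
by rewrite big1 ?addr0// => k kj; rewrite mxE (negbTE kj) normc0 expr0n mulr0.
Qed.

End Contraction.

End CauchyMatrix.

(** * Continuity of the determinant at the identity, with uniform estimates *)

Section DetNear1.
Context {R : realType}.
Local Notation C := R[i].

Lemma prod_near (I : Type) (r : seq I) : exists2 c : R, 0 <= c &
  forall (x y : I -> C) (eta : R), 0 <= eta <= 1 -> (forall i, normc (y i) <= 1) ->
  (forall i, normc (x i - y i) <= eta) ->
  normc (\prod_(i <- r) x i - \prod_(i <- r) y i) <= c * eta.
Proof.
elim: r => [|i r [c c0 IH]].
  by exists 0 => // x y eta _ _ _; rewrite !big_nil subrr normc0 mul0r.
exists (2 * c + 1) => [|x y eta eta01 y1 xy]; first lra.
have /andP[eta0 eta1] := eta01.
rewrite !big_cons; set px := \prod_(_ <- _) x _; set py := \prod_(_ <- _) y _.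
have -> : x i * px - y i * py = x i * (px - py) + (x i - y i) * py by ring.
apply: le_trans (normcD _ _) _; rewrite !normcM.
have xi : normc (x i) <= 2.
  rewrite -(subrK (y i) (x i)); apply: le_trans (normcD _ _) _.
  have := y1 i; have := xy i; lra.
have py1 : normc py <= 1.
  by rewrite normc_prod; apply: prodr_ile1 => j _; rewrite normc_ge0 y1.
rewrite mulrDl -mulrA mul1r; apply: lerD.
  by apply: ler_pM; rewrite ?normc_ge0//; exact: IH.
by rewrite -[leRHS]mulr1; apply: ler_pM; rewrite ?normc_ge0.
Qed.

Lemma det_near1 n (e : R) : 0 < e -> exists2 eta : R, 0 < eta &
  forall A : 'M[C]_n, (forall i j, normc (A i j) <= eta) ->
  normc (\det (1%:M - A) - 1) <= e.
Proof.
move=> e0; have [c c0 hc] := prod_near (index_enum 'I_n).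
pose K := #|[set: 'S_n]%SET|%:R * c.
have K0 : 0 <= K by rewrite mulr_ge0.
exists (Num.min 1 (e / (K + 1))).
  by rewrite lt_min ltr01 divr_gt0// ltr_wpDl.
move=> A hA; set eta := Num.min _ _ in hA.
have eta0 : 0 <= eta.
  by rewrite le_min ler01 divr_ge0// ?(ltW e0)// ltW// ltr_wpDl.
have eta1 : eta <= 1 by rewrite ge_min lexx.
rewrite -[X in _ - X](det1 C n) /determinant -sumrB.
apply: le_trans (normc_sum _ _ _) _.
apply: (@le_trans _ _ (\sum_(s : 'S_n) c * eta)); last first.
  rewrite sumr_const -cardsT -mulr_natl mulrA -[_ * c]/K.
  apply: (@le_trans _ _ (K * (e / (K + 1)))).
    by rewrite ler_wpM2l// ge_min lexx orbT.
  rewrite mulrA ler_pdivrMr ?ltr_wpDl// mulrC ler_wpM2l ?(ltW e0)//; lra.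
apply: ler_sum => s _; rewrite -mulrBr normcM.
have -> : normc ((-1) ^+ s : C) = 1 by rewrite normcXE normcNE normc1 expr1n.
rewrite mul1r; apply: hc => [|i|i]; first by rewrite eta0.
- by rewrite mxE; case: eqP => _; rewrite ?mulr1n ?mulr0n ?normc1 ?normc0 ?ler01.
- by rewrite !mxE addrAC subrr add0r normcNE.
Qed.

End DetNear1.

(** * Periodic exponential sums *)

(** For the fractional part r of l, cos (2 pi r) = 1 forces sin (pi r) = 0, which is impossible for
    0 < r < 1. *)
Lemma expi_2pi_eq1 (R : realType) (l : R) : 0 <= l -> expi (l * (2 * pi)) = 1 ->
  l = (Num.truncn l)%:R.
Proof.
move=> l0 e; set m := Num.truncn l; pose r := l - m%:R.
have r0 : 0 <= r by rewrite subr_ge0 truncn_le.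
have r1 : r < 1 by rewrite ltrBlDl natr1 truncnS_gt.
apply/eqP; rewrite -subr_eq0 -/r; apply: contraT => rn0.
have rp : 0 < r by rewrite lt_def rn0.
have : expi ((pi * r) *+ 2) = 1.
  have -> : (pi * r) *+ 2 = l * (2 * pi) + - (m%:R * (2 * pi)) by rewrite /r; ring.
  have h0 : expi (m%:R * (2 * pi) : R) = 1.
    rewrite mulr_natl expiMn.
    by rewrite -[X in expi X]add0r expi_period expi0 expr1n.
  by rewrite expiD e expiN h0 mul1r rmorph1.
move=> /(congr1 (@complex.Re R)) /=; rewrite cos_mulr2n => c1.
have : 0 < sin (pi * r).
  apply: sin_gt0_pi; rewrite mulr_gt0 ?pi_gt0//=.
  by rewrite -[ltRHS]mulr1 ltr_pM2l ?pi_gt0.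
have := cos2Dsin2 (pi * r) => c2 s0.
have : sin (pi * r) ^+ 2 = 0 by lra.
by move/eqP; rewrite sqrf_eq0 gt_eqF.
Qed.

Section PeriodicExponentialSum.
Context {R : realType}.
Local Notation C := R[i].

Lemma xsum_der_trans h (L : seq (C * R)) x y :
  xsum (xder (xtrans h L)) x y = xsum (xder L) (x + h) y.
Proof.
rewrite /xsum /xder /xtrans /xscale !big_map; apply: eq_bigr => p _ /=.
rewrite mulrDr expiD; ring.
Qed.

Lemma xsum_scale1 k (L : seq (C * R)) x y : xsum (xmul [:: (k, 0)] L) x y = k * xsum L x y.
Proof. by rewrite xsum_mul xsum_cons /(xsum [::]) big_nil /= !mul0r expR0 expi0 !mulr1 addr0. Qed.

Local Notation neg := (fun l : R => l < 0).
Local Notation npos := (fun l : R => l <= 0).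

Context (L : seq (C * R)).
Hypothesis L_neg : freq_in neg L.

Let f : seq (C * R) := (1, 0) :: L.

Let f_npos : freq_in npos f.
Proof. by rewrite /= lexx; apply: sub_all L_neg => p; exact: ltW. Qed.

Local Notation nu x y := (1 + xsum L x y).

Lemma xsum_unit x y : xsum f x y = nu x y.
Proof. by rewrite xsum_cons /= !mul0r expR0 expi0 !mulr1. Qed.

Lemma xsum_der_unit x y : xsum (xder f) x y = xsum (xder L) x y.
Proof. by rewrite /xder /= xsum_cons /= !mulr0 !mul0r add0r. Qed.

Context (h : R) (g : seq (C * R)).
Hypotheses (g_npos : freq_in npos g)
  (nu_neq0 : forall x, nu x 0 != 0)
  (nu_inv : forall x, normc (nu x 0 * xsum g x 0 - 1) <= 8^-1)
  (log_der_per : forall x, Im (xsum (xder L) (x + h) 0 / nu (x + h) 0) =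
                           Im (xsum (xder L) x 0 / nu x 0)).

(** The difference nu(x + h) - nu(x), whose vanishing is the goal. All its frequencies are negative,
    since the constant 1 cancels. *)
Let om := xtrans h L ++ xmul [:: (-1, 0)] L.

(* nu(x) nu'(x + h) - nu'(x) nu(x + h), expressed through nu(x + h) - nu(x) *)
Let wr := xmul f (xder om) ++ xmul [:: (-1, 0)] (xmul (xder L) om).

Let om_neg : freq_in neg om.
Proof.
rewrite freq_in_cat freq_in_xscale L_neg /=.
apply: (@freq_in_xmul _ (pred1 0) neg) => //= [a b /eqP ->|]; last by rewrite eqxx.
by rewrite add0r.
Qed.

Let wr_neg : freq_in neg wr.
Proof.
rewrite freq_in_cat; apply/andP; split.
  apply: (freq_in_xmul (P := npos) (Q := neg)) => //.
    by move=> a b /= *; lra.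
  by rewrite freq_in_xscale.
apply: (@freq_in_xmul _ (pred1 0) neg) => //= [a b /eqP ->||].
- by rewrite add0r.
- by rewrite eqxx.
apply: (freq_in_xmul (P := neg) (Q := neg)) => //.
  by move=> a b /= *; lra.
by rewrite freq_in_xscale.
Qed.

Let wr_sum x : xsum wr x 0 =
  xsum (xder L) (x + h) 0 * nu x 0 - xsum (xder L) x 0 * nu (x + h) 0.
Proof.
have om1 : xsum om x 0 = xsum L (x + h) 0 - xsum L x 0.
  by rewrite xsum_cat xsum_trans xsum_scale1 mulN1r.
have om2 : xsum (xder om) x 0 = xsum (xder L) (x + h) 0 - xsum (xder L) x 0.
  rewrite /xder /xscale map_cat xsum_cat xsum_der_trans; congr (_ + _).
  rewrite -[RHS]mulN1r -xsum_scale1; apply: (@xsum_eq _ (xder _) (xmul _ (xder _))) => mu.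
  by rewrite xcoef_scale !xcoef_term subr0 xcoef_scale mulrA.
rewrite xsum_cat xsum_scale1 !xsum_mul xsum_unit om1 om2; ring.
Qed.

(** The logarithmic derivatives at x and x + h have equal imaginary parts, so wr = r nu(x) nu(x + h)
    with r real. Multiplied by the approximate inverses g(x) and g(x + h) it becomes a = r w with w
    close to 1. All frequencies of a are negative, so a^2 has mean 0, whereas Re a^2 is at least a
    positive multiple of r^2 and so dominates |wr|^2. *)
Let wr0 mu : xcoef wr mu = 0.
Proof.
pose a := xmul wr (xmul g (xtrans h g)).
have a_neg : freq_in neg a.
  apply: (freq_in_xmul (P := neg) (Q := npos)) => //.
    by move=> u v /= *; lra.
  apply: (freq_in_xmul (P := npos) (Q := npos)) => //.
    by move=> u v /= *; lra.
  by rewrite freq_in_xscale.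
have [B B0 hB] := xsum_bound f.
apply: (@xcoef_dominated _ wr (xmul a a) (B ^+ 4 * (5 / 2))).
- by rewrite mulr_ge0 ?exprn_ge0//; lra.
- apply: (xcoef_out (P := neg)); last by rewrite ltxx.
  apply: (freq_in_xmul (P := neg) (Q := neg)) => //.
  by move=> u v /= *; lra.
move=> x.
set p := nu x 0; set q := nu (x + h) 0.
have p0 : p != 0 by exact: nu_neq0.
have q0 : q != 0 by exact: nu_neq0.
have [r hr] : exists r : R, xsum wr x 0 = r%:C * (p * q).
  exists (Re (xsum (xder L) (x + h) 0 / q - xsum (xder L) x 0 / p)).
  rewrite wr_sum -/p -/q; set z := _ / q - _ / p.
  have -> : (Re z)%:C = z.
    apply: complex_eqP => //=; rewrite /z ImD ImN -/p -/q.
    by have := log_der_per x; rewrite -/p -/q => ->; rewrite subrr.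
  by rewrite /z; field; rewrite p0 q0.
pose w := (p * xsum g x 0) * (q * xsum g (x + h) 0).
have ea : xsum (xmul a a) x 0 = (r ^+ 2)%:C * w ^+ 2.
  rewrite !xsum_mul xsum_trans hr /w rmorphXn /=; ring.
(* Two errors of 1/8 combine to 1/8 + 1/8 + 1/64 <= 3/10, whence Re w^2 >= (7/10)^2 - (3/10)^2 =
   2/5. *)
have hw : normc (w - 1) <= 3 / 10.
  set e1 := p * xsum g x 0 - 1; set e2 := q * xsum g (x + h) 0 - 1.
  have n1 : normc e1 <= 8^-1 by exact: nu_inv.
  have n2 : normc e2 <= 8^-1 by exact: nu_inv.
  have -> : w - 1 = e1 + e2 + e1 * e2 by rewrite /w /e1 /e2; ring.
  apply: le_trans (normcD _ _) _; apply: le_trans (lerD (normcD _ _) (lexx _)) _.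
  have : normc e1 * normc e2 <= 8^-1 * 8^-1 by apply: ler_pM; rewrite ?normc_ge0.
  rewrite normcM; lra.
have rw : 2 / 5 <= Re (w ^+ 2).
  move: (w) hw => z hz; have := le_trans (normc_Re _) hz; have := le_trans (normc_Im _) hz.
  rewrite ReD ImD ReN ImN /= subr0 expr2 ReM !ler_norml => /andP[i1 i2] /andP[r1 r2].
  nra.
rewrite ea ReZ hr !normcM normcR exprMn real_normK ?num_real//.
have hp : normc p <= B by rewrite /p -xsum_unit.
have hq : normc q <= B by rewrite /q -xsum_unit.
have pq : (normc p * normc q) ^+ 2 <= B ^+ 4.
  rewrite exprMn (_ : 4 = 2 + 2)%N// exprD; apply: ler_pM; rewrite ?sqr_ge0//.
    by rewrite ler_pXn2r// nnegrE normc_ge0.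
  by rewrite ler_pXn2r// nnegrE normc_ge0.
apply: (@le_trans _ _ (r ^+ 2 * B ^+ 4)); first by rewrite ler_wpM2l ?sqr_ge0.
rewrite [leRHS](_ : _ = r ^+ 2 * B ^+ 4 * (5 / 2 * Re (w ^+ 2))); last by ring.
move: rw; move: (Re (w ^+ 2)) => X hX.
by apply: ler_peMr; [rewrite mulr_ge0 ?sqr_ge0 ?exprn_ge0|lra].
Qed.

(** Suppose not, and let m < 0 be the largest frequency of [om]. In nu om' - nu' om the frequency m
    arises only from 1 times om', every other product adding a negative frequency to one that is at
    most m. Its coefficient, i m times that of [om], would be nonzero. *)
Let om0 mu : xcoef om mu = 0.
Proof.
apply/eqP; apply: contraT => m0.
have mem nuu : xcoef om nuu != 0 -> exists i : 'I_(size om), (nth (0, 0) om i).2 = nuu.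
  move=> n0; have : nuu \in map snd om.
    apply: contraR n0 => n0; rewrite (@xcoef_out _ (mem (map snd om)))//.
    by apply/allP => p pom; apply: map_f.
  move=> /mapP[p /(nthP (0, 0))[i iL <-] ->]; by exists (Ordinal iL).
have [i0 hi0] := mem _ m0.
have Pi0 : xcoef om (nth (0, 0) om i0).2 != 0 by rewrite hi0.
case: (@Order.TotalTheory.arg_maxP _ _ _ i0 (fun i : 'I_(size om) => xcoef om (nth (0, 0) om i).2 != 0)
   (fun i => (nth (0, 0) om i).2) Pi0) => k ck kmax.
set m := (nth (0, 0) om k).2 in ck kmax.
have m_neg : m < 0.
  by apply: contraR ck => nm; apply/eqP; exact: (xcoef_out (P := neg) om_neg).
have big_eq0 l : m < l -> xcoef om l = 0.
  move=> ml; apply/eqP; apply: contraT => /[dup] c0 /mem[i hi].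
  by have := kmax i; rewrite hi => /(_ c0); rewrite /= leNgt ml.
have := wr0 m.
rewrite xcoef_cat xcoef_term subr0 !xcoef_mul big_cons /= subr0 mul1r xcoef_scale.
rewrite big_seq big1 => [|p pL]; last first.
  have pn := allP L_neg _ pL.
  by rewrite xcoef_scale big_eq0 ?mul0r ?mulr0//; move: pn => /=; lra.
rewrite big_seq big1 => [|p pL]; last first.
  have pn : p.2 < 0 by move: p pL; apply/allP; rewrite -/(freq_in neg _) freq_in_xscale.
  by rewrite big_eq0 ?mulr0//; move: pn => /=; lra.
rewrite mulr0 !addr0 => /eqP; rewrite !mulf_eq0 (negbTE ck) orFb => /orP[/eqP/(congr1 (@complex.Im R))/=|/eqP/(congr1 (@complex.Re R))/=].
  by move/eqP; rewrite oner_eq0.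
by move=> e; move: m_neg; rewrite e ltxx.
Qed.

Lemma xcoef_periodic mu : xcoef L mu != 0 -> expi (mu * h) = 1.
Proof.
move=> c0; have := om0 mu; rewrite xcoef_cat xcoef_scale xcoef_term subr0 mulN1r.
rewrite -{2}[xcoef L mu]mulr1 -mulrBr => /eqP; rewrite mulf_eq0 (negbTE c0) subr_eq0.
by move/eqP.
Qed.

End PeriodicExponentialSum.

(** * Integer frequencies: polynomials in e^{-ix} without zeros in the disc *)

Section IntegerFrequencies.
Context {R : realType}.
Local Notation C := R[i].

Lemma expi_neg_nat m (x : R) : expi (- m%:R * x) = (expi x)^* ^+ m.
Proof. by rewrite -expiN -expiMn mulNr mulr_natl mulNrn. Qed.

Lemma xsum_poly (L : seq (C * R)) : freq_in (fun l => l < 0) L ->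
  (forall mu, xcoef L mu != 0 -> exists m : nat, mu = - m%:R) ->
  exists T : {poly C}, [/\ T.[0] = 1,
    forall x y, 1 + xsum L x y = T.[(expR (- y))%:C * (expi x)^*] &
    forall x, xsum (xder L) x 0 = - 'i * (expi x)^* * T^`().[(expi x)^*]].
Proof.
move=> L_neg L_int; pose f : seq (C * R) := (1, 0) :: L.
pose N := (\sum_(p <- L) (Num.truncn (- p.2)).+1)%N.
pose T := \poly_(m < N.+1) xcoef f (- m%:R).
pose g : seq (C * R) := [seq (xcoef f (- m%:R), - m%:R) | m <- index_iota 0 N.+1].
have f0 : xcoef f 0 = 1.
  by rewrite xcoef_cons /= eqxx (xcoef_out (P := fun l : R => l < 0))// ?ltxx// addr0.
have f_int mu : xcoef f mu != 0 -> exists2 m : nat, mu = - m%:R & (m < N.+1)%N.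
  rewrite xcoef_cons /=; case: (eqVneq 0 mu) => [<- _|_]; first by exists 0%N; rewrite ?oppr0.
  rewrite add0r => c0; have [m em] := L_int _ c0; exists m => //.
  have : mu \in map snd L.
    by apply: contraR c0 => nm; rewrite (xcoef_out (P := mem (map snd L)))//; apply/allP => p; exact: map_f.
  move=> /mapP[p pL ep]; rewrite ltnS /N (big_rem p)//=.
  by rewrite -ep em opprK natrK; lia.
have gf mu : xcoef g mu = xcoef f mu.
  rewrite /xcoef big_map -/(xcoef f mu) /=.
  case: (eqVneq (xcoef f mu) 0) => [e|/f_int[m em mN]].
    by rewrite e; apply: big1 => m /eqP ->.
  rewrite big_mkord (bigD1 (Ordinal mN)) ?em//= big1 ?addr0// => i /andP[/eqP/oppr_inj/eqP].
  by rewrite eqr_nat => /eqP e; rewrite -val_eqE /= e eqxx.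
have sumf x y : xsum f x y = 1 + xsum L x y by rewrite xsum_cons /= !mul0r expR0 expi0 !mulr1.
exists T; split.
- by rewrite horner_coef0 coef_poly /= oppr0.
- move=> x y; rewrite -sumf -(xsum_eq gf) horner_poly /xsum big_map big_mkord.
  apply: eq_bigr => m _ /=.
  have -> : expR (- m%:R * y) = expR (- y) ^+ m by rewrite -expRM_natl mulrN mulNr.
  by rewrite rmorphXn expi_neg_nat exprMn mulrA.
move=> x.
have -> : xsum (xder L) x 0 = xsum (xder g) x 0.
  rewrite [RHS](@xsum_eq _ (xder g) (xder f)) => [|mu]; last by rewrite !xcoef_scale gf.
  by rewrite /xder /= xsum_cons /= !mulr0 !mul0r add0r.
rewrite /T poly_def raddf_sum horner_sum mulr_sumr /xsum !big_map big_mkord.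
apply: eq_bigr => m _ /=; rewrite derivZ derivXn hornerZ hornerMn hornerXn.
rewrite mulr0 expR0 mulr1 expi_neg_nat rmorphN rmorph_nat.
case: (val m) => [|k]; first by rewrite mulr0n !(mulr0, mul0r, oppr0).
by rewrite exprS -mulr_natr /=; ring.
Qed.

(** The p are the inverses of the roots, with multiplicity; the formula is the logarithmic
    derivative of prod (1 - p W). *)
Lemma poly_unit_disc (T : {poly C}) : T.[0] = 1 ->
  (forall W, normc W <= 1 -> T.[W] != 0) -> (1 < size T)%N ->
  exists ps : seq C, [/\ ps != [::], forall p, p \in ps -> p != 0 /\ normc p < 1 &
    forall W, T.[W] != 0 -> T^`().[W] / T.[W] = - \sum_(p <- ps) p / (1 - p * W)].
Proof.
move=> T0 T_disc sT.
have [rs eT] := closed_field_poly_normal T.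
pose c := lead_coef T; have c0 : c != 0 by rewrite lead_coef_eq0 -size_poly_gt0 (ltn_trans _ sT).
have root_T r : r \in rs -> T.[r] = 0.
  by move=> rrs; apply/eqP; rewrite eT hornerZ mulf_eq0 -/(root _ _) root_prod_XsubC rrs orbT.
exists (map (fun r => r^-1) rs); split.
- apply: contraTneq sT => /eqP; rewrite -size_eq0 size_map => /eqP/size0nil e.
  by rewrite eT e big_nil -leqNgt size_scale// size_poly1.
- move=> p /mapP[r rrs ->]; have rT := root_T _ rrs.
  have r1 : 1 < normc r.
    by rewrite ltNge; apply/negP => /T_disc; rewrite rT eqxx.
  have r0 : r != 0 by rewrite -normc_gt0 (lt_trans _ r1).
  by rewrite invr_neq0// normcV invf_lt1// (lt_trans _ r1).
move=> W; rewrite eT derivZ !hornerZ mulf_eq0 negb_or => /andP[_].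
rewrite invfM mulrACA divff// mul1r big_map.
have : forall r, r \in rs -> r != 0.
  move=> r rrs; apply: contra_eq_neq (root_T _ rrs) => ->; by rewrite T0 oner_eq0.
elim: rs {eT root_T} => [|r rs IH] h.
  by rewrite !big_nil derivC horner0 mul0r oppr0.
rewrite !big_cons derivM !hornerE derivXsubC hornerC mul1r mulf_eq0 negb_or => /andP[h1 h2].
have r0 : r != 0 by apply: h; rewrite mem_head.
have {}IH := IH (fun s hs => h s (mem_behead (s := r :: rs) hs)) h2.
rewrite opprD -IH.
have rW : r - W != 0 by rewrite -opprB oppr_eq0.
have -> : r^-1 / (1 - r^-1 * W) = (r - W)^-1.
  by rewrite -[X in _ / (X - _)](mulVf r0) -mulrBr invfM invrK mulrA mulVf// mul1r.
by field; rewrite h1 h2 rW.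
Qed.

End IntegerFrequencies.

(** * Structure of multi-phase solutions *)

Lemma expi_polar (R : realType) (u : R[i]) : normc u = 1 -> exists x, u = expi x.
Proof.
move=> u1; have : Re u ^+ 2 + Im u ^+ 2 = 1 by rewrite -sqr_normcE u1 expr1n.
case: u {u1} => a b /= ab.
have a1 : -1 <= a <= 1 by apply/andP; split; nra.
have s : Num.sqrt (1 - a ^+ 2) = `|b|.
  by rewrite -ab addrAC subrr add0r sqrtr_sqr.
case: (lerP 0 b) => b0.
  by exists (acos a); rewrite /expi acosK ?in_itv// sin_acos// s ger0_norm.
by exists (- acos a); rewrite /expi cosN sinN acosK ?in_itv// sin_acos// s ltr0_norm// opprK.
Qed.

Lemma cst_xsum_mx_exp (R : realType) (P : pred R) n (A : R -> R -> 'M[R[i]]_n) (c : 'M[R[i]]_n) m :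
  (forall a b, P a -> P b -> P (a + b)) ->
  (forall i j, cst_xsum P (c i j) (fun x y => A x y i j)) ->
  forall i j, cst_xsum P ((c ^+ m) i j) (fun x y => (A x y ^+ m) i j).
Proof.
move=> P_add hA; elim: m => [|m IH] i j; first by rewrite expr0; exact: cst_xsum_cst.
rewrite exprS mxE.
apply: (@cst_xsum_ext _ _ _ (fun x y => \sum_k A x y i k * (A x y ^+ m) k j)).
  by move=> x y; rewrite exprS mxE.
by apply: cst_xsum_sum => k; apply: cst_xsumM.
Qed.

Lemma xsum_der_term (R : realType) (k : R[i]) (l : R) (L : seq (R[i] * R)) x y :
  xsum (xder (xmul [:: (k, l)] L)) x y =
  k * (expR (l * y))%:C * expi (l * x) * ('i * l%:C * xsum L x y + xsum (xder L) x y).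
Proof.
rewrite /xder /xscale /xmul /= cats0 /xsum !big_map mulrDr !mulr_sumr -big_split /=.
apply: eq_bigr => p _ /=; rewrite !mulrDl expRD expiD !rmorphD !rmorphM; ring.
Qed.

Section MultiPhaseStructure.
Context {R : realType}.
Local Notation C := R[i].
Context (eps : R) (n : nat) (su : 'I_n.+1 -> R) (sd chi : 'I_n -> R) (t : R).
Hypotheses (eps_gt0 : 0 < eps) (n_gt0 : (0 < n)%N) (s_ord : interlaced su sd)
  (v_per : forall x, multi_phase eps su sd chi (x + 2 * pi) t = multi_phase eps su sd chi x t).

Local Notation a := (sup_prev su).
Local Notation s0 := (su ord_max).

Let su_dec (i j : 'I_n.+1) : (i <= j)%N -> su j <= su i.
Proof.
case: i j => i hi [j hj] /= ij; elim: j hj ij => [|j IH] hj.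
  by rewrite leqn0 => /eqP i0; rewrite le_eqVlt; apply/orP; left; apply/eqP; congr su; apply: val_inj.
rewrite leq_eqVlt => /predU1P[ij|ij].
  by rewrite le_eqVlt; apply/orP; left; apply/eqP; congr su; apply: val_inj; rewrite /= ij.
have hj' : (j < n)%N by [].
apply: le_trans (IH (ltnW hj) ij); have /andP[h1 h2] := s_ord (Ordinal hj').
have e1 : sup_prev su (Ordinal hj') = su (Ordinal (ltnW hj)) by congr su; exact: val_inj.
have e2 : sup_next su (Ordinal hj') = su (Ordinal hj) by congr su; exact: val_inj.
by rewrite -e1 -e2 ltW// (lt_trans h1 h2).
Qed.

Let d_lt i : sd i < a i.
Proof. by case/andP: (s_ord i). Qed.

Let a_lt (i j : 'I_n) : (i < j)%N -> a j < sd i.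
Proof. by move=> ij; case/andP: (s_ord i) => h _; apply: le_lt_trans h; exact: su_dec. Qed.

Let s0_lt i : s0 < sd i.
Proof.
case/andP: (s_ord i) => h _; apply: le_lt_trans h; apply: su_dec.
by rewrite /= /bump leq0n add1n.
Qed.

Let k_gt0 i : 0 < a i - sd i. Proof. by rewrite subr_gt0. Qed.

Local Notation Z := (phase_Z su sd).

Lemma phase_arg_gt0 (i j : 'I_n) : j != i ->
  0 < ((sd i - sd j) * (a i - a j)) / ((a i - sd j) * (sd i - a j)).
Proof.
move=> /interl_neq[ij|ij].
  rewrite divr_gt0// mulr_gt0// subr_gt0 ?(interl_dd d_lt a_lt)// ?(interl_aa d_lt a_lt)// ?a_lt//.
  exact: lt_trans (interl_dd d_lt a_lt ij) (d_lt i).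
rewrite -[X in X / _]mulrNN -[X in _ / X]mulrNN !opprB.
rewrite divr_gt0// mulr_gt0// subr_gt0 ?(interl_dd d_lt a_lt)// ?(interl_aa d_lt a_lt)// ?a_lt//.
exact: lt_trans (d_lt i) (interl_aa d_lt a_lt ij).
Qed.

Lemma phase_Z_gt0 i : 0 < Z i.
Proof.
rewrite /phase_Z mulr_gt0//.
  by rewrite sqrtr_gt0 divr_gt0 ?subr_gt0// (lt_trans (s0_lt i)).
by apply: prodr_gt0 => j ji; rewrite sqrtr_gt0 phase_arg_gt0.
Qed.

(** The origin of Z_i: apart from the first factor, (Z_i / (a_i - d_i))^2 is exactly the ratio of
    the weights [cauchy_den] and [cauchy_num], so that dividing the rows of the Cauchy matrix by Z_i
    / (a_i - d_i) preserves [den_norm]. *)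
Lemma phase_Z_cauchy i : Z i ^+ 2 * cauchy_num a sd i / (a i - sd i) ^+ 2 =
  (a i - s0) / (sd i - s0) * cauchy_den a sd i.
Proof.
rewrite /phase_Z exprMn sqr_sqrtr; last first.
  by rewrite divr_ge0// ltW// subr_gt0// (lt_trans (s0_lt i)).
have sq : (\prod_(j < n | j != i) Num.sqrt (((sd i - sd j) * (a i - a j)) /
      ((a i - sd j) * (sd i - a j)))) ^+ 2 =
    \prod_(j < n | j != i) (((sd i - sd j) / (sd i - a j)) * ((a i - a j) / (a i - sd j))).
  rewrite -prodrXl; apply: eq_bigr => j ji; rewrite sqr_sqrtr; last first.
    have := phase_arg_gt0 ji; exact: ltW.
  by rewrite [X in _ / X]mulrC -mulf_div.
have ne : \prod_(j < n | j != i) ((a i - a j) / (a i - sd j)) *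
    \prod_(j | j != i) ((a i - sd j) / (a i - a j)) = 1.
  rewrite -big_split big1// => j ji /=; rewrite mulrA divfK ?divff//.
    by rewrite subr_eq0 (inj_eq (interl_inj d_lt a_lt)) eq_sym.
  exact: interl_ad d_lt a_lt _ _.
rewrite sq big_split /= /cauchy_num /cauchy_den.
set p1 := \prod_(_ | _) (_ / _) in ne *; set p2 := \prod_(_ | _) (_ / _) in ne *.
have k0 : a i - sd i != 0 by rewrite gt_eqF.
have s1 : sd i - s0 != 0 by rewrite gt_eqF// subr_gt0.
rewrite -[RHS]mulr1 -ne.
field; by rewrite k0 s1.
Qed.

Local Notation kap := (fun i => (a i - sd i) / eps).
Local Notation D := (fun i => Z i / (a i - sd i)).
Local Notation ph := (fun i => expi (- (kap i * (chi i + 2^-1 * (sd i + a i) * t))) : C).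

Let kap_gt0 i : 0 < kap i. Proof. by rewrite divr_gt0. Qed.
Let D_gt0 i : 0 < D i. Proof. by rewrite divr_gt0 ?phase_Z_gt0. Qed.

(* [gain] is 1 / (D_i E_i) at the point x - i y, so that M = DE (1 - N). *)
Let gain x y i : C :=
  (D i)^-1%:C * (ph i)^* * (expR (- kap i * y))%:C * expi (- kap i * x).

Let N x y := scaled_cauchy a sd (gain x y).

Let theta := \big[Num.max/0]_i ((sd i - s0) / (a i - s0)).

Let theta_ge0 : 0 <= theta.
Proof. by rewrite /theta; elim/big_rec: _ => // i x _ x0; rewrite le_max x0 orbT. Qed.

Let theta_lt1 : theta < 1.
Proof.
rewrite /theta; elim/big_rec: _ => // i x _ x0; rewrite gt_max x0 andbT.
by rewrite ltr_pdivrMr ?mul1r ?subr_gt0 ?(lt_trans (s0_lt i))// ltrD2r.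
Qed.

Let gain_le x y : 0 <= y -> forall i,
  cauchy_den a sd i * normc (gain x y i) ^+ 2 <= theta * cauchy_num a sd i.
Proof.
move=> y0 i.
have as0 : 0 < a i - s0 by rewrite subr_gt0 (lt_trans (s0_lt i)).
have ds0 : 0 < sd i - s0 by rewrite subr_gt0.
have n0 := cauchy_num_gt0 d_lt a_lt i; have m0 := cauchy_den_gt0 d_lt a_lt i.
have g1 : normc (gain x y i) <= (D i)^-1.
  rewrite /gain !normcM normcJE !normc_expi !mulr1 !normcR.
  rewrite (gtr0_norm (x := expR _)) ?expR_gt0// gtr0_norm ?invr_gt0//.
  rewrite ler_piMr ?invr_ge0 ?(ltW (D_gt0 i))// -expR0 ler_expR mulNr oppr_le0.
  by rewrite mulr_ge0// ltW.
apply: (@le_trans _ _ (cauchy_den a sd i * (D i)^-1 ^+ 2)).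
  by rewrite ler_wpM2l ?(ltW m0)// lerXn2r// nnegrE ?normc_ge0// invr_ge0 ltW.
have -> : cauchy_den a sd i * (D i)^-1 ^+ 2 = (sd i - s0) / (a i - s0) * cauchy_num a sd i.
  have := phase_Z_cauchy i; have := phase_Z_gt0 i; have := k_gt0 i.
  move: (cauchy_num _ _ _) (cauchy_den _ _ _) (Z i) => u w z k0 z0 e.
  have -> : u = (a i - s0) / (sd i - s0) * w * (a i - sd i) ^+ 2 / z ^+ 2.
    by rewrite -e; field; rewrite !gt_eqF.
  by field; rewrite !gt_eqF.
by rewrite ler_wpM2r ?(ltW n0)// /theta le_bigmax.
Qed.

Let nu_neq0 x y : 0 <= y -> \det (1 - N x y) != 0.
Proof. by move=> /(gain_le x) h; exact: det_scaled_cauchy h _. Qed.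

Local Notation neg := (fun l : R => l < 0).

Let neg_add (u w : R) : neg u -> neg w -> neg (u + w).
Proof. by move=> /= *; lra. Qed.

Let N_xsum i j : cst_xsum neg 0 (fun x y => N x y i j).
Proof.
apply: (@cst_xsum_ext _ _ _ (fun x y => ((D i)^-1%:C * (ph i)^* * ((a i - sd j)^-1)%:C) *
   (expR (- kap i * y))%:C * expi (- kap i * x))).
  by move=> x y; rewrite mxE /gain; ring.
by apply: cst_xsum_term; rewrite oppr_lt0.
Qed.

Let one_mx i j : cst_xsum neg ((1%:M : 'M[C]_n) i j) (fun x y => (1%:M - N x y) i j).
Proof.
apply: (@cst_xsum_ext _ _ _ (fun x y => (1%:M : 'M[C]_n) i j + -1 * N x y i j)).
  by move=> x y; rewrite !mxE mulN1r.
rewrite -[X in cst_xsum _ X]addr0; apply: cst_xsumD; first exact: cst_xsum_cst.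
by rewrite -[X in cst_xsum _ X](mulr0 (-1)); apply: cst_xsumM => //; exact: cst_xsum_cst.
Qed.

Lemma nu_xsum : exists2 L, freq_in neg L &
  forall x y, \det (1%:M - N x y) = 1 + xsum L x y.
Proof. by have := cst_xsum_det neg_add one_mx; rewrite det1. Qed.

(** A Neumann series cut at order Q: det (1 - N) times det (1 + N + ... + N^(Q-1)) is det (1 - N^Q),
    close to 1 uniformly in x because theta^Q tends to 0. The second determinant is a finite
    exponential sum. *)
Lemma nu_inverse : exists2 g, freq_in (fun l : R => l <= 0) g &
  forall x, normc (\det (1%:M - N x 0) * xsum g x 0 - 1) <= 8^-1.
Proof.
have [eta eta0 h_eta] := @det_near1 R n 8^-1 ltac:(lra).
(* [K] dominates every quotient of two weights, so theta^Q K bounds all squared entries of N^Q. *)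
pose K := \sum_i \sum_j (cauchy_den a sd j / cauchy_den a sd i).
have den0 i : 0 <= cauchy_den a sd i by rewrite ltW// (cauchy_den_gt0 d_lt a_lt).
have K0 : 0 <= K by rewrite sumr_ge0// => i _; rewrite sumr_ge0// => j _; rewrite divr_ge0.
have [Q hQ] : exists Q, theta ^+ Q * K <= eta ^+ 2.
  have e0 : 0 < eta ^+ 2 / (K + 1) by rewrite divr_gt0 ?exprn_gt0// ltr_wpDl.
  have := @cvg_expr R theta; rewrite ger0_norm// => /(_ theta_lt1)/cvgrPdist_le/(_ _ e0).
  move=> [Q _ /(_ Q (leqnn Q))] /=; rewrite sub0r normrN ger0_norm ?exprn_ge0// => hQ.
  exists Q; apply: (@le_trans _ _ (eta ^+ 2 / (K + 1) * K)); first by rewrite ler_wpM2r.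
  by rewrite mulrAC ler_pdivrMr ?ltr_wpDl// ler_wpM2l ?sqr_ge0//; lra.
pose c := \det (\sum_(m < Q) (0 : 'M[C]_n) ^+ m).
have [L aL hL] : cst_xsum neg c (fun x y => \det (\sum_(m < Q) N x y ^+ m)).
  apply: cst_xsum_det => // i j; rewrite summxE.
  apply: (@cst_xsum_ext _ _ _ (fun x y => \sum_(m < Q) (N x y ^+ m) i j)).
    by move=> x y; rewrite summxE.
  apply: cst_xsum_sum => // m; apply: cst_xsum_mx_exp => // k l; rewrite mxE; exact: N_xsum.
exists ((c, 0) :: L) => [|x].
  by rewrite /freq_in /= lexx; apply: sub_all aL => p; exact: ltW.
rewrite xsum_cons /= !mul0r expR0 expi0 !mulr1 -hL -det_mulmx.
have -> : (1%:M - N x 0) *m (\sum_(m < Q) N x 0 ^+ m) = 1%:M - N x 0 ^+ Q.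
  by rewrite -[RHS]opprB subrX1 -mulNr opprB.
apply: h_eta => i j; rewrite -(@ler_pXn2r _ 2)// ?nnegrE ?normc_ge0 ?(ltW eta0)//.
apply: le_trans (scaled_cauchyX_entry d_lt a_lt (gain_le x (lexx _)) _ Q i j) _ => //.
apply: le_trans hQ; rewrite ler_wpM2l ?exprn_ge0// /K (bigD1 i)//= (bigD1 j)//= -addrA lerDl.
rewrite addr_ge0// sumr_ge0// => k _; first by rewrite divr_ge0.
by rewrite sumr_ge0// => l _; rewrite divr_ge0.
Qed.

Let tau x := \det (phase_matrix eps su sd chi x t).

Let phase_matrixE x i j : phase_matrix eps su sd chi x t i j =
  - ((a i - sd j)^-1)%:C + (i == j)%:R * ((D i)%:C * ph i * expi (kap i * x)).
Proof.
rewrite mxE.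
have -> : kap i * (x - chi i - 2^-1 * (sd i + a i) * t) =
   - (kap i * (chi i + 2^-1 * (sd i + a i) * t)) + kap i * x by ring.
rewrite expiD; case: eqP => [<-|_]; last by rewrite !mul0r !addr0 mulrN1.
have -> : (D i)%:C = (Z i)%:C * ((a i - sd i)^-1)%:C :> C by exact: rmorphM.
rewrite !mul1r; ring.
Qed.

Lemma tau_nu x : tau x =
  \prod_i ((D i)%:C * ph i) * expi ((\sum_i kap i) * x) * \det (1%:M - N x 0).
Proof.
pose dE := \row_i ((D i)%:C * ph i * expi (kap i * x)).
rewrite /tau (_ : phase_matrix _ _ _ _ _ _ = diag_mx dE *m (1%:M - N x 0)); last first.
  apply/matrixP => i j; rewrite phase_matrixE mul_diag_mx !mxE mulrBr addrC; congr (_ - _).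
    by case: eqP => _; rewrite ?mulr1 ?mul1r ?mulr0 ?mul0r.
  rewrite /gain mulr0 expR0 mulr1.
  have h1 : (D i)%:C * (D i)^-1%:C = 1 :> C by rewrite -rmorphM divff ?gt_eqF.
  have h2 : ph i * (ph i)^* = 1 by rewrite mulcJ normc_expi expr1n.
  have h3 : expi (kap i * x) * expi (- kap i * x) = 1.
    by rewrite -expiD mulNr subrr expi0.
  transitivity ((D i)%:C * (D i)^-1%:C * (ph i * (ph i)^*) *
    (expi (kap i * x) * expi (- kap i * x)) * ((a i - sd j)^-1)%:C); last by ring.
  by rewrite h1 h2 h3 !mul1r.
rewrite det_mulmx det_diag; congr (_ * _).
rewrite (eq_bigr (fun i => ((D i)%:C * ph i) * expi (kap i * x))) => [|i _]; last by rewrite mxE.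
rewrite big_split /=; congr (_ * _).
rewrite mulr_suml; elim/big_rec2: _ => [|i u w _ ->]; first by rewrite expi0.
by rewrite expiD.
Qed.

Let K := \sum_i kap i.

(** This is where n > 0 enters: for n = 0 the sum is empty and v is constant. *)
Let K_gt0 : 0 < K.
Proof.
rewrite /K (bigD1 (Ordinal n_gt0))//=; apply: ltr_pwDl; first exact: kap_gt0.
by apply: sumr_ge0 => i _; rewrite ltW.
Qed.

(* The exponentials E_i carry positive frequencies, so the constant term of det M is
   the determinant of the Cauchy matrix, whereas nu = 1 would make det M a single
   exponential of frequency K > 0. *)
Lemma nu_nonconstant : ~ (forall x, \det (1%:M - N x 0) = 1).
Proof.
move=> nu1; pose c : 'M[C]_n := - \matrix_(i, j) ((a i - sd j)^-1)%:C.
have pos_add (u w : R) : 0 < u -> 0 < w -> 0 < u + w by move=> *; lra.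
have [L aL hL] : cst_xsum (fun l : R => 0 < l) (\det c) (fun x y => \det (\matrix_(i, j)
    (- ((a i - sd j)^-1)%:C + (i == j)%:R *
       ((D i)%:C * ph i * (expR (kap i * y))%:C * expi (kap i * x))) : 'M[C]_n)).
  apply: cst_xsum_det => // i j.
  apply: (@cst_xsum_ext _ _ _ (fun x y => - ((a i - sd j)^-1)%:C + (i == j)%:R *
       ((D i)%:C * ph i * (expR (kap i * y))%:C * expi (kap i * x)))) => [x y|].
    by rewrite mxE.
  rewrite !mxE -[X in cst_xsum _ X]addr0; apply: cst_xsumD; first exact: cst_xsum_cst.
  rewrite -[X in cst_xsum _ X](mulr0 (i == j)%:R); apply: cst_xsumM => //.
    exact: cst_xsum_cst.
  by apply: cst_xsum_term.
pose c0 := \prod_i ((D i)%:C * ph i).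
have := @xcoef_eq0 _ ((\det c, 0) :: L ++ [:: (- c0, K)]) _ 0.
rewrite !xcoef_cons xcoef_cat xcoef_cons /= eqxx (gt_eqF K_gt0).
rewrite (xcoef_out (P := fun l : R => 0 < l) aL) ?ltxx// /(xcoef [::]) big_nil !addr0.
move=> H; have : \det c != 0.
  rewrite /c -scaleN1r detZ mulf_neq0 ?(det_cauchy d_lt a_lt)//.
  by rewrite expf_neq0// oppr_eq0 oner_eq0.
case/negP; apply/eqP; apply: H => x.
rewrite xsum_cons xsum_cat xsum_cons /(xsum [::]) big_nil /= !mul0r !mulr0 !expR0 expi0.
rewrite !mulr1 addr0 addrA -hL mulNr; apply/eqP; rewrite subr_eq0; apply/eqP.
have := tau_nu x; rewrite nu1 mulr1 => <-.
by congr (\det _); apply/matrixP => i j; rewrite phase_matrixE mxE mulr0 expR0 mulr1.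
Qed.

Lemma multi_phase_structure : exists (A : R) (ps : seq C),
  [/\ ps != [::], forall p, p \in ps -> p != 0 /\ normc p < 1 &
  forall x, multi_phase eps su sd chi x t =
    A + 2 * eps * Re (\sum_(p <- ps) p * (expi x)^* / (1 - p * (expi x)^*))].
Proof.
have [L aL hL] := nu_xsum.
have nu0 x y : 0 <= y -> 1 + xsum L x y != 0 by move=> y0; rewrite -hL; exact: nu_neq0.
pose c0 := \prod_i ((D i)%:C * ph i).
have c00 : c0 != 0.
  apply/prodf_neq0 => i _; rewrite mulf_neq0 ?expi_neq0// -normc_gt0 normcR normr_gt0.
  by rewrite gt_eqF.
(* In det M = c0 e^{iKx} nu the constant c0 drops out of the logarithmic derivative and the
   exponential contributes i K. *)
have vE x : multi_phase eps su sd chi x t = s0 - \sum_i (a i - sd i)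
    + 2 * eps * (K + Im (xsum (xder L) x 0 / (1 + xsum L x 0))).
  rewrite /multi_phase; congr (_ + _ * _).
  have tE y : tau y = xsum (xmul [:: (c0, K)] ((1, 0) :: L)) y 0.
    rewrite tau_nu hL xsum_mul xsum_unit; congr (_ * _).
    by rewrite xsum_cons /(xsum [::]) big_nil /= mulr0 expR0 mulr1 addr0.
  rewrite -/(tau x) -[fun y => _]/tau (_ : tau = fun y => xsum (xmul [:: (c0, K)] ((1, 0) :: L)) y 0); last first.
    exact/funext.
  rewrite cderive1_xsum xsum_der_term xsum_mul xsum_unit xsum_der_unit.
  rewrite xsum_cons /(xsum [::]) big_nil /= mulr0 expR0 mulr1 addr0.
  have n0 := nu0 x 0 (lexx _).
  have e0 : expi (K * x) != 0 :> C by exact: expi_neq0.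
  rewrite (_ : _ / _ = 'i * K%:C + xsum (xder L) x 0 / (1 + xsum L x 0)).
    by rewrite ImD ImM /=; ring.
  by field; rewrite n0 c00 e0.
have [g ag hg] := nu_inverse.
have L_int mu : xcoef L mu != 0 -> exists m : nat, mu = - m%:R.
  move=> cmu; have mu0 : mu < 0.
    by apply: contraR cmu => nm; rewrite (xcoef_out (P := neg)).
  have e : expi (mu * (2 * pi)) = 1.
    apply: (xcoef_periodic aL ag _ _ _ cmu) => [x|x|x]; first exact: nu0.
      by rewrite -hL.
    have := v_per x; rewrite !vE => /addrI/(mulfI _)/addrI; apply.
    by rewrite mulf_neq0// gt_eqF.
  exists (Num.truncn (- mu)); apply: oppr_inj; rewrite opprK; apply: expi_2pi_eq1.
    by rewrite oppr_ge0 ltW.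
  by rewrite mulNr expiN e rmorph1.
have [T [T0 TE TD]] := xsum_poly aL L_int.
(* A nonzero W in the closed disc is e^{-y} e^{-ix} with y = - ln |W| >= 0, a point where 1 - N is
   invertible; at W = 0 the value is 1. *)
have T_disc W : normc W <= 1 -> T.[W] != 0.
  move=> W1; have [->|W0] := eqVneq W 0; first by rewrite T0 oner_eq0.
  have w0 : 0 < normc W by rewrite normc_gt0.
  have [x hx] : exists x, (W / (normc W)%:C)^* = expi x.
    by apply: expi_polar; rewrite normcJE normcM normcV normcR gtr0_norm// divff// gt_eqF.
  have -> : W = (expR (- - ln (normc W)))%:C * (expi x)^*.
    rewrite opprK lnK ?posrE// -hx conjCK mulrC divfK//.
    by rewrite -normc_gt0 normcR gtr0_norm.
  by rewrite -TE nu0// oppr_ge0 ln_le0.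
have sT : (1 < size T)%N.
  rewrite ltnNge; apply/negP => /size1_polyC eT; apply: nu_nonconstant => x.
  by rewrite hL TE eT hornerC -horner_coef0.
have [ps [ps0 psP psE]] := poly_unit_disc T0 T_disc sT.
exists (s0 - \sum_i (a i - sd i) + 2 * eps * K), ps; split=> // x.
rewrite vE mulrDr addrA; congr (_ + _ * _).
rewrite TD TE oppr0 expR0 mul1r.
have W1 : normc (expi x)^* <= 1 :> R by rewrite normcJE normc_expi.
rewrite -mulrA -[X in Im X]mulrA -mulrA psE ?T_disc//.
(* The factor - i of the derivative meets the minus sign of the sum, and Im (i z) = Re z. *)
rewrite mulrN mulrNN mulr_sumr ImM /= mul0r mul1r add0r; congr Re.
by apply: eq_bigr => p _; rewrite mulrCA mulrA.
Qed.

End MultiPhaseStructure.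

(** * Infinitely many gaps *)

Section PoissonSum.
Context {R : realType}.
Local Notation C := R[i].

(** The Taylor coefficients in w of z w / (1 - z w); [fact1 z] is its denominator. *)
Definition geom (z : C) (m : nat) : C := if m is k.+1 then z ^+ k.+1 else 0.

Definition fact1 (z : C) : {poly C} := (- z)%:P * 'X + 1%:P.

Lemma horner_fact1 z x : (fact1 z).[x] = 1 - z * x.
Proof. by rewrite /fact1 !hornerE addrC mulNr. Qed.

Lemma conv0s (y : nat -> C) h : conv (pseq 0) y h = 0.
Proof. by rewrite /conv big1// => j _; rewrite /pseq coef0 mul0r. Qed.

Lemma convC_const (c : C) y h : conv (pseq c%:P) y h = c * y h.
Proof.
have -> : c%:P = 0 * 'X + c%:P :> {poly C} by rewrite mul0r add0r.
by rewrite conv_mulX_addC; case: h => [|h]; rewrite /= ?conv0s add0r.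
Qed.

Lemma conv_geom z : conv (pseq (fact1 z)) (geom z) = pseq (z%:P * 'X).
Proof.
apply/funext => h; rewrite conv_mulX_addC mul1r /pseq coefMX coefC.
case: h => [|[|h]] /=; first by rewrite addr0.
  by rewrite convC_const mulr0 add0r expr1.
by rewrite convC_const mulNr -exprS addNr.
Qed.

Lemma conv_seq_sum (I : Type) (r : seq I) (x : nat -> C) (y : I -> nat -> C) h :
  conv x (fun k => \sum_(i <- r) y i k) h = \sum_(i <- r) conv x (y i) h.
Proof.
rewrite /conv; under eq_bigr do rewrite mulr_sumr.
by rewrite exchange_big.
Qed.

Lemma poisson_infinite_gaps (eps A : R) (zs : seq C) (V : R -> R) : 0 < eps ->
  zs != [::] -> (forall z, z \in zs -> z != 0 /\ normc z < 1) ->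
  (forall x, V x = A - 2 * eps * Re (\sum_(z <- zs) z * expi x / (1 - z * expi x))) ->
  infinite_set (gaps eps V).
Proof.
move=> eps_gt0 zs0 zsP VE.
have [rho [rho0 rho1 zs_rho]] : exists rho : R,
    [/\ 0 <= rho, rho < 1 & forall z, z \in zs -> normc z <= rho].
  elim: zs zsP {zs0 VE} => [|z s IH] h; first by exists 0; split; rewrite ?ltr01.
  have [r [r0 r1 hr]] := IH (fun y hy => h y (mem_behead (s := z :: s) hy)).
  exists (Num.max (normc z) r); split; first by rewrite le_max r0 orbT.
    by rewrite gt_max r1 (h z (mem_head _ _)).2.
  by move=> y; rewrite inE le_max => /predU1P[->|/hr ->]; rewrite ?lexx ?orbT.
(* Since 2 Re f = f + conj f, the coefficient of w^m in V for m >= 1 is - eps times the sum of the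
   z^m. *)
pose v m : C := if m is 0 then A%:C else - eps%:C * \sum_(z <- zs) z ^+ m.
have vE m : v m = pseq A%:C%:P m + \sum_(z <- zs) (- eps%:C) * geom z m.
  case: m => [|m] /=; rewrite /pseq coefC /=; first by rewrite big1 ?addr0// => z _; rewrite mulr0.
  by rewrite add0r mulr_sumr.
pose E N := 2 * eps * (size zs)%:R * rho ^+ N / (1 - rho).
have rho1' : 0 < 1 - rho by rewrite subr_gt0.
have z1 z x : z \in zs -> 1 - rho <= normc (1 - z * expi x).
  move=> zz; have := normcB_ge 1 (z * expi x); rewrite normc1 normcM normc_expi mulr1.
  by have := zs_rho _ zz; lra.
have V_approx N x : normc ((V x)%:C - trig_part v N x) <= E N.
  have cc (y : C) : y + y^* = (2 * Re y)%:C.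
    by case: y => a b; apply: complex_eqP => /=; ring.
  have vk m : v m.+1 * ket m.+1 x = - eps%:C * \sum_(z <- zs) (z * expi x) ^+ m.+1.
    rewrite /= /ket -mulrA mulr_suml; congr (_ * _).
    by apply: eq_bigr => z _; rewrite exprMn.
  have tr : trig_part v N x =
      (A - 2 * eps * Re (\sum_(z <- zs) \sum_(m < N) (z * expi x) ^+ m.+1))%:C.
    rewrite /trig_part exchange_big Re_sum mulr_sumr -sumrN rmorphD rmorph_sum.
    congr (_ + _); apply: eq_bigr => m _.
    by rewrite vk cc mulNr ReN ReZ mulrN mulrA.
  have -> : (V x)%:C - trig_part v N x =
      (- (2 * eps) * Re (\sum_(z <- zs) (z * expi x) ^+ N.+1 / (1 - z * expi x)))%:C.
    rewrite tr VE -rmorphB /=; congr (_%:C).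
    have -> : \sum_(z <- zs) z * expi x / (1 - z * expi x) =
        \sum_(z <- zs) \sum_(m < N) (z * expi x) ^+ m.+1 +
        \sum_(z <- zs) (z * expi x) ^+ N.+1 / (1 - z * expi x); last by rewrite ReD; ring.
    rewrite -big_split big_seq [RHS]big_seq.
    apply: eq_bigr => z zz; set y := z * expi x.
    have y0 : 1 - y != 0 by rewrite -normc_gt0 (lt_le_trans rho1')// z1.
    have gs : (1 - y) * \sum_(m < N) y ^+ m.+1 = y - y ^+ N.+1.
      elim: N {tr} => [|N IH]; first by rewrite big_ord0 mulr0 expr1 subrr.
      by rewrite big_ord_recr /= mulrDr IH !exprS; ring.
    apply: (mulfI y0); rewrite mulrDr gs mulrCA divff// mulr1 mulrCA divff// mulr1; ring.
  have -> : E N = 2 * eps * \sum_(z <- zs) (rho ^+ N / (1 - rho)).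
    by rewrite big_const_seq count_predT iter_addr_0 /E -[(_ / _) *+ _]mulr_natl !mulrA.
  rewrite normcR normrM normrN (gtr0_norm (x := 2 * eps)) ?mulr_gt0//.
  rewrite ler_wpM2l ?mulr_ge0 ?(ltW eps_gt0)//; apply: le_trans (normc_Re _) _.
  apply: le_trans (normc_sum _ _ _) _; rewrite big_seq [leRHS]big_seq.
  apply: ler_sum => z zz; rewrite normcM normcV normcXE normcM normc_expi mulr1.
  apply: ler_pM; rewrite ?exprn_ge0 ?invr_ge0 ?normc_ge0//.
    apply: (@le_trans _ _ (rho ^+ N.+1)).
      by rewrite lerXn2r// ?nnegrE ?normc_ge0// zs_rho.
    by rewrite exprS ler_piMl ?exprn_ge0// ltW.
  by rewrite lef_pV2 ?posrE ?z1// (lt_le_trans rho1')// z1.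
have E_lim : E @ \oo --> (0 : R).
  rewrite (_ : E = fun N => 2 * eps * (size zs)%:R / (1 - rho) * rho ^+ N); last first.
    by apply/funext => N; rewrite /E mulrAC.
  rewrite -(mulr0 (2 * eps * (size zs)%:R / (1 - rho))).
  by apply: cvgM; [exact: cvg_cst|apply: cvg_expr; rewrite ger0_norm].
have v_bound m : normc (v m) <= (`|A| + eps * (size zs)%:R) * rho ^+ m.
  have es : 0 <= eps * (size zs)%:R by rewrite mulr_ge0// ltW.
  case: m => [|m]; first by rewrite normcR expr0 mulr1 lerDl.
  rewrite /v normcM normcNE normcR gtr0_norm// mulrDl.
  apply: (@le_trans _ _ (eps * (size zs)%:R * rho ^+ m.+1)); last first.
    by rewrite lerDr mulr_ge0// exprn_ge0.
  rewrite -mulrA ler_wpM2l ?(ltW eps_gt0)//.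
  have -> : (size zs)%:R * rho ^+ m.+1 = \sum_(z <- zs) rho ^+ m.+1.
    by rewrite big_const_seq count_predT iter_addr_0 mulr_natl.
  apply: le_trans (normc_sum _ _ _) _; rewrite big_seq [leRHS]big_seq.
  by apply: ler_sum => z zz; rewrite normcXE lerXn2r// ?nnegrE ?normc_ge0// zs_rho.
(* [Q] takes each distinct z once and so has simple roots. The multiplicity of z0 reappears in
   F(1/z0) as [count_mem z0 zs], times the value U of the other factors, which is nonzero because
   they belong to other z. *)
pose s := undup zs.
pose Q := \prod_(y <- s) fact1 y.
pose Qz z := \prod_(y <- s | y != z) fact1 y.
have QE z : z \in zs -> Q = fact1 z * Qz z.
  by move=> zz; rewrite /Q (bigD1_seq z) ?mem_undup ?undup_uniq.
pose F := Q * A%:C%:P + \sum_(z <- zs) (- eps%:C)%:P * (Qz z * (z%:P * 'X)).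
have QF h : conv (pseq Q) v h = pseq F h.
  rewrite (_ : v = fun m => pseq A%:C%:P m + \sum_(z <- zs) (- eps%:C) * geom z m); last first.
    exact/funext.
  rewrite convDr -conv_pseqM /F pseqD; congr (_ + _).
  rewrite conv_seq_sum [RHS]/pseq coef_sum big_seq [RHS]big_seq; apply: eq_bigr => z zz.
  by rewrite convZr coefCM (QE z zz) [fact1 z * _]mulrC conv_pseqM convA conv_geom -conv_pseqM.
have [z0 z0s] : exists z0, z0 \in zs by case: (zs) zs0 => // z0 l _; exists z0; rewrite mem_head.
have z00 : z0 != 0 by case: (zsP _ z0s).
pose U := (Qz z0).[z0^-1].
have U0 : U != 0.
  rewrite /U /Qz horner_prod prodf_seq_neq0; apply/allP => y _; apply/implyP.
  by apply: contra; rewrite horner_fact1 subr_eq0 => /eqP/esym/divr1_eq ->.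
have f0 : (fact1 z0).[z0^-1] = 0 by rewrite horner_fact1 divff// subrr.
have Qb : Q.[z0^-1] = 0 by rewrite (QE _ z0s) hornerM f0 mul0r.
have Q'b : Q^`().[z0^-1] = - z0 * U.
  rewrite (QE _ z0s) derivM hornerD !hornerM f0 mul0r addr0; congr (_ * _).
  by rewrite /fact1 derivD derivM !derivC derivX !hornerE.
have Fb : F.[z0^-1] = - eps%:C * (count_mem z0 zs)%:R * U.
  rewrite hornerD hornerM Qb mul0r add0r horner_sum.
  rewrite (bigID (pred1 z0)) /= addrC big1 ?add0r => [|z zz0]; last first.
    rewrite !hornerM (_ : (Qz z).[_] = 0) ?mul0r ?mulr0//.
    apply/eqP; rewrite /Qz horner_prod prodf_seq_eq0; apply/hasP; exists z0.
      by rewrite mem_undup.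
    by rewrite eq_sym zz0 f0 /=.
  rewrite (eq_bigr (fun=> - eps%:C * U)) => [|z /eqP ->]; last first.
    by rewrite !hornerM !hornerC hornerX divff// mulr1.
  rewrite big_const_seq iter_addr_0 -mulr_natr; ring.
apply: (infinite_gaps eps_gt0 V_approx E_lim _ _ v_bound QF Qb).
- by rewrite /v conjcR.
- by rewrite rho0.
(* The quantity is - eps (j + mult) U; as the multiplicity of z0 is at least 1, it is nonzero
   already for j = 0. *)
move=> j; rewrite Q'b Fb.
have -> : eps%:C * j%:R * z0^-1 * (- z0 * U) + - eps%:C * (count_mem z0 zs)%:R * U =
    - (eps%:C * (j + count_mem z0 zs)%:R * U).
  by rewrite natrD; field.
rewrite oppr_eq0 !mulf_neq0//.
  by rewrite -normc_gt0 normcR gtr0_norm.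
by rewrite -normc_gt0 normc_nat ltr0n addn_gt0 orbC -has_count has_pred1 z0s.
Qed.

End PoissonSum.

Theorem proposition1p3p4 (R : realType) (eps : R) (n : nat)
    (su : 'I_n.+1 -> R) (sd chi : 'I_n -> R)
    (eps_gt0 : 0 < eps) (n_gt0 : (0 < n)%N) (s_ord : interlaced su sd)
    (v_per : forall x t : R,
       multi_phase eps su sd chi (x + 2 * pi) t = multi_phase eps su sd chi x t)
    (t : R) :
  n_star eps (fun x => - multi_phase eps su sd chi x t) = +oo%E.
Proof.
have [A [ps [ps0 psP psE]]] := multi_phase_structure eps_gt0 n_gt0 s_ord (v_per^~ t).
have : infinite_set (gaps eps (fun x => - multi_phase eps su sd chi x t)).
  apply: (@poisson_infinite_gaps R eps (- A) (map Num.conj ps)) => //.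
  - by case: (ps) ps0.
  - move=> _ /mapP[p /psP[p0 p1] ->]; split; last by rewrite normcJE.
    by rewrite conjC_eq0.
  (* Conjugation leaves the real part unchanged and turns p e^{-ix} into z e^{ix} with z the
     conjugate of p. *)
  move=> x; rewrite psE opprD big_map -[in LHS]ReJ conjc_sum; congr (_ - _ * Re _).
  apply: eq_bigr => p _.
  by rewrite !conjcM conjcV conjcB conjcM conjCK rmorph1.
by move=> inf; rewrite /n_star /counting; case: asboolP.
Qed.
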